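(* Let $\alpha \geq 1$ and $m \geq 3$ be integers. The digraph $K^*_{\alpha m}$ admits a resolvable decomposition into directed cycles of length $m$ (a $\vec{C}_m$-factorization) if and only if $(\alpha, m) \notin \{(1,6), (1,4), (2,3)\}$.
   Context: $K^*_n$ denotes the complete symmetric digraph on $n$ vertices: for any two distinct vertices $u,v$ both arcs $(u,v)$ and $(v,u)$ are present, and there are no loops. A $\vec{C}_m$-factor of a digraph $G$ is a spanning subdigraph that is a disjoint union of directed cycles of length $m$; a $\vec{C}_m$-factorization of $G$ is a partition of the arc set of $G$ into $\vec{C}_m$-factors. *)

(* Defs.v *)
From mathcomp Require Import all_boot.
Set Implicit Arguments. Unset Strict Implicit. Unset Printing Implicit Defensive.

Definition Kstar_arc (n : nat) (a : 'I_n * 'I_n) : bool := a.1 != a.2.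

Definition cycle_arcs (T : finType) (c : seq T) : {set T * T} :=
  [set a | [exists i : 'I_(size c),
     a == (nth a.1 c i, nth a.1 c ((i.+1) %% size c))]].

Definition is_dcycle (T : finType) (m : nat) (c : seq T) : bool :=
  (size c == m) && uniq c.

Definition is_Cm_factor (n m : nat) (F : seq (seq 'I_n)) : bool :=
  all (is_dcycle m) F && perm_eq (flatten F) (enum 'I_n)
  && all (fun c => [forall a in cycle_arcs c, Kstar_arc a]) F.

Definition factor_arcs (n : nat) (F : seq (seq 'I_n)) : {set 'I_n * 'I_n} :=
  \bigcup_(c <- F) cycle_arcs c.

Definition Cm_factorization (n m : nat) (L : seq (seq (seq 'I_n))) : Prop :=
  all (@is_Cm_factor n m) L /\
  forall a : 'I_n * 'I_n, Kstar_arc a ->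
    count (fun F => a \in factor_arcs F) L = 1.

(* Main.v *)
Require Import Defs.
From mathcomp Require Import all_boot.
From mathcomp Require Import zify.

(* Write the vertices as (label, column) with alpha labels and m columns.

   alpha = 1 asks for a directed Hamiltonian decomposition, obtained from a base path on a cyclic group
   together with one factor that collects an arc of each of its translates; alpha = 2 with m odd is
   treated in the same way.

   For even m, split each label into two halves: the 1-factors of K_(2 alpha) blow up to C_m-factors of
   the arcs between halves, and one 1-factor together with the arcs inside the halves blows up to copies
   of K*_m. For m = 4 and odd alpha one label is kept as a hole and frames are used instead.

   For odd m it is enough to decompose the arcs between distinct labels (E m alpha), the arcs inside a
   label being Hamiltonian. For a prime p > 3 dividing m, small alpha come from strips: tables on 5 columns,
   using column steps 0, 1, 2, in which a pair of columns can be inserted, so that they extend to p columns;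
   the other column steps are filled by scaled copies of a table using the step 1 only. All other alpha
   follow by Wilson's construction from truncated transversal designs. The only exception is alpha = 14,
   for which the labels are grouped in pairs. *)

Set Implicit Arguments. Unset Strict Implicit. Unset Printing Implicit Defensive.

(** A base path on a cyclic group has to use every nonzero difference once, so its ends differ by
    the sum of all nonzero elements. In a group of odd order this sum is 0 and the path would have
    to end where it starts; so the group must have even order. An odd number of vertices then leaves
    one point at infinity besides the group. An even number leaves two: infinity, fixed by the
    translations, and a point inserted afterwards into one arc of each translate. The arcs pushed
    out by the insertion must form the last factor together with that point, and this dictates which
    arcs the base paths have to contain.

    The exceptions disturb the general scheme. K*_6 has no Hamiltonian decomposition, so for m = 6
    two 1-factors, whose union is one long cycle of half-labels, are merged with the arcs inside the
    halves. K*_4 has none either, so for m = 4 and even alpha the copies of K*_8 on pairs of whole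
    labels take its place, and for odd alpha the hole can be filled only inside a larger
    ingredient. *)

(** * Factors as lists of cycles, and decompositions with prescribed arc multiplicities *)

Definition arcs (T : Type) (c : seq T) : seq (T * T) := zip c (rot 1 c).

Arguments arcs {T} c : simpl never.

Definition farcs (T : Type) (F : seq (seq T)) : seq (T * T) :=
  flatten [seq arcs c | c <- F].

Definition larcs (T : Type) (L : seq (seq (seq T))) : seq (T * T) :=
  flatten [seq farcs F | F <- L].

(** Vertex sets are predicates and coverage is a multiplicity, so that union, restriction and
    relabelling never leave the type [T]. *)
Definition is_fac (T : eqType) (m : nat) (V : pred T) (F : seq (seq T)) : Prop :=
  all (fun c => size c == m) F /\ forall x, count_mem x (flatten F) = V x.

(* [A x y] is the number of times the arc [(x, y)] is used. *)
Definition dec (T : eqType) (m k : nat) (V : pred T) (A : T -> T -> nat) : Prop :=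
  exists L : seq (seq (seq T)),
    [/\ size L = k, forall F, F \in L -> is_fac m V F
      & forall x y, count_mem (x, y) (larcs L) = A x y].

Section Arcs.
Variables (T U : eqType).
Implicit Types (c : seq T) (F : seq (seq T)) (L : seq (seq (seq T))).

Lemma arcs_map (f : T -> U) c :
  arcs (map f c) = [seq (f a.1, f a.2) | a <- arcs c].
Proof.
rewrite /arcs -map_rot; move: (rot 1 c) => d.
by elim: c d => [|x c IH] [|y d] //=; rewrite IH.
Qed.

Lemma farcs_map (f : T -> U) F :
  farcs (map (map f) F) = [seq (f a.1, f a.2) | a <- farcs F].
Proof.
rewrite /farcs map_flatten -!map_comp; congr flatten.
by apply: eq_map => c /=; rewrite arcs_map.
Qed.

Lemma larcs_map (f : T -> U) L :
  larcs (map (map (map f)) L) = [seq (f a.1, f a.2) | a <- larcs L].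
Proof.
rewrite /larcs map_flatten -!map_comp; congr flatten.
by apply: eq_map => c /=; rewrite farcs_map.
Qed.

Lemma farcs_cons c F : farcs (c :: F) = arcs c ++ farcs F.
Proof. by []. Qed.

Lemma farcs_cat F F' : farcs (F ++ F') = farcs F ++ farcs F'.
Proof. by rewrite /farcs map_cat flatten_cat. Qed.

Lemma larcs_cons F L : larcs (F :: L) = farcs F ++ larcs L.
Proof. by []. Qed.

Lemma larcs_cat L L' : larcs (L ++ L') = larcs L ++ larcs L'.
Proof. by rewrite /larcs map_cat flatten_cat. Qed.

Lemma arcs_mem c x y : (x, y) \in arcs c -> x \in c /\ y \in c.
Proof.
rewrite /arcs => /(nthP (x, y)) [i]; rewrite size_zip size_rot minnn => lti.
rewrite nth_zip ?size_rot // => -[<- <-].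
split; first exact: mem_nth.
by rewrite -(mem_rot 1); apply: mem_nth; rewrite size_rot.
Qed.

Lemma farcs_mem F x y : (x, y) \in farcs F -> x \in flatten F /\ y \in flatten F.
Proof.
case/flattenP => a /mapP [c cF ->] /arcs_mem [xc yc].
by split; apply/flattenP; exists c.
Qed.

End Arcs.

Section Dec.
Variable T : eqType.
Implicit Types (V W : pred T) (A B : T -> T -> nat) (m k : nat).

Lemma dec_ext m k V W A B :
  V =1 W -> A =2 B -> dec m k V A -> dec m k W B.
Proof.
move=> eVW eAB [L [sL FL cL]]; exists L; split=> // [F FinL|x y].
  by have [a b] := FL F FinL; split=> // x; rewrite b eVW.
by rewrite cL eAB.
Qed.

Lemma dec_nil m V : dec m 0 V (fun _ _ => 0).
Proof. by exists [::]. Qed.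

Lemma dec_add m k l V A B : dec m k V A -> dec m l V B ->
  dec m (k + l) V (fun x y => A x y + B x y).
Proof.
move=> [L [sL FL cL]] [M [sM FM cM]]; exists (L ++ M); split.
- by rewrite size_cat sL sM.
- by move=> F; rewrite mem_cat => /orP[/FL|/FM].
by move=> x y; rewrite larcs_cat count_cat cL cM.
Qed.

(** The i-th factors of the two families are concatenated; this is why the number [k] of factors is
    part of [dec] and must be the same on both sides. *)
Lemma dec_union m k V W A B : (forall x, V x -> ~~ W x) ->
  dec m k V A -> dec m k W B ->
  dec m k (fun x => V x || W x) (fun x y => A x y + B x y).
Proof.
move=> VW [L [sL FL cL]] [M [sM FM cM]].
have {}sM : size M = size L by rewrite sL.
(* The wanted multiplicities are rewritten through the two lists, which leaves a claim that can be
   proved by induction on both lists at once. *)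
have C x y : A x y + B x y =
    count_mem (x, y) (larcs L) + count_mem (x, y) (larcs M) by rewrite cL cM.
suff [N [sN FN cN]] : exists N : seq (seq (seq T)), [/\ size N = size L,
    forall F, F \in N -> is_fac m (fun x => V x || W x) F &
    forall x y, count_mem (x, y) (larcs N) =
      count_mem (x, y) (larcs L) + count_mem (x, y) (larcs M)].
  by exists N; split=> [|//|x y]; [rewrite sN|rewrite cN C].
elim: L M sM FL FM {sL cL cM C} => [|F L IH] [|G M] //= sM FL FM.
  by exists [::].
case: (IH M) => [|||N [sN FN cN]].
- by case: sM.
- by move=> H HL; apply: FL; rewrite inE HL orbT.
- by move=> H HL; apply: FM; rewrite inE HL orbT.
have [aF cF] := FL F (mem_head _ _); have [aG cG] := FM G (mem_head _ _).
exists ((F ++ G) :: N); split=> [/=|H|x y]; first by rewrite sN.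
  rewrite inE => /predU1P[->|/FN //]; split; first by rewrite all_cat aF.
  move=> x; rewrite flatten_cat count_cat cF cG.
  by case Vx: (V x) (VW x) => //= H1; rewrite (negPf (H1 _)).
by rewrite !larcs_cons farcs_cat !count_cat cN addnACA.
Qed.

Lemma dec_supp m k V A x y : dec m k V A -> A x y != 0 -> V x && V y.
Proof.
move=> [L [sL FL cL]]; rewrite -cL -lt0n -has_count has_pred1.
case/flattenP => a /mapP [F FinL ->] /farcs_mem.
have [_ cF] := FL F FinL.
by rewrite -!has_pred1 !has_count !cF; case: (V x) => [] [] //= _; case: (V y).
Qed.

Lemma dec_sum (I : eqType) (r : seq I) m (k : I -> nat) V (A : I -> T -> T -> nat) :
  (forall i, i \in r -> dec m (k i) V (A i)) ->
  dec m (\sum_(i <- r) k i) V (fun x y => \sum_(i <- r) A i x y).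
Proof.
elim: r => [|i r IH] H.
  by rewrite big_nil; apply: (dec_ext _ _ (dec_nil m V)) => // x y; rewrite big_nil.
rewrite big_cons.
apply: (dec_ext _ _ (dec_add (H i (mem_head _ _)) (IH _))) => // [x y|j jr].
  by rewrite big_cons.
by apply: H; rewrite inE jr orbT.
Qed.

Lemma dec_const m k : dec m k pred0 (fun _ _ : T => 0).
Proof.
exists (nseq k [::]); split; first by rewrite size_nseq.
  by move=> F; rewrite mem_nseq => /andP[_ /eqP->].
by move=> x y; rewrite /larcs map_nseq; elim: k.
Qed.

Lemma dec_bigunion (I : eqType) (r : seq I) m k (V : I -> pred T)
    (A : I -> T -> T -> nat) :
  uniq r -> (forall i j x, i \in r -> j \in r -> V i x -> V j x -> i = j) ->
  (forall i, i \in r -> dec m k (V i) (A i)) ->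
  dec m k (fun x => has (V^~ x) r) (fun x y => \sum_(i <- r) A i x y).
Proof.
elim: r => [|i r IH] /=.
  by move=> _ _ _; apply: (dec_ext _ _ (dec_const m k)) => // x y; rewrite big_nil.
move=> /andP[ir ur] dis H.
apply: (dec_ext _ _ (dec_union _ (H i (mem_head _ _)) (IH ur _ _))) => //.
- by move=> x y /=; rewrite big_cons.
- move=> x Vx; apply/hasPn => j jr; apply/negP => Vjx.
  move: ir; rewrite (dis i j x) ?mem_head ?jr //.
  by rewrite inE jr orbT.
- by move=> j j' x jr j'r; apply: dis; rewrite inE ?jr ?j'r orbT.
by move=> j jr; apply: H; rewrite inE jr orbT.
Qed.

End Dec.

Lemma count_map_in (T U : eqType) (f : T -> U) (V : pred T) (s : seq T) x :
  {in V &, injective f} -> {subset s <= V} -> x \in V ->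
  count_mem (f x) (map f s) = count_mem x s.
Proof.
move=> fI sV xV; rewrite count_map; apply: eq_in_count => y ys /=.
by apply/eqP/eqP => [/fI ->|->] //; apply: sV.
Qed.

(** Injectivity is asked on [V] only, which admits codings by quotient and remainder. The hypothesis
    on the support of [B] settles the pairs outside the image, about which the comparison of [A] and
    [B] on [V] says nothing; it usually comes from [dec_supp]. *)
Lemma dec_map (T U : eqType) (f : T -> U) m k (V : pred T) (W : pred U) A B :
  {in V &, injective f} ->
  (forall x, V x -> W (f x)) ->
  (forall y, W y -> exists2 x, V x & y = f x) ->
  (forall x y, V x -> V y -> B (f x) (f y) = A x y) ->
  (forall x y, B x y != 0 -> W x && W y) ->
  dec m k V A -> dec m k W B.
Proof.
move=> fI VW WV BA BW [L [sL FL cL]]; exists (map (map (map f)) L); split.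
- by rewrite size_map.
- move=> _ /mapP[F FinL ->]; have [aF cF] := FL F FinL.
  split; first by rewrite all_map; apply: sub_all aF => c /=; rewrite size_map.
  move=> y; rewrite -map_flatten.
  have sF : {subset flatten F <= V}.
    by move=> x; rewrite -has_pred1 has_count cF unfold_in; case: (V x).
  case Wy: (W y).
    have [x Vx ->] := WV y Wy.
    by rewrite (@count_map_in _ _ _ V) // cF Vx.
  apply/eqP; rewrite -leqn0 leqNgt -has_count has_pred1.
  apply/negP => /mapP[x /sF Vx ey]; move: Wy; rewrite ey VW //.
have sL2 : {subset larcs L <= [pred a | V a.1 && V a.2]}.
  case=> x y xy; have := @dec_supp _ m k V A x y; rewrite inE /=; apply.
    by exists L.
  by rewrite -cL -lt0n -has_count has_pred1.
move=> x y; rewrite larcs_map.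
have [E|nz] := eqVneq (B x y) 0; last first.
  have /andP[/WV[x' Vx ->] /WV[y' Vy ->]] := BW _ _ nz.
  rewrite BA // -cL.
  apply: (@count_map_in _ _ (fun a : T * T => (f a.1, f a.2))
            [pred a | V a.1 && V a.2] _ (x', y')) => //; last by rewrite inE /= Vx.
  by move=> [a b] [c d] /andP[/= Va Vb] /andP[/= Vc Vd] [/fI -> // /fI ->].
apply/eqP; rewrite E -leqn0 leqNgt -has_count has_pred1.
apply/negP => /mapP[[a b] ab [ex ey]].
have /andP[/= Va Vb] := sL2 _ ab.
move: E; rewrite ex ey BA // -cL => E.
by move: ab; rewrite -has_pred1 has_count E.
Qed.

Lemma cycle_arcsE (T : finType) (c : seq T) (a : T * T) :
  (a \in cycle_arcs c) = (a \in arcs c).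
Proof.
rewrite inE; apply/existsP/idP => [[i /eqP ->]|].
  move: (nat_of_ord i) (ltn_ord i) => {i} i lti.
  have szr : size c = size (rot 1 c) by rewrite size_rot.
  rewrite /arcs; set x := nth _ _ _; set y := nth _ _ _.
  apply/(nthP (a.1, a.1)); exists i; first by rewrite size_zip size_rot minnn.
  rewrite nth_zip // /x /y; congr (_, _).
  case: (c) lti => [//|z s] /= lti; rewrite rot1_cons nth_rcons.
  have [lt|] := ltnP i (size s); first by rewrite modn_small.
  (* Only the last index wraps around; its successor is the entry 0, which the rotation has moved to
     the end. *)
  move=> ge; have {lti ge} -> : i = size s by apply/eqP; rewrite eqn_leq ge andbT -ltnS.
  by rewrite eqxx modnn.
case: a => x y /(nthP (x, x)) [i]; rewrite size_zip size_rot minnn => lti.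
rewrite nth_zip ?size_rot // => -[ex ey].
exists (Ordinal lti); apply/eqP => /=; rewrite ex; congr (_, _).
rewrite -ey; case: (c) lti => [//|z s] /= lti; rewrite rot1_cons nth_rcons.
have [lt|] := ltnP i (size s); first by rewrite modn_small.
move=> ge; have {lti ge} -> : i = size s by apply/eqP; rewrite eqn_leq ge andbT -ltnS.
  by rewrite eqxx modnn.
Qed.

Lemma factor_arcsE n (F : seq (seq 'I_n)) a :
  (a \in factor_arcs F) = (a \in farcs F).
Proof.
rewrite /factor_arcs /farcs; elim: F => [|c F IH]; first by rewrite big_nil inE.
by rewrite big_cons inE cycle_arcsE IH mem_cat.
Qed.

Definition Kstar (n : nat) (x y : nat) : nat := [&& x < n, y < n & x != y].

(** The specification counts factors that contain an arc, whereas [dec] counts occurrences of the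
    arc; the two agree because a factor contains an arc at most once. *)
Lemma dec_factorization n m k :
  dec m k (fun x => x < n) (Kstar n) ->
  exists L : seq (seq (seq 'I_n)), Cm_factorization m L.
Proof.
case: n => [|n].
  by move=> _; exists [::]; split=> // -[[]].
move=> D.
have {D} [L [_ FL cL]] : dec m k predT (fun x y : 'I_n.+1 => x != y).
  apply: (dec_map (f := fun x => inord x) _ _ _ _ _ D) => //.
  - by move=> x y /= Hx Hy /(congr1 (@nat_of_ord _)); rewrite !inordK.
  - by move=> y _; exists (nat_of_ord y); rewrite ?ltn_ord ?inord_val.
  move=> x y Hx Hy; rewrite /Kstar Hx Hy /=; congr (nat_of_bool (~~ _)).
  by apply/eqP/eqP => [/(congr1 (@nat_of_ord _))|->] //; rewrite !inordK.
have perm F : F \in L -> perm_eq (flatten F) (enum 'I_n.+1).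
  move=> /FL[_ cF]; apply/allP => x _ /=.
  by rewrite cF count_uniq_mem ?enum_uniq // mem_enum inE.
exists L; split.
  apply/allP => F FinL; have [aF cF] := FL F FinL.
  have uF : uniq (flatten F) by rewrite (perm_uniq (perm F FinL)) enum_uniq.
  apply/andP; split; first (apply/andP; split; last exact: perm).
    apply/allP => c cF'; rewrite /is_dcycle (allP aF) //=.
    by move: uF; case/splitPr: cF' => s t; rewrite flatten_cat /= !cat_uniq => /and3P[_ _ /and3P[]].
  apply/allP => c cF'; apply/forallP => -[x y]; apply/implyP.
  rewrite cycle_arcsE => ac.
  suff : 0 < (x != y) by rewrite lt0b.
  rewrite -cL -has_count has_pred1; apply/flattenP; exists (farcs F).
    exact: map_f.
  by apply/flattenP; exists (arcs c) => //; apply: map_f.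
move=> [x y]; rewrite /Kstar_arc /= => xy.
have {xy}: count_mem (x, y) (larcs L) = 1 by rewrite cL xy.
rewrite /larcs => <-; rewrite count_flatten -map_comp sumnE big_map -sum1_count big_mkcond /=.
rewrite [LHS]big_seq [RHS]big_seq; apply: eq_bigr => F FinL.
rewrite factor_arcsE -has_pred1 has_count.
(* In a factor each vertex is the tail of exactly one arc. *)
suff : count_mem (x, y) (farcs F) <= 1 by case: (count _ _) => [|[|]].
have [_ cF] := FL F FinL.
have -> : 1 = count_mem x (flatten F) by rewrite cF.
have -> : flatten F = map fst (farcs F).
  rewrite /farcs map_flatten -map_comp; congr flatten.
  rewrite -[LHS]map_id; apply: eq_map => c /=.
  by rewrite /arcs -/(unzip1 _) unzip1_zip // size_rot.
by rewrite count_map; apply: sub_count => -[a b] /= /eqP [-> _].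
Qed.

(** * Inserting a vertex into an arc of a cycle *)

Section Insert.
Variable T : eqType.

Lemma arcs_rot n (c : seq T) : perm_eq (arcs (rot n c)) (arcs c).
Proof.
have zip_rot (s t : seq T) : size s = size t ->
    zip (rot n s) (rot n t) = rot n (zip s t).
  move=> st; rewrite /rot zip_cat; last by rewrite !size_drop st.
  congr (_ ++ _); last by elim: n s t {st} => [|k IH] [|x s] [|y t] //=; rewrite IH.
  elim: n s t st => [|k IH] [|x s] [|y t] //= [st].
  by rewrite IH.
have -> : arcs (rot n c) = rot n (arcs c).
  by rewrite /arcs -zip_rot ?size_rot // rot_rot.
by rewrite perm_rot.
Qed.

Lemma arcs_cons x (s : seq T) :
  arcs (x :: s) = rcons (zip (belast x s) s) (last x s, x).
Proof.
rewrite /arcs rot1_cons; move: {2 5}x => z.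
by elim: s x => [|y s IH] x //=; rewrite IH.
Qed.

(** The rotation turns [a] into the closing arc, so that a vertex put in front splits this arc and
    no other. *)
Definition insert_at (c : seq T) (a : T * T) v := v :: rot (index a (arcs c)).+1 c.

Lemma cycle_insert (c : seq T) a v : a \in arcs c ->
  [/\ size (insert_at c a v) = (size c).+1, perm_eq (insert_at c a v) (v :: c) &
    perm_eq (a :: arcs (insert_at c a v)) [:: (a.1, v), (v, a.2) & arcs c]].
Proof.
case: a => x y; rewrite /insert_at /= => xyc; set i := index _ _.
have lti : i < size (arcs c) by rewrite index_mem.
have ei : nth (x, y) (arcs c) i = (x, y) by apply: nth_index.
have szc : i < size c by move: lti; rewrite size_zip size_rot minnn.
case E: (rot i.+1 c) => [|w s].
  by move: szc; rewrite -(size_rot i.+1) E.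
have ac := arcs_rot i.+1 c; rewrite E in ac.
have sw : size (w :: s) = size c by rewrite -E size_rot.
have [ew el] : w = y /\ last w s = x.
  move: ei; rewrite nth_zip ?size_rot // => -[ex ey].
  have lw : last x (rot i.+1 c) = x.
    by rewrite /rot last_cat (take_nth x) // last_rcons ex.
  have hw : nth y (rot i.+1 c) 0 = y.
    rewrite -[RHS](_ : nth y (rot 1 c) i = y); last first.
      by rewrite -[RHS]ey; apply: set_nth_default; rewrite size_rot.
    case: (c) szc => [//|z t] /= szc; rewrite rot1_cons nth_rcons.
    have [lt|] := ltnP i (size t).
      by rewrite /rot nth_cat size_drop subn_gt0 ltnS lt nth_drop addn0.
    move=> ge; have {szc ge} -> : i = size t by lia.
    by rewrite eqxx rot_oversize.
  by move: lw hw; rewrite E.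
split.
- by rewrite -sw.
- by rewrite perm_cons -E perm_rot.
rewrite (permPr (_ : perm_eq _ [:: (x, v), (v, y) & arcs (w :: s)])); last first.
  by rewrite !perm_cons perm_sym.
rewrite !arcs_cons /= ew in el *; rewrite el.
rewrite -[rcons (zip _ _) _]cats1 -cats1.
apply/permP => p /=; rewrite !count_cat /=; lia.
Qed.
End Insert.

Lemma arcs_unzip1 (T : Type) (c : seq T) : unzip1 (arcs c) = c.
Proof. by rewrite /arcs unzip1_zip // size_rot. Qed.

Lemma arcs_unzip2 (T : Type) (c : seq T) : unzip2 (arcs c) = rot 1 c.
Proof. by rewrite /arcs unzip2_zip // size_rot. Qed.

Lemma farcs_unzip1 (T : Type) (F : seq (seq T)) : unzip1 (farcs F) = flatten F.
Proof.
rewrite /unzip1 /farcs map_flatten -map_comp; congr flatten.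
by rewrite -[RHS]map_id; apply: eq_map => c /=; rewrite -/(unzip1 _) arcs_unzip1.
Qed.

Lemma farcs_unzip2 (T : eqType) (F : seq (seq T)) :
  perm_eq (unzip2 (farcs F)) (flatten F).
Proof.
rewrite /farcs; elim: F => //= c F IH.
by rewrite /unzip2 map_cat -/(unzip2 _) -/(unzip2 _) arcs_unzip2 perm_cat // perm_rot.
Qed.

(** * Rotational decompositions: a cyclic group and one or two further points *)

(** Translation by [i] on Z_N, with [N] as the fixed point at infinity. Comparisons are used instead
    of remainders, so that [lia] can decide everything after case splits. *)
Definition tr (N i x : nat) : nat :=
  if x < N then (if x + i < N then x + i else x + i - N) else x.

Definition dif (N x y : nat) : nat := if x <= y then y - x else y + N - x.

Ltac iflia :=
  repeat match goal with |- context [if ?b then _ else _] =>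
    lazymatch b with
    | context [if _ then _ else _] => fail
    | _ => case: (boolP b) => ?
    end
  end; try move=> *; lia.

Definition fdiffs (N : nat) (s : seq (nat * nat)) : seq nat :=
  [seq dif N a.1 a.2 | a <- s & (a.1 < N) && (a.2 < N)].

Lemma sum_delta N i0 (Q : bool) :
  \sum_(i <- iota 0 N) ((i == i0) && Q : nat) = ((i0 < N) && Q : nat).
Proof.
case: Q; last by rewrite andbF big1_seq // => i _; rewrite andbF.
rewrite andbT (eq_bigr (fun i => if i == i0 then 1 else 0)); last first.
  by move=> i _; rewrite andbT; case: eqP.
by rewrite -big_mkcond sum1_count count_uniq_mem ?iota_uniq // mem_iota.
Qed.

(** At most one translation takes a finite end to a given place. Hence an arc between finite points
    meets each pair of the same difference once, and an arc at infinity meets each finite point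
    once. *)
Lemma tr_count N u w x y : u <= N -> w <= N -> x <= N -> y <= N ->
  \sum_(i <- iota 0 N) ((tr N i u, tr N i w) == (x, y) : nat) =
  if x < N then
    if y < N then [&& u < N, w < N & dif N u w == dif N x y] : nat
    else (u < N) && (w == N) : nat
  else if y < N then (u == N) && (w < N) : nat
  else (N * ((u == N) && (w == N)))%N.
Proof.
move=> uN wN xN yN.
have [xl|xg] := ltnP x N; last first.
  have {xg xN} -> : x = N by lia.
  have [yl|yg] := ltnP y N; last first.
    have {yg yN} -> : y = N by lia.
    rewrite (eq_big_seq (fun=> (u == N) && (w == N) : nat)).
      by rewrite big_const_seq count_predT size_iota iter_addn_0 mulnC.
    by move=> i; rewrite mem_iota xpair_eqE /tr => /andP[_ iN]; iflia.
  rewrite (eq_big_seq (fun i => (i == dif N w y) && ((u == N) && (w < N)) : nat)).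
    by rewrite sum_delta /dif; iflia.
  by move=> i; rewrite mem_iota xpair_eqE /tr /dif => /andP[_ iN]; iflia.
have [yl|yg] := ltnP y N; last first.
  have {yg yN} -> : y = N by lia.
  rewrite (eq_big_seq (fun i => (i == dif N u x) && ((u < N) && (w == N)) : nat)).
    by rewrite sum_delta /dif; iflia.
  by move=> i; rewrite mem_iota xpair_eqE /tr /dif => /andP[_ iN]; iflia.
rewrite (eq_big_seq (fun i => (i == dif N u x) &&
    [&& u < N, w < N & dif N u w == dif N x y] : nat)).
  by rewrite sum_delta /dif; iflia.
by move=> i; rewrite mem_iota xpair_eqE /tr /dif => /andP[_ iN]; iflia.
Qed.

Section Rotational.
Variables (N : nat) (F : seq (seq nat)).
Hypothesis N0 : 0 < N.
Hypothesis cF : forall x, count_mem x (flatten F) = (x <= N).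
Hypothesis dF : perm_eq (fdiffs N (farcs F)) (iota 1 N.-1).
Hypothesis nF : (N, N) \notin farcs F.

Let L := [seq map (map (tr N i)) F | i <- iota 0 N].

Lemma rot_fac i x : i < N -> count_mem x (flatten (map (map (tr N i)) F)) = (x <= N).
Proof.
move=> iN; rewrite -map_flatten.
have [xN|xN] := leqP x N; last first.
  apply/eqP; rewrite -leqn0 leqNgt -has_count has_pred1.
  apply/negP => /mapP[y]; rewrite -has_pred1 has_count cF /tr; iflia.
pose y := if x < N then (if i <= x then x - i else x + N - i) else x.
have -> : x = tr N i y by rewrite /tr /y; iflia.
rewrite (@count_map_in _ _ _ [pred z | z <= N]) ?cF; first by rewrite /y; iflia.
- by move=> a b; rewrite !inE /tr; iflia.
- by move=> z; rewrite -has_pred1 has_count cF inE lt0b.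
by rewrite inE /y; iflia.
Qed.

Lemma rot_count x y : count_mem (x, y) (larcs L) = Kstar N.+1 x y.
Proof.
have supp a : a \in farcs F -> a.1 <= N /\ a.2 <= N.
  by case: a => u w /farcs_mem; rewrite -!has_pred1 !has_count !cF !lt0b.
have [xN|xN] := leqP x N; last first.
  rewrite /Kstar ltnNge xN /=; apply/eqP; rewrite -leqn0 leqNgt -has_count has_pred1.
  apply/negP => /flattenP[s /mapP[G /mapP[i]]]; rewrite mem_iota => /andP[_ iN] -> ->.
  move=> /farcs_mem[]; rewrite -has_pred1 has_count rot_fac //; lia.
have [yN|yN] := leqP y N; last first.
  rewrite /Kstar [y < _]ltnNge yN /= andbF; apply/eqP; rewrite -leqn0 leqNgt -has_count has_pred1.
  apply/negP => /flattenP[s /mapP[G /mapP[i]]]; rewrite mem_iota => /andP[_ iN] -> ->.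
  move=> /farcs_mem[_]; rewrite -has_pred1 has_count rot_fac //; lia.
have -> : count_mem (x, y) (larcs L) =
    \sum_(a <- farcs F) \sum_(i <- iota 0 N) ((tr N i a.1, tr N i a.2) == (x, y) : nat).
  rewrite exchange_big /= /larcs /L count_flatten sumnE !big_map.
  apply: eq_bigr => i _; rewrite farcs_map count_map -sum1_count big_mkcond /=.
  by apply: eq_bigr => a _.
rewrite (eq_big_seq _ (fun a aF => tr_count (proj1 (supp a aF)) (proj2 (supp a aF)) xN yN)).
(* Exactly one base arc leaves infinity and exactly one enters it; their translates reach every
   finite point once. *)
have c1 : count (fun a => a.1 == N) (farcs F) = 1.
  by rewrite -(count_map fst (pred1 N)) -/(unzip1 _) farcs_unzip1 cF leqnn.
have c2 : count (fun a => a.2 == N) (farcs F) = 1.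
  rewrite -(count_map snd (pred1 N)) -/(unzip2 _) (permP (farcs_unzip2 F)) cF leqnn //.
rewrite /Kstar !ltnS xN yN /=.
have [xl|xg] := ltnP x N; have [yl|yg] := ltnP y N.
- have -> : \sum_(a <- farcs F) ([&& a.1 < N, a.2 < N & dif N a.1 a.2 == dif N x y] : nat) =
            count_mem (dif N x y) (fdiffs N (farcs F)).
    rewrite /fdiffs count_map count_filter -sum1_count [RHS]big_mkcond /=.
    by apply: eq_bigr => a _ /=; case: (a.1 < N); case: (a.2 < N); case: eqP.
  rewrite (permP dF) count_uniq_mem ?iota_uniq // mem_iota /dif; iflia.
- have -> : y = N by lia.
  have -> : nat_of_bool (x != N) = 1 by lia.
  rewrite -c2 -sum1_count [RHS]big_mkcond /=; apply: eq_big_seq => a aF.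
  have [a1 a2] := supp a aF; have : a != (N, N) by apply: contraNneq nF => <-.
  by case: a a1 a2 {aF} => u w /= uN wN; rewrite xpair_eqE; iflia.
- have -> : x = N by lia.
  have -> : nat_of_bool (N != y) = 1 by lia.
  rewrite -c1 -sum1_count [RHS]big_mkcond /=; apply: eq_big_seq => a aF.
  have [a1 a2] := supp a aF; have : a != (N, N) by apply: contraNneq nF => <-.
  by case: a a1 a2 {aF} => u w /= uN wN; rewrite xpair_eqE; iflia.
have -> : x = N by lia. have -> : y = N by lia.
rewrite eqxx big1_seq // => a /andP[_ aF].
have : a != (N, N) by apply: contraNneq nF => <-.
by case: a {aF} => u w; rewrite xpair_eqE => /negPf /= ->; rewrite muln0.
Qed.

Lemma rot_dec m : all (fun c => size c == m) F ->
  dec m N (fun x => x <= N) (Kstar N.+1).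
Proof.
move=> aF; exists L; split; [by rewrite size_map size_iota | | exact: rot_count].
move=> G /mapP[i]; rewrite mem_iota => /andP[_ iN] ->; split.
  by rewrite all_map; apply: sub_all aF => c /=; rewrite size_map.
by move=> x; rewrite rot_fac.
Qed.

End Rotational.

Section RotAdd.
Variables (N m : nat) (C : seq nat) (Fs : seq (seq nat)).
Variables (p0 : nat) (P : seq nat) (Ds : seq (seq nat)) (a : nat -> nat * nat).
Let F := C :: Fs.
Let v := N.+1.
Let R := zip (p0 :: P) P ++ farcs Ds.
Let rem i := (tr N i (a i).1, tr N i (a i).2).
Hypothesis N0 : 0 < N.
Hypothesis cF : forall x, count_mem x (flatten F) = (x <= N).
Hypothesis dF : perm_eq (fdiffs N (farcs F)) (iota 1 N.-1).
Hypothesis nF : (N, N) \notin farcs F.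
Hypothesis sC : (size C).+1 = m.
Hypothesis sFs : all (fun c => size c == m) Fs.
Hypothesis aC : forall i, i < N -> a i \in arcs C.
Hypothesis sP : (size P).+2 = m.
Hypothesis sDs : all (fun c => size c == m) Ds.
Hypothesis cD : perm_eq ((p0 :: P) ++ flatten Ds) (iota 0 N.+1).
Hypothesis RE : perm_eq R [seq rem i | i <- iota 0 N].

Let G i := insert_at (map (tr N i) C) (rem i) v :: map (map (tr N i)) Fs.

Let rem_in i : i < N -> rem i \in arcs (map (tr N i) C).
Proof. by move=> /aC; rewrite arcs_map => /(map_f (fun b => (tr N i b.1, tr N i b.2))). Qed.

(** Each translate gives up the arc [rem i] of its short cycle, in which the new point [v] is
    inserted. By [RE] the arcs given up form a path and the cycles [Ds]; the path closed through [v]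
    and these cycles make the one additional factor. The tails of the removed arcs are all points
    but the end of the path and the heads all points but its start, so [v] is joined once to every
    point in each direction. *)
Lemma rot_add_point : dec m N.+1 (fun x => x <= N.+1) (Kstar N.+2).
Proof.
have cx z : count_mem z ((p0 :: P) ++ flatten Ds) = (z <= N).
  by rewrite (permP cD) count_uniq_mem ?iota_uniq // mem_iota.
exists (((v :: p0 :: P) :: Ds) :: [seq G i | i <- iota 0 N]); split.
- by rewrite /= size_map size_iota.
- move=> H; rewrite inE => /predU1P[->|/mapP[i]].
    split; first by rewrite /= sP eqxx.
    by move=> x; have := cx x; rewrite /= /v; lia.
  rewrite mem_iota => /andP[_ iN] ->; rewrite {H}/G.
  have [] := cycle_insert v (rem_in iN); move: (insert_at _ _ _) => c' s1 s2 _.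
  split.
    rewrite /= s1 size_map sC eqxx all_map.
    by apply: sub_all sFs => c /=; rewrite size_map.
  move=> x; have := rot_fac N0 cF dF nF x iN.
  by rewrite /= !count_cat (permP s2) /= /v; lia.
(* Balance of arcs: the new factors together with the removed arcs are the old translates together
   with the arcs at [v]. *)
have key : perm_eq (R ++ larcs [seq G i | i <- iota 0 N])
   ([seq ((rem i).1, v) | i <- iota 0 N] ++ [seq (v, (rem i).2) | i <- iota 0 N]
    ++ larcs [seq map (map (tr N i)) F | i <- iota 0 N]).
  apply: (perm_trans (y := [seq rem i | i <- iota 0 N] ++ larcs [seq G i | i <- iota 0 N])).
    by rewrite perm_cat2r.
  have : forall i, i \in iota 0 N -> i < N by move=> i; rewrite mem_iota.
  elim: (iota 0 N) => [//|i r IH] H /=.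
  have iN : i < N by apply: H; rewrite mem_head.
  have {IH} /permP IH := IH (fun j jr => H j (mem_behead (s := i :: r) jr)).
  have [_ _ /permP s3] := cycle_insert v (rem_in iN).
  apply/permP => q; have := IH q; have := s3 q.
  rewrite !larcs_cons /farcs /= !count_cat /= ?count_cat; lia.
move=> x y; rewrite larcs_cons count_cat.
have -> : count_mem (x, y) (farcs ((v :: p0 :: P) :: Ds)) =
   ((v, p0) == (x, y)) + ((last p0 P, v) == (x, y)) + count_mem (x, y) R.
  rewrite farcs_cons arcs_cons /= -cats1 /R !count_cat /=.
  have <- : zip (belast p0 P) P = zip (p0 :: P) P.
    by elim: P p0 => [|z t IH] w //=; rewrite IH.
  by lia.
have := permP key (pred1 (x, y)); rewrite !count_cat (rot_count N0 cF dF nF) !count_map => key2.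
suff : ((v, p0) == (x, y)) + ((last p0 P, v) == (x, y))
   + count (preim (fun i => ((rem i).1, v)) (pred1 (x, y))) (iota 0 N)
   + count (preim (fun i => (v, (rem i).2)) (pred1 (x, y))) (iota 0 N) + Kstar N.+1 x y = Kstar N.+2 x y.
  by move=> <-; rewrite -[LHS]addnA key2 !addnA.
have uz (q : nat) : unzip1 (zip (q :: P) P) = belast q P.
  by elim: P q => [|z t IH] w //=; rewrite IH.
have uz2 (q : nat) : unzip2 (zip (q :: P) P) = P.
  by elim: P q => [|z t IH] w //=; rewrite IH.
(* Every point is left by one arc of the path or of [Ds], except the last point of the path, which
   is left by its closing arc to [v]. *)
have out z : count (fun i => (rem i).1 == z) (iota 0 N) + (last p0 P == z) = (z <= N).
  have -> : count (fun i => (rem i).1 == z) (iota 0 N) =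
            count (fun b => b.1 == z) [seq rem i | i <- iota 0 N] by rewrite count_map.
  rewrite -(permP RE) -(count_map fst (pred1 z)) /R map_cat -/(unzip1 _) -/(unzip1 _).
  rewrite uz farcs_unzip1 -cx !count_cat [p0 :: P]lastI -cats1 count_cat /=; lia.
have inn z : count (fun i => (rem i).2 == z) (iota 0 N) + (p0 == z) = (z <= N).
  have -> : count (fun i => (rem i).2 == z) (iota 0 N) =
            count (fun b => b.2 == z) [seq rem i | i <- iota 0 N] by rewrite count_map.
  rewrite -(permP RE) -(count_map snd (pred1 z)) /R map_cat -/(unzip2 _) -/(unzip2 _).
  rewrite uz2 -cx !count_cat (permP (farcs_unzip2 _)) /=; lia.
have lP : last p0 P <= N.
  have : last p0 P \in (p0 :: P) ++ flatten Ds by rewrite mem_cat mem_last.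
  by rewrite (perm_mem cD) mem_iota.
have p0N : p0 <= N.
  have : p0 \in (p0 :: P) ++ flatten Ds by rewrite mem_head.
  by rewrite (perm_mem cD) mem_iota.
have remN i : i < N -> (rem i).1 <= N /\ (rem i).2 <= N.
  move=> iN; have := rem_in iN; case/arcs_mem => h1 h2.
  have mr z : z \in map (tr N i) C -> z <= N.
    move=> zC; have : z \in flatten (map (map (tr N i)) F) by rewrite /= mem_cat zC.
    by rewrite -has_pred1 has_count rot_fac // lt0b.
  by split; apply: mr.
have -> : count (preim (fun i => ((rem i).1, v)) (pred1 (x, y))) (iota 0 N) =
   if y == v then count (fun i => (rem i).1 == x) (iota 0 N) else 0.
  rewrite -[RHS]mul1n; case: eqP => [->|ne].
    by rewrite mul1n; apply: eq_count => i /=; rewrite xpair_eqE eqxx andbT.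
  by rewrite (@eq_count _ _ pred0) ?count_pred0 // => i /=; rewrite xpair_eqE; lia.
have -> : count (preim (fun i => (v, (rem i).2)) (pred1 (x, y))) (iota 0 N) =
   if x == v then count (fun i => (rem i).2 == y) (iota 0 N) else 0.
  rewrite -[RHS]mul1n; case: eqP => [->|ne].
    by rewrite mul1n; apply: eq_count => i /=; rewrite xpair_eqE eqxx.
  by rewrite (@eq_count _ _ pred0) ?count_pred0 // => i /=; rewrite xpair_eqE; lia.
have := out x; have := inn y; rewrite !xpair_eqE /Kstar /v.
by iflia.
Qed.

End RotAdd.

Definition pdiffs (N : nat) (s : seq nat) : seq nat :=
  if s is x :: s' then pairmap (dif N) x s' else [::].

Lemma fdiffs_path N s : all (fun x => x < N) s ->
  fdiffs N (arcs (N :: s)) = pdiffs N s.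
Proof.
case: s => [|x s] /=; first by rewrite /fdiffs /arcs /= ltnn.
move=> /andP[xN sN]; rewrite arcs_cons /fdiffs filter_rcons /= ltnn andbF /=.
elim: s x xN sN => [//|y s IH] x xN /= /andP[yN sN].
by rewrite xN yN /= IH.
Qed.

Lemma fdiffs_cycle N x s : all (fun x => x < N) (x :: s) ->
  perm_eq (fdiffs N (arcs (x :: s))) (dif N (last x s) x :: pdiffs N (x :: s)).
Proof.
move=> sN; rewrite arcs_cons /fdiffs filter_rcons /=.
have -> : last x s < N by move/allP: sN; apply; apply: mem_last.
have xN : x < N by move: sN => /= /andP[].
rewrite xN /= map_rcons /= perm_rcons perm_cons.
move: sN => /= /andP[_].
elim: s x xN => [//|y s IH] x xN /= /andP[yN sN].
by rewrite xN yN /= perm_cons IH.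
Qed.

(** Since the lengths agree, it is enough to locate every value in the list; absence of repetitions
    is automatic. The symbolic families below are checked in this way, both for their points and for
    their differences. *)
Lemma perm_surj (s t : seq nat) :
  size s <= size t -> uniq t -> {subset t <= s} -> perm_eq s t.
Proof.
move=> st ut sub; rewrite perm_sym; apply: uniq_perm => //.
  exact: leq_size_uniq ut sub st.
by move=> x; have [_ ->] := uniq_min_size ut sub st.
Qed.

Lemma perm_count n (s : seq nat) : perm_eq s (iota 0 n) ->
  forall x, count_mem x s = (x < n).
Proof. by move=> /permP H x; rewrite H count_uniq_mem ?iota_uniq // mem_iota. Qed.

Lemma arcs_noloop (T : eqType) (c : seq T) x :
  1 < size c -> uniq c -> (x, x) \notin arcs c.
Proof.
case: c => [//|y s] s0 /andP[ys us]; rewrite arcs_cons mem_rcons inE negb_or.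
apply/andP; split.
  rewrite xpair_eqE; apply/negP => /andP[/eqP e1 /eqP e2].
  case: s s0 ys us e1 => //= z s _ ys _ e1.
  by move: ys; rewrite -e2 e1 mem_last.
elim: s y ys us {s0} => [//|z s IH] y /=; rewrite inE negb_or => /andP[yz ys] /andP[zs us].
rewrite inE negb_or IH // andbT xpair_eqE.
by apply: contraNN yz => /andP[/eqP <- ].
Qed.

(** * Base paths with distinct differences, and zigzags *)

Section RotPath.
Variables (N : nat) (s : seq nat).
Hypothesis N1 : 1 < N.
Hypothesis sP : perm_eq s (iota 0 N).
Hypothesis dP : perm_eq (pdiffs N s) (iota 1 N.-1).

Let sN : all (fun x => x < N) s.
Proof. by apply/allP => x; rewrite (perm_mem sP) mem_iota. Qed.

Lemma rot_path_count x : count_mem x (flatten [:: N :: s]) = (x <= N).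
Proof.
by rewrite /= cats0 (perm_count sP); case: ltngtP; lia.
Qed.

Lemma rot_path_diffs : perm_eq (fdiffs N (farcs [:: N :: s])) (iota 1 N.-1).
Proof. by rewrite farcs_cons cats0 fdiffs_path. Qed.

Lemma rot_path_noloop : (N, N) \notin farcs [:: N :: s].
Proof.
rewrite farcs_cons cats0; apply: arcs_noloop.
  by rewrite /= (perm_size sP) size_iota; lia.
by rewrite /= (perm_mem sP) mem_iota ltnn /= (perm_uniq sP) iota_uniq.
Qed.

(** The path visits every element of Z_N once and every nonzero difference once; closed through
    infinity it is a base factor with a single cycle. *)
Lemma rot_path_dec : dec N.+1 N (fun x => x <= N) (Kstar N.+1).
Proof.
apply: (rot_dec (F := [:: N :: s])).
- by lia.
- exact: rot_path_count.
- exact: rot_path_diffs.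
- exact: rot_path_noloop.
by rewrite /= (perm_size sP) size_iota eqxx.
Qed.
End RotPath.

(* The zigzag a, b, a+1, b-1, a+2, ... with 2k terms. *)
Fixpoint zig (a b k : nat) : seq nat :=
  if k is k'.+1 then [:: a, b & zig a.+1 b.-1 k'] else [::].

Lemma size_zig a b k : size (zig a b k) = k.*2.
Proof. by elim: k a b => //= k IH a b; rewrite IH doubleS. Qed.

Lemma mem_zig a b k v : k <= b.+1 ->
  (a <= v < a + k) || (b < v + k <= b + k) -> v \in zig a b k.
Proof.
elim: k a b => [|k IH] a b kb /= H; first by lia.
rewrite !inE; have [//|va] := eqVneq v a; have [//|vb] := eqVneq v b.
by rewrite IH //; lia.
Qed.

Lemma last_zig x a b k : 0 < k -> last x (zig a b k) = b - k.-1.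
Proof.
elim: k a b x => //= -[|k] IH a b x _ /=; first by lia.
by rewrite -[LHS]/(last b (zig a.+1 b.-1 k.+1)) IH //=; lia.
Qed.

Section ZigDiffs.
Variables (N x : nat).

Lemma dzig_head a b k : 0 < k -> dif N x a \in pairmap (dif N) x (zig a b k).
Proof. by case: k => //= k _; rewrite mem_head. Qed.

(** For [a] below [b] the forward steps are b - a, b - a - 2, ... and the backward steps, taken
    modulo N, are N - (b - a) + 1, N - (b - a) + 3, .... A difference is thus recognised by its
    range and its parity, here and in [dzig_down]. *)
Lemma dzig_up a b k d : a + k.*2 < b.+2 -> d <= b - a -> b - a < d + k.*2 ->
  (b - a - d) %% 2 = 0 -> d \in pairmap (dif N) x (zig a b k).
Proof.
elim: k a b x => [|k IH] a b y /= ab d1 d2 d3; first by lia.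
rewrite !inE; have [e|ne] := eqVneq d (b - a).
  by rewrite /dif (_ : a <= b) ?e ?eqxx ?orbT //; lia.
by rewrite IH ?orbT //; lia.
Qed.

Lemma dzig_down a b k d : a + k.*2 < b.+2 -> b < N ->
  N < d + (b - a) -> d + (b - a) + 2 < N + k.*2 ->
  (d + (b - a) - N) %% 2 = 1 -> d \in pairmap (dif N) x (zig a b k).
Proof.
elim: k a b x => [|k IH] a b y /= ab bN d1 d2 d3; first by lia.
rewrite !inE; have [e|ne] := eqVneq (d + (b - a)) N.+1.
  case: k ab d2 {IH} => [|k] ab d2; first by lia.
  rewrite /= inE /dif (_ : b <= a.+1 = false); last by lia.
  by rewrite (_ : a.+1 + N - b = d) ?eqxx ?orbT //; lia.
by rewrite IH ?orbT //; lia.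
Qed.

(** With [b] below [a] the roles are exchanged: the step from [a] to [b] wraps around and the step
    from [b] to the next entry does not. *)
Lemma dzig_down' a b k d : k <= b.+1 -> b < a -> a + k <= N ->
  d + (a - b) <= N -> N < d + (a - b) + k.*2 ->
  (N - (a - b) - d) %% 2 = 0 -> d \in pairmap (dif N) x (zig a b k).
Proof.
elim: k a b x => [|k IH] a b y /= kb ab aN d1 d2 d3; first by lia.
rewrite !inE; have [e|ne] := eqVneq (d + (a - b)) N.
  rewrite /dif [a <= b](_ : _ = false); last by lia.
  by rewrite (_ : b + N - a = d) ?eqxx ?orbT //; lia.
by rewrite IH ?orbT //; lia.
Qed.

Lemma dzig_up' a b k d : k <= b.+1 -> b < a ->
  a - b < d -> d + 2 < a - b + k.*2 ->
  (d - (a - b)) %% 2 = 1 -> d \in pairmap (dif N) x (zig a b k).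
Proof.
elim: k a b x => [|k IH] a b y /= kb ab d1 d2 d3; first by lia.
rewrite !inE; have [e|ne] := eqVneq d (a - b).+1.
  case: k kb d2 {IH} => [|k] kb d2; first by lia.
  rewrite /= inE /dif (_ : b <= a.+1); last by lia.
  by rewrite (_ : a.+1 - b = d) ?eqxx ?orbT //; lia.
by rewrite IH ?orbT //; lia.
Qed.

End ZigDiffs.

(** The list of differences cut at the boundaries of the blocks. A block owns the difference by
    which it is entered, hence the last point [x] of what precedes it. *)
Fixpoint ptoks (N x : nat) (ts : seq (seq nat)) : seq (seq nat) :=
  if ts is t :: ts' then pairmap (dif N) x t :: ptoks N (last x t) ts' else [::].

Lemma pairmap_flatten N x ts :
  pairmap (dif N) x (flatten ts) = flatten (ptoks N x ts).
Proof. by elim: ts x => //= t ts IH x; rewrite pairmap_cat IH. Qed.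

Lemma in_tok i (ts : seq (seq nat)) v : v \in nth [::] ts i -> v \in flatten ts.
Proof.
move=> H; apply/flattenP; exists (nth [::] ts i) => //; apply: mem_nth.
by rewrite ltnNge; apply/negP => le; rewrite nth_default in H.
Qed.

Lemma in_tokl i j v (ts : seq (seq nat)) :
  j < size (nth [::] ts i) -> v = nth 0 (nth [::] ts i) j -> v \in flatten ts.
Proof. by move=> lt ->; apply: (@in_tok i); apply: mem_nth. Qed.

Lemma arcs_flatten i j x a (ts : seq (seq nat)) : j.+1 < size (nth [::] ts i) ->
  a = (nth 0 (nth [::] ts i) j, nth 0 (nth [::] ts i) j.+1) ->
  a \in arcs (x :: flatten ts).
Proof.
move=> lt ->; rewrite arcs_cons mem_rcons inE; apply/orP; right.
elim: ts i x lt => [|t ts IH] [|i] x //= lt.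
  elim: t j x lt {IH} => [//|y t IHt] [|j] x lt /=.
    rewrite inE; apply/orP; right.
    by case: t lt {IHt} => [//|z t] _ /=; rewrite mem_head.
  by rewrite inE (IHt j y) ?orbT.
elim: t x => [|y t IHt] x /=; first exact: IH.
by rewrite inE IHt orbT.
Qed.

Lemma dzig_enter N x a b k d : 0 < k -> d = dif N x a -> d \in pairmap (dif N) x (zig a b k).
Proof. by move=> k0 ->; apply: dzig_head. Qed.

(** Sweeps the interval upwards: the values under [B] are located in the first branch, and in the
    second the old lower bound is replaced by [B]. *)
Ltac below v B :=
  match goal with H : is_true (_ <= v) |- _ => case: (ltnP v B) => ?; [|clear H] end.
Ltac parity v := have [?|?] : v %% 2 = 0 \/ v %% 2 = 1 by lia.
(** In these tactics [i] is the number of a block and [j] a position in it. [single] and [inzig]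
    locate a point; [jump], [enter] and [within] locate a difference, as an isolated one, as the
    entrance of a zigzag, or inside a zigzag. *)
Ltac single i j := rewrite inE; apply/orP; right; apply: (@in_tokl i j) => //=; lia.
Ltac inzig i := rewrite inE; apply/orP; right; apply: (@in_tok i); apply: mem_zig; lia.
Ltac jump i j := apply: (@in_tokl i j) => //=; rewrite ?last_zig /dif; iflia.
Ltac enter i := apply: (@in_tok i); apply: dzig_enter; rewrite /= ?last_zig /dif; iflia.
Ltac within i H := apply: (@in_tok i); apply: H; lia.

(** The classical zigzag 0, 1, N - 1, 2, N - 2, ..., N/2 has the differences 1, N - 2, 3, N - 4,
    ..., N - 1. *)
Lemma ham_odd k : 0 < k -> dec k.*2.+1 k.*2 (fun x => x < k.*2.+1) (Kstar k.*2.+1).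
Proof.
move=> k0; pose N := k.*2; pose ts := [:: zig 1 N.-1 k.-1; [:: k]].
have szs : size (0 :: flatten ts) = N.
  by rewrite /= !size_cat size_zig /=; lia.
apply: (@rot_path_dec N (0 :: flatten ts)); first by rewrite /N; lia.
  apply: perm_surj; rewrite ?iota_uniq ?szs ?size_iota // => v.
  rewrite mem_iota => /andP[lo hiN].
  have [->|v0] := eqVneq v 0; first exact: mem_head.
  have [vk|vk] := eqVneq v k; first by single 1 0.
  by inzig 0.
apply: perm_surj; rewrite ?iota_uniq ?size_iota /pdiffs ?size_pairmap //.
  by have := szs; rewrite /=; lia.
move=> d; rewrite mem_iota pairmap_flatten => dN.
have [k1|k1] := eqVneq k 1.
  have -> : d = 1 by rewrite /N k1 in dN; lia.
  by rewrite /ts /N k1.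
have [d1|d1] := eqVneq d 1; first by enter 0.
have [d2|d2] := eqVneq d N.-1; first by jump 1 0.
by parity d; [within 0 dzig_up|within 0 dzig_down].
Qed.
(** Here N = 2M with M = 2g + 14. Two zigzags absorb the growth with [g], and a fixed number of
    isolated entries supplies the differences they leave out. The two displayed arcs are (1, 2) and
    (M + 2, M + 5), wanted by [ham_path_ok]. *)
Lemma ham_family_even g : let N := 4 * g + 28 in
  let s := 0 :: flatten
    [:: [:: 2 * g + 17; 3; 4 * g + 25];
     zig (4) (4 * g + 24) (g + 1);
     [:: g + 6; g + 10; g + 8; g + 5; g + 11; g + 7; 3 * g + 23; 3 * g + 22; g + 9; 3 * g + 21];
     zig (g + 12) (3 * g + 20) (g + 1);
     [:: 2 * g + 13; 2 * g + 18; 4 * g + 27; 1; 2; 2 * g + 15; 4 * g + 26; 2 * g + 16; 2 * g + 19; 2 * g + 14]] in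
  [/\ perm_eq s (iota 0 N), perm_eq (pdiffs N s) (iota 1 N.-1),
     (1, 2) \in arcs s & (2 * g + 16, 2 * g + 19) \in arcs s].
Proof.
move=> N; move=> s.
have szs : size s = N by rewrite /N /=; do 9? rewrite ?size_cat ?size_zig /=; lia.
split; last 2 first.
- by apply: (@arcs_flatten 4 3).
- by apply: (@arcs_flatten 4 7).
- apply: perm_surj; rewrite ?iota_uniq ?szs ?size_iota // => v.
  rewrite mem_iota /N => /andP[lo hiN].
  below v (1); first by rewrite (_ : v = 0) ?mem_head //; lia.
  below v (2); first by single 4 3.
  below v (3); first by single 4 4.
  below v (4); first by single 0 1.
  below v (g + 5); first by inzig 1.
  below v (g + 6); first by single 2 3.
  below v (g + 7); first by single 2 0.
  below v (g + 8); first by single 2 5.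
  below v (g + 9); first by single 2 2.
  below v (g + 10); first by single 2 8.
  below v (g + 11); first by single 2 1.
  below v (g + 12); first by single 2 4.
  below v (2 * g + 13); first by inzig 3.
  below v (2 * g + 14); first by single 4 0.
  below v (2 * g + 15); first by single 4 9.
  below v (2 * g + 16); first by single 4 5.
  below v (2 * g + 17); first by single 4 7.
  below v (2 * g + 18); first by single 0 0.
  below v (2 * g + 19); first by single 4 1.
  below v (2 * g + 20); first by single 4 8.
  below v (3 * g + 21); first by inzig 3.
  below v (3 * g + 22); first by single 2 9.
  below v (3 * g + 23); first by single 2 7.
  below v (3 * g + 24); first by single 2 6.
  below v (4 * g + 25); first by inzig 1.
  below v (4 * g + 26); first by single 0 2.
  below v (4 * g + 27); first by single 4 6.
  by single 4 2.
rewrite -[pdiffs N s]/(pairmap (dif N) 0 (flatten _)).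
apply: perm_surj; rewrite ?iota_uniq ?size_iota ?size_pairmap //; first by rewrite -szs.
move=> v; rewrite mem_iota pairmap_flatten /N => /andP[lo hiN].
below v (2); first by jump 4 4.
below v (3); first by jump 4 3.
below v (4); first by jump 4 8.
below v (5); first by jump 2 1.
below v (6); first by jump 4 1.
below v (7); first by jump 2 4.
below v (8); first by enter 1.
below v (9); first by within 3 dzig_up.
below v (2 * g + 8); first by parity v; [within 3 dzig_up|within 1 dzig_down].
below v (2 * g + 9); first by within 3 dzig_up.
below v (2 * g + 10); first by jump 4 2.
below v (2 * g + 11); first by jump 2 0.
below v (2 * g + 12); first by jump 4 6.
below v (2 * g + 13); first by jump 2 9.
below v (2 * g + 14); first by jump 4 5.
below v (2 * g + 15); first by jump 0 1.
below v (2 * g + 16); first by jump 2 8.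
below v (2 * g + 17); first by jump 2 6.
below v (2 * g + 18); first by jump 0 0.
below v (2 * g + 19); first by jump 4 7.
below v (2 * g + 20); first by enter 3.
below v (2 * g + 21); first by within 1 dzig_up.
below v (4 * g + 20); first by parity v; [within 1 dzig_up|within 3 dzig_down].
below v (4 * g + 21); first by within 1 dzig_up.
below v (4 * g + 22); first by jump 4 0.
below v (4 * g + 23); first by jump 0 2.
below v (4 * g + 24); first by jump 4 9.
below v (4 * g + 25); first by jump 2 5.
below v (4 * g + 26); first by jump 2 3.
below v (4 * g + 27); first by jump 2 2.
by jump 2 7.
Qed.

(** The same shape for M = 2g + 15, again with the arcs (1, 2) and (M + 2, M + 5). *)
Lemma ham_family_odd g : let N := 4 * g + 30 in
  let s := 0 :: flatten
    [:: [:: 2 * g + 16; 4 * g + 29; 3; 4 * g + 27];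
     zig (4) (4 * g + 26) (g + 1);
     [:: g + 5; g + 11; g + 9; 3 * g + 24; g + 8; g + 10; g + 7; 3 * g + 25; g + 6; 3 * g + 23];
     zig (g + 12) (3 * g + 22) (g + 2);
     [:: 2 * g + 14; 2 * g + 19; 1; 2; 4 * g + 28; 2 * g + 18; 2 * g + 17; 2 * g + 20; 2 * g + 15]] in
  [/\ perm_eq s (iota 0 N), perm_eq (pdiffs N s) (iota 1 N.-1),
     (1, 2) \in arcs s & (2 * g + 17, 2 * g + 20) \in arcs s].
Proof.
move=> N; move=> s.
have szs : size s = N by rewrite /N /=; do 9? rewrite ?size_cat ?size_zig /=; lia.
split; last 2 first.
- by apply: (@arcs_flatten 4 2).
- by apply: (@arcs_flatten 4 6).
- apply: perm_surj; rewrite ?iota_uniq ?szs ?size_iota // => v.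
  rewrite mem_iota /N => /andP[lo hiN].
  below v (1); first by rewrite (_ : v = 0) ?mem_head //; lia.
  below v (2); first by single 4 2.
  below v (3); first by single 4 3.
  below v (4); first by single 0 2.
  below v (g + 5); first by inzig 1.
  below v (g + 6); first by single 2 0.
  below v (g + 7); first by single 2 8.
  below v (g + 8); first by single 2 6.
  below v (g + 9); first by single 2 4.
  below v (g + 10); first by single 2 2.
  below v (g + 11); first by single 2 5.
  below v (g + 12); first by single 2 1.
  below v (2 * g + 14); first by inzig 3.
  below v (2 * g + 15); first by single 4 0.
  below v (2 * g + 16); first by single 4 8.
  below v (2 * g + 17); first by single 0 0.
  below v (2 * g + 18); first by single 4 6.
  below v (2 * g + 19); first by single 4 5.
  below v (2 * g + 20); first by single 4 1.
  below v (2 * g + 21); first by single 4 7.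
  below v (3 * g + 23); first by inzig 3.
  below v (3 * g + 24); first by single 2 9.
  below v (3 * g + 25); first by single 2 3.
  below v (3 * g + 26); first by single 2 7.
  below v (4 * g + 27); first by inzig 1.
  below v (4 * g + 28); first by single 0 3.
  below v (4 * g + 29); first by single 4 4.
  by single 0 1.
rewrite -[pdiffs N s]/(pairmap (dif N) 0 (flatten _)).
apply: perm_surj; rewrite ?iota_uniq ?size_iota ?size_pairmap //; first by rewrite -szs.
move=> v; rewrite mem_iota pairmap_flatten /N => /andP[lo hiN].
below v (2); first by jump 4 3.
below v (3); first by jump 2 5.
below v (4); first by jump 4 7.
below v (5); first by jump 0 2.
below v (6); first by jump 4 1.
below v (7); first by jump 2 1.
below v (8); first by enter 1.
below v (9); first by within 3 dzig_up.
below v (2 * g + 8); first by parity v; [within 3 dzig_up|within 1 dzig_down].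
below v (2 * g + 9); first by within 3 dzig_up.
below v (2 * g + 10); first by jump 2 0.
below v (2 * g + 11); first by within 3 dzig_up.
below v (2 * g + 12); first by jump 2 8.
below v (2 * g + 13); first by jump 4 2.
below v (2 * g + 14); first by jump 0 1.
below v (2 * g + 15); first by jump 2 4.
below v (2 * g + 16); first by jump 2 3.
below v (2 * g + 17); first by jump 0 0.
below v (2 * g + 18); first by jump 2 9.
below v (2 * g + 19); first by jump 2 7.
below v (2 * g + 20); first by enter 3.
below v (2 * g + 21); first by jump 4 5.
below v (2 * g + 22); first by within 3 dzig_down.
below v (4 * g + 22); first by parity v; [within 1 dzig_up|within 3 dzig_down].
below v (4 * g + 23); first by within 1 dzig_up.
below v (4 * g + 24); first by jump 4 0.
below v (4 * g + 25); first by jump 0 3.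
below v (4 * g + 26); first by jump 4 8.
below v (4 * g + 27); first by jump 4 4.
below v (4 * g + 28); first by jump 2 6.
below v (4 * g + 29); first by jump 2 2.
by jump 4 6.
Qed.

(** The hypotheses of [rot_add_point] in decidable form; the i-th entry of [al] is the arc given up
    by the i-th translate, before translation. *)
Definition rot_table_ok N m C Fs p0 P Ds (al : seq (nat * nat)) : bool :=
  let F := C :: Fs in
  [&& perm_eq (flatten F) (iota 0 N.+1), perm_eq (fdiffs N (farcs F)) (iota 1 N.-1),
      (N, N) \notin farcs F, (size C).+1 == m, all (fun c => size c == m) Fs
    & [&& all (mem (arcs C)) al, size al == N, (size P).+2 == m,
      all (fun c => size c == m) Ds, perm_eq ((p0 :: P) ++ flatten Ds) (iota 0 N.+1)
    & perm_eq (zip (p0 :: P) P ++ farcs Ds)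
       [seq (tr N i (nth (0, 0) al i).1, tr N i (nth (0, 0) al i).2) | i <- iota 0 N]]].

Lemma rot_table N m C Fs p0 P Ds al : 0 < N -> rot_table_ok N m C Fs p0 P Ds al ->
  dec m N.+1 (fun x => x <= N.+1) (Kstar N.+2).
Proof.
move=> N0 /andP[c1 /andP[c2 /andP[c3 /andP[/eqP c4 /andP[c5]]]]].
case/andP=> c6 /andP[/eqP c7 /andP[/eqP c8 /andP[c9 /andP[c10 c11]]]].
apply: (rot_add_point N0 _ c2 c3 c4 c5 _ c8 c9 c10 c11).
  by move=> x; rewrite (perm_count c1).
by move=> i iN; apply: (allP c6); apply: mem_nth; rewrite c7.
Qed.

Lemma zip_map_iota (T : Type) (f : nat -> T) a n :
  zip (map f (iota a n.+1)) (map f (iota a.+1 n)) = [seq (f j, f j.+1) | j <- iota a n].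
Proof. by elim: n a => //= n IH a; rewrite -IH. Qed.

Lemma perm_map_iota n (f g : nat -> nat) : (forall i, i < n -> g i < n) ->
  (forall i, i < n -> f (g i) = i) -> perm_eq (map f (iota 0 n)) (iota 0 n).
Proof.
move=> gn fg; apply: perm_surj; rewrite ?iota_uniq ?size_map // => i.
rewrite mem_iota => /= lt; apply/mapP; exists (g i); rewrite ?mem_iota ?fg //=.
exact: gn.
Qed.

Ltac casesif :=
  repeat match goal with |- context [if ?b then _ else _] =>
    lazymatch b with
    | context [if _ then _ else _] => fail
    | _ => first [have -> : b = true by lia | have -> : b = false by lia
                 | case: (boolP b) => ?]; cbv beta iota
    end
  end.

(** * Hamiltonian decompositions for an even number of vertices *)

Section HamD.
Variable M : nat.
Let N := M.*2.

(** The path 0, 1, ..., M, M + 3, M + 4, ..., N - 1, infinity, M + 1, M + 2 to be formed by the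
    removed arcs: N - 3 steps of difference 1, one of difference 3 and two at infinity. *)
Definition ham_path_pt j := if j <= M then j else if j <= M.*2 - 3 then j + 2
  else if j == M.*2 - 2 then M.*2 else if j == M.*2 - 1 then M.+1 else M.+2.

(** The translate that gives up the j-th arc of this path. The step from j to j + 1 is a translate
    of (1, 2) by j - 1; the exceptional steps use the values that remain free. *)
Definition ham_shift j := if j == 0 then M.*2 - 1 else if j < M then j - 1
  else if j == M then M.*2 - 2 else if j < M.*2 - 3 then j.+1
  else if j == M.*2 - 3 then M.-1 else if j == M.*2 - 2 then M.+1 else M.

(** The arc (M + 2, M + 5) translated by N - 2 is the long step from M to M + 3; the arcs at
    infinity become the steps from N - 1 to infinity and from infinity to M + 1. *)
Definition ham_removed i := if i == M.*2 - 2 then (M + 2, M + 5)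
  else if i == M.+1 then (M.*2, 0) else if i == M.-1 then (M, M.*2) else (1, 2).

Hypothesis M5 : 5 < M.

Lemma ham_path_ptP : perm_eq (map ham_path_pt (iota 0 N.+1)) (iota 0 N.+1).
Proof.
apply: (perm_map_iota (g := fun i => if i <= M then i else if i == M.+1 then N - 1
  else if i == M.+2 then N else if i == N then N - 2 else i - 2)) => i;
  rewrite /ham_path_pt /N; casesif; lia.
Qed.

Lemma ham_shiftP : perm_eq (map ham_shift (iota 0 N)) (iota 0 N).
Proof.
apply: (perm_map_iota (g := fun i => if i == N - 1 then 0 else
   if i < M.-1 then i.+1 else if i == M.-1 then N - 3 else if i == M then N - 1
   else if i == M.+1 then N - 2 else if i == N - 2 then M else i.-1)) => i;
  rewrite /ham_shift /N; casesif; lia.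
Qed.

Lemma ham_removedE j : j < N ->
  (tr N (ham_shift j) (ham_removed (ham_shift j)).1,
   tr N (ham_shift j) (ham_removed (ham_shift j)).2) = (ham_path_pt j, ham_path_pt j.+1).
Proof.
rewrite /N => jN; rewrite /ham_shift; casesif; rewrite /ham_removed; casesif;
  rewrite /tr /ham_path_pt /=; casesif; congr (_, _); lia.
Qed.

End HamD.

Lemma ham_even_of_path M s : let N := M.*2 in 5 < M ->
  perm_eq s (iota 0 N) -> perm_eq (pdiffs N s) (iota 1 N.-1) ->
  (M, N) \in arcs (N :: s) -> (N, 0) \in arcs (N :: s) ->
  (1, 2) \in arcs (N :: s) -> (M + 2, M + 5) \in arcs (N :: s) ->
  dec N.+2 N.+1 (fun x => x <= N.+1) (Kstar N.+2).
Proof.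
move=> N M5 sP dP aM a0 a1 a2; have N1 : 1 < N by rewrite /N; lia.
apply: (@rot_add_point N N.+2 (N :: s) [::] (ham_path_pt M 0)
  (map (ham_path_pt M) (iota 1 N)) [::] (ham_removed M)).
- by lia.
- exact: rot_path_count.
- exact: rot_path_diffs.
- exact: rot_path_noloop.
- by rewrite /= (perm_size sP) size_iota.
- by [].
- by move=> i iN; rewrite /ham_removed; do 3 case: ifP => _ //.
- by rewrite size_map size_iota.
- by [].
- by rewrite cats0; apply: ham_path_ptP.
rewrite cats0 -[_ :: _]/(map (ham_path_pt M) (iota 0 N.+1)) zip_map_iota.
rewrite perm_sym -(permPl (perm_map _ (ham_shiftP M5))) -map_comp.
rewrite [X in perm_eq X _](_ : _ = [seq (ham_path_pt M j, ham_path_pt M j.+1) | j <- iota 0 N]) //.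
apply/eq_in_map => j; rewrite mem_iota => /andP[_ jN].
exact: ham_removedE.
Qed.

(** A path from 0 has no choice but to end at M, since 1 + ... + (2M - 1) is M modulo 2M. *)
Definition ham_path_ok M (s : seq nat) : bool :=
  [&& perm_eq s (iota 0 M.*2), perm_eq (pdiffs M.*2 s) (iota 1 (M.*2).-1),
      head 1 s == 0, last 0 s == M, (1, 2) \in arcs s & (M + 2, M + 5) \in arcs s].

(** A point put in front of a cycle destroys only the closing arc, the one that enters the former
    first point. *)
Lemma mem_arcs_cons (T : eqType) (x : T) s a :
  a \in arcs s -> a.2 != head x s -> a \in arcs (x :: s).
Proof.
case: s => [//|y s]; case: a => u w; rewrite !arcs_cons !mem_rcons !inE /=.
by move=> /orP[/eqP[_ ->]|-> _]; rewrite ?eqxx ?orbT.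
Qed.

Lemma ham_even_of_ok M s : 5 < M -> ham_path_ok M s ->
  dec (M.*2).+2 (M.*2).+1 (fun x => x < (M.*2).+2) (Kstar (M.*2).+2).
Proof.
move=> M5 /andP[sP /andP[dP /andP[h0 /andP[lM /andP[a1 a2]]]]].
case: s h0 lM a1 a2 sP dP => [|x s] /eqP //= -> /eqP lM a1 a2 sP dP.
apply: (ham_even_of_path M5 sP dP).
- by rewrite arcs_cons mem_rcons inE /= lM eqxx.
- by rewrite arcs_cons mem_rcons /= inE orbC inE eqxx.
- exact: mem_arcs_cons.
apply: mem_arcs_cons => //=; lia.
Qed.

(** Paths for M = 6, ..., 13, which lie below the two families. *)
Definition ham_table : seq (seq nat) :=
  [:: [:: 0; 8; 11; 10; 5; 7; 4; 9; 3; 1; 2; 6];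
     [:: 0; 9; 12; 5; 13; 11; 1; 2; 4; 10; 6; 3; 8; 7];
     [:: 0; 12; 9; 15; 1; 2; 11; 6; 14; 3; 10; 13; 7; 5; 4; 8];
     [:: 0; 15; 10; 6; 4; 8; 1; 2; 7; 17; 11; 14; 16; 5; 13; 12; 3; 9];
     [:: 0; 16; 4; 9; 1; 2; 6; 3; 18; 8; 17; 19; 12; 15; 13; 7; 14; 5; 11; 10];
     [:: 0; 6; 8; 17; 13; 16; 4; 19; 18; 12; 9; 1; 2; 15; 20; 10; 5; 3; 14; 21; 7; 11];
     [:: 0; 16; 9; 6; 11; 13; 20; 4; 10; 8; 23; 19; 18; 5; 14; 17; 21; 7; 1; 2; 15; 3; 22; 12];
     [:: 0; 10; 16; 21; 3; 23; 1; 2; 4; 17; 8; 15; 18; 14; 11; 9; 20; 6; 22; 5; 19; 12; 7; 25; 24; 13]].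

(** For M = 3, 4, 5 there is no room for the uniform choice of removed arcs, so these three cases
    have removed arcs of their own. *)
Lemma ham_8 : dec 8 7 (fun x => x <= 7) (Kstar 8).
Proof.
exact: (@rot_table 6 8 [:: 6; 0; 1; 5; 2; 4; 3] [::] 0 [:: 1; 3; 5; 6; 4; 2] [::]
  [:: (0, 1); (2, 4); (3, 6); (1, 5); (6, 0); (2, 4)]).
Qed.

Lemma ham_10 : dec 10 9 (fun x => x <= 9) (Kstar 10).
Proof.
exact: (@rot_table 8 10 [:: 8; 0; 1; 7; 2; 6; 3; 5; 4] [::] 0 [:: 6; 7; 1; 2; 3; 4; 8; 5] [::]
  [:: (4, 8); (0, 1); (0, 1); (0, 1); (3, 5); (8, 0); (0, 1); (1, 7)]).
Qed.

Lemma ham_12 : dec 12 11 (fun x => x <= 11) (Kstar 12).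
Proof.
exact: (@rot_table 10 12 [:: 10; 0; 1; 9; 2; 8; 3; 7; 4; 6; 5] [::]
  0 [:: 1; 7; 8; 9; 3; 4; 5; 6; 10; 2] [::]
  [:: (0, 1); (5, 10); (10, 0); (0, 1); (0, 1); (0, 1); (3, 7); (0, 1); (0, 1); (2, 8)]).
Qed.

Theorem ham n : 2 < n -> n != 4 -> n != 6 -> dec n n.-1 (fun x => x < n) (Kstar n).
Proof.
move=> n2 n4 n6; have [odn|evn] := boolP (odd n).
  have -> : n = (n./2).*2.+1 by lia.
  by apply: ham_odd; lia.
(* The vertices are Z_(2M), infinity and the inserted point. *)
have [M ?] : exists M, n = (M.*2).+2 by exists (n./2).-1; lia.
subst n.
have [->|M3] := eqVneq M 3; first exact: ham_8.
have [->|M4] := eqVneq M 4; first exact: ham_10.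
have [->|M5] := eqVneq M 5; first exact: ham_12.
have M6 : 5 < M by lia.
have [M14|M14] := ltnP M 14.
  apply: (@ham_even_of_ok _ (nth [::] ham_table (M - 6))) => //.
  have : M - 6 < 8 by lia.
  have {2}-> : M = (M - 6) + 6 by lia.
  by move: (M - 6) => k; do 8 (case: k => [|k]; first by vm_compute).
pose g := (M - 14)./2.
have [oM|eM] := boolP (odd M).
  have -> : M = 2 * g + 15 by rewrite /g; lia.
  have [c1 c2 c3 c4] := ham_family_odd g.
  have e : 4 * g + 30 = (2 * g + 15).*2 by lia.
  rewrite e in c1 c2.
  apply: (ham_even_of_ok _ (s := _)); first by lia.
  apply/and5P; split; [exact: c1|exact: c2|by []| |].
    by rewrite /=; do 9? rewrite ?last_cat /=; lia.
  have -> : 2 * g + 15 + 2 = 2 * g + 17 by lia.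
  have -> : 2 * g + 15 + 5 = 2 * g + 20 by lia.
  by rewrite c3 c4.
have -> : M = 2 * g + 14 by rewrite /g; lia.
have [c1 c2 c3 c4] := ham_family_even g.
have e : 4 * g + 28 = (2 * g + 14).*2 by lia.
rewrite e in c1 c2.
apply: (ham_even_of_ok _ (s := _)); first by lia.
apply/and5P; split; [exact: c1|exact: c2|by []| |].
  by rewrite /=; do 9? rewrite ?last_cat /=; lia.
have -> : 2 * g + 14 + 2 = 2 * g + 16 by lia.
have -> : 2 * g + 14 + 5 = 2 * g + 19 by lia.
by rewrite c3 c4.
Qed.

(* Over Z_N with N = 4h: a path (0 :: flatten ts1) closed up through infinity, and a cycle (c :: flatten ts2). *)
Definition r2_ok h (ts1 : seq (seq nat)) c (ts2 : seq (seq nat)) : Prop :=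
  let N := 4 * h in
  [/\ size (flatten ts1) = 2 * h - 2,
      perm_eq (flatten ([:: 0] :: ts1 ++ [:: c] :: ts2)) (iota 0 N),
      perm_eq (flatten (ptoks N 0 ts1 ++ [:: dif N (last c (flatten ts2)) c] :: ptoks N c ts2))
        (iota 1 N.-1),
      prefix [:: 1; N - 1] (flatten ts1) && (last 0 (flatten ts1) == 2 * h)
    & (2 * h + 2, 2 * h + 4) \in arcs (0 :: flatten ts1)].

(** * Base factors of two cycles: alpha = 2 and m odd *)

Lemma arcs_map_iota (T : Type) (f : nat -> T) n :
  arcs (map f (iota 0 n.+1)) = rcons [seq (f j, f j.+1) | j <- iota 0 n] (f n, f 0).
Proof.
have H a x : zip (map f (iota a n.+1)) (rcons (map f (iota a.+1 n)) x) =
    rcons [seq (f j, f j.+1) | j <- iota a n] (f (a + n), x).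
  elim: n a => [|n IH] a /=; first by rewrite addn0.
  by congr (_ :: _); rewrite addnS -addSn; exact: IH.
by rewrite /arcs /= rot1_cons -[_ :: _]/(map f (iota 0 n.+1)) H.
Qed.

Lemma eq_map_iota (T : Type) a b n (f g : nat -> T) :
  (forall i, i < n -> f (a + i) = g (b + i)) -> map f (iota a n) = map g (iota b n).
Proof.
elim: n a b => //= n IH a b H; congr (_ :: _).
  by have := H 0 isT; rewrite !addn0.
by apply: IH => i lt; rewrite !addSnnS; apply: H.
Qed.

Section R2D.
Variable h : nat.
Hypothesis h3 : 3 < h.
Let N := 4 * h.

(** The removed arcs form the path 2h - 2, 2h - 1, ..., N - 3 of steps 1 and this cycle: infinity,
    0, N - 2, N - 1, 1, 2, ..., 2h - 3. *)
Definition r2_cycle_pt j := if j == 0 then 4 * h else if j == 1 then 0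
  else if j == 2 then 4 * h - 2 else if j == 3 then 4 * h - 1 else j - 3.

(** Apart from the translates of (0, 1) there are four arcs: two at infinity, (1, N - 1) giving the
    step from 0 to N - 2, and (2h + 2, 2h + 4) giving the step from N - 1 to 1. *)
Definition r2_removed i := if i == 0 then (4 * h, 0) else if i == 4 * h - 1 then (1, 4 * h - 1)
  else if i == 2 * h - 3 then (2 * h + 2, 2 * h + 4)
  else if i == 4 * h - 3 then (2 * h, 4 * h) else (0, 1).

Definition r2_shift j := if j < 2 * h - 1 then 2 * h - 2 + j
  else if j == 2 * h - 1 then 0 else if j == 2 * h then 4 * h - 1
  else if j == 2 * h + 1 then 4 * h - 2 else if j == 2 * h + 2 then 2 * h - 3
  else if j == 4 * h - 1 then 4 * h - 3 else j - (2 * h + 2).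

Lemma r2_shiftP : perm_eq (map r2_shift (iota 0 N)) (iota 0 N).
Proof.
apply: (perm_map_iota (g := fun i => if i == 0 then 2 * h - 1 else if i == 4 * h - 1 then 2 * h
  else if i == 4 * h - 2 then 2 * h + 1 else if i == 2 * h - 3 then 2 * h + 2
  else if i == 4 * h - 3 then 4 * h - 1 else if i < 2 * h - 3 then i + (2 * h + 2)
  else i - (2 * h - 2))) => i; rewrite /r2_shift /N; casesif; lia.
Qed.

(** The j-th removed arc: first along the path, then around the cycle, with the return to infinity
    at the end. *)
Let dst j := if j < 2 * h - 1 then (2 * h - 2 + j, 2 * h - 2 + j.+1)
  else if j == 4 * h - 1 then (2 * h - 3, 4 * h)
  else (r2_cycle_pt (j - (2 * h - 1)), r2_cycle_pt (j - (2 * h - 1)).+1).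

Lemma r2_removedE j : j < N ->
  (tr N (r2_shift j) (r2_removed (r2_shift j)).1,
   tr N (r2_shift j) (r2_removed (r2_shift j)).2) = dst j.
Proof.
rewrite /N => jN; rewrite /r2_shift; casesif; rewrite /r2_removed; casesif;
  rewrite /tr /dst /r2_cycle_pt /=; casesif; congr (_, _); lia.
Qed.

Lemma r2_removed_perm :
  perm_eq (zip (map (addn (2 * h - 2)) (iota 0 (2 * h - 1).+1))
               (map (addn (2 * h - 2)) (iota 1 (2 * h - 1)))
           ++ farcs [:: map r2_cycle_pt (iota 0 (2 * h).+1)])
   [seq (tr N i (r2_removed i).1, tr N i (r2_removed i).2) | i <- iota 0 N].
Proof.
rewrite perm_sym -(permPl (perm_map _ r2_shiftP)) -map_comp.
rewrite (_ : [seq _ | j <- iota 0 N] = map dst (iota 0 N)); last first.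
  by apply/eq_in_map => j; rewrite mem_iota => /andP[_ jN]; apply: r2_removedE.
have -> : N = (2 * h - 1) + (2 * h + 1) by rewrite /N; lia.
rewrite farcs_cons cats0 arcs_map_iota zip_map_iota (iotaD 0 (2 * h - 1)) (iotaD _ (2 * h) 1).
rewrite !map_cat cats1 add0n.
rewrite (@eq_map_iota _ 0 0 (2 * h - 1) dst (fun j => (2 * h - 2 + j, 2 * h - 2 + j.+1))).
  rewrite perm_cat2l /=.
  rewrite (@eq_map_iota _ (2 * h - 1) 0 (2 * h) dst (fun j => (r2_cycle_pt j, r2_cycle_pt j.+1))).
    have -> : dst (2 * h - 1 + 2 * h) = (r2_cycle_pt (2 * h), r2_cycle_pt 0).
      by rewrite /dst /r2_cycle_pt; casesif; congr (_, _); lia.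
    by [].
  move=> i ih; rewrite /dst (_ : 2 * h - 1 + i - (2 * h - 1) = 0 + i); last by lia.
  by casesif.
by move=> i ih; rewrite /dst !add0n; casesif.
Qed.

Lemma r2_cover :
  perm_eq (map (addn (2 * h - 2)) (iota 0 (2 * h - 1).+1)
           ++ flatten [:: map r2_cycle_pt (iota 0 (2 * h).+1)]) (iota 0 N.+1).
Proof.
rewrite [flatten _]cats0; apply: perm_surj; rewrite ?iota_uniq //.
  by rewrite size_cat !size_map !size_iota /N; lia.
move=> x; rewrite mem_iota => /andP[_ xN]; rewrite mem_cat.
have [lo|hi] := boolP (2 * h - 2 <= x < N - 2).
  apply/orP; left; apply/mapP; exists (x - (2 * h - 2)); last by lia.
  by rewrite mem_iota; lia.
apply/orP; right; apply/mapP.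
exists (if x == 4 * h then 0 else if x == 0 then 1 else if x == 4 * h - 2 then 2
  else if x == 4 * h - 1 then 3 else x + 3); rewrite ?mem_iota /r2_cycle_pt /N in xN hi *; casesif; lia.
Qed.

End R2D.

(** The end 2h of the path is forced as in the Hamiltonian case: all differences together sum to
    N/2, and those of the cycle that avoids infinity sum to 0. *)
Lemma r2_of_ok h (N := 4 * h) ts1 c ts2 : 3 < h -> r2_ok h ts1 c ts2 ->
  dec (2 * h).+1 N.+1 (fun x => x <= N.+1) (Kstar N.+2).
Proof.
move=> h3; case=> s1; rewrite -/N => vP dP /andP[/prefixP[s s1E] /eqP l1] aD.
have {}vP : perm_eq ((0 :: flatten ts1) ++ c :: flatten ts2) (iota 0 N).
  by move: vP; rewrite /= flatten_cat.
have aN : all (fun x => x < N) ((0 :: flatten ts1) ++ c :: flatten ts2).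
  by apply/allP => x; rewrite (perm_mem vP) mem_iota.
have s2 : size (flatten ts2) = 2 * h.
  by have := perm_size vP; rewrite size_cat /= s1 size_iota /N; lia.
have uF := iota_uniq 0 N; rewrite -(perm_uniq vP) cat_uniq in uF.
have memN x : x \in (0 :: flatten ts1) ++ c :: flatten ts2 -> x < N by move/allP: aN; apply.
move: aN; rewrite all_cat => /andP[aN1 aN2].
case/and3P: uF => u1 _ u2.
apply: (@rot_add_point N (2 * h).+1 (N :: 0 :: flatten ts1) [:: c :: flatten ts2] (2 * h - 2 + 0)
  (map (addn (2 * h - 2)) (iota 1 (2 * h - 1))) [:: map (r2_cycle_pt h) (iota 0 (2 * h).+1)] (r2_removed h)).
- by rewrite /N; lia.
- move=> x; have := perm_count vP x.
  by rewrite /= cats0 => ->; case: ltngtP; lia.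
- rewrite !farcs_cons cats0 /fdiffs filter_cat map_cat.
  rewrite -/(fdiffs N (arcs (N :: _))) -/(fdiffs N (arcs (c :: _))) fdiffs_path //.
  rewrite (perm_trans _ dP) // flatten_cat -pairmap_flatten.
  by rewrite perm_cat2l /= -pairmap_flatten; apply: (fdiffs_cycle aN2).
- rewrite !farcs_cons cats0 mem_cat negb_or; apply/andP; split; apply: arcs_noloop => //.
  + rewrite cons_uniq u1 andbT; apply/negP => H.
    by have := memN N; rewrite mem_cat H ltnn => /(_ isT).
  + by rewrite /= s2; lia.
- by rewrite /= s1; lia.
- by rewrite /= s2 eqxx.
- move=> i iN; rewrite /r2_removed s1E; do 4?case: ifP => _.
  + by rewrite arcs_cons mem_rcons /= !inE eqxx ?orbT.
  + by rewrite arcs_cons mem_rcons /= !inE /N eqxx ?orbT.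
  + by rewrite -s1E; apply: mem_arcs_cons => //=; lia.
  + by rewrite arcs_cons mem_rcons inE -s1E /= l1 eqxx.
  + by rewrite arcs_cons mem_rcons /= !inE eqxx ?orbT.
- by rewrite size_map size_iota; lia.
- by rewrite /= size_map size_iota eqxx.
- exact: r2_cover.
exact: r2_removed_perm.
Qed.

(** [sing] and [inz] are [single] and [inzig] for lists whose starting points are blocks of their
    own; [closing] finds the difference that closes the second cycle. *)
Ltac sing i j := apply: (@in_tokl i j) => //=; lia.
Ltac closing i :=
  apply: (@in_tokl i 0) => //=; rewrite ?cats0 ?last_cat /= ?last_cat /= ?last_zig /dif; iflia.
Ltac inz i := apply: (@in_tok i); apply: mem_zig; lia.

(** The path and the cycle contain two zigzags each. Those of the cycle have [a] above [b], so their
    differences fill the middle of the range, while those of the path fill its two ends. *)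
Lemma r2_family_even g : r2_ok (2 * g + 12)
    [:: [:: 1; 8 * g + 47; 4 * g + 26; 4 * g + 28; 2 * g + 13; 8 * g + 45; 2; 8 * g + 44];
     zig (3) (8 * g + 43) (g + 2);
     [:: g + 5; 3 * g + 17; 3 * g + 20; g + 8; 5 * g + 31];
     zig (3 * g + 22) (5 * g + 30) (g + 1);
     [:: 4 * g + 23; 4 * g + 29; 4 * g + 24]]
    (2 * g + 10)
    [:: [:: 4 * g + 27; 6 * g + 37; 2 * g + 11; 6 * g + 36; 2 * g + 12; 6 * g + 38; 4 * g + 25; 8 * g + 46; 6 * g + 35];
     zig (6 * g + 39) (2 * g + 9) (g + 1);
     [:: 7 * g + 40; 3 * g + 21; 7 * g + 41; g + 7; g + 6; 3 * g + 19; 3 * g + 16; 5 * g + 32; 3 * g + 18];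
     zig (5 * g + 33) (3 * g + 15) (g + 2)].
Proof.
split.
- by rewrite /=; do 9? rewrite ?size_cat ?size_zig /=; lia.
- apply: perm_surj; rewrite ?iota_uniq //; last move=> v.
    by rewrite size_iota /=; do 19? rewrite ?size_cat ?size_zig /=; lia.
  rewrite mem_iota => /andP[lo hiN].
  below v (1); first by sing 0 0.
  below v (2); first by sing 1 0.
  below v (3); first by sing 1 6.
  below v (g + 5); first by inz 2.
  below v (g + 6); first by sing 3 0.
  below v (g + 7); first by sing 9 4.
  below v (g + 8); first by sing 9 3.
  below v (g + 9); first by sing 3 3.
  below v (2 * g + 10); first by inz 8.
  below v (2 * g + 11); first by sing 6 0.
  below v (2 * g + 12); first by sing 7 2.
  below v (2 * g + 13); first by sing 7 4.
  below v (2 * g + 14); first by sing 1 4.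
  below v (3 * g + 16); first by inz 10.
  below v (3 * g + 17); first by sing 9 6.
  below v (3 * g + 18); first by sing 3 1.
  below v (3 * g + 19); first by sing 9 8.
  below v (3 * g + 20); first by sing 9 5.
  below v (3 * g + 21); first by sing 3 2.
  below v (3 * g + 22); first by sing 9 1.
  below v (4 * g + 23); first by inz 4.
  below v (4 * g + 24); first by sing 5 0.
  below v (4 * g + 25); first by sing 5 2.
  below v (4 * g + 26); first by sing 7 6.
  below v (4 * g + 27); first by sing 1 2.
  below v (4 * g + 28); first by sing 7 0.
  below v (4 * g + 29); first by sing 1 3.
  below v (4 * g + 30); first by sing 5 1.
  below v (5 * g + 31); first by inz 4.
  below v (5 * g + 32); first by sing 3 4.
  below v (5 * g + 33); first by sing 9 7.
  below v (6 * g + 35); first by inz 10.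
  below v (6 * g + 36); first by sing 7 8.
  below v (6 * g + 37); first by sing 7 3.
  below v (6 * g + 38); first by sing 7 1.
  below v (6 * g + 39); first by sing 7 5.
  below v (7 * g + 40); first by inz 8.
  below v (7 * g + 41); first by sing 9 0.
  below v (7 * g + 42); first by sing 9 2.
  below v (8 * g + 44); first by inz 2.
  below v (8 * g + 45); first by sing 1 7.
  below v (8 * g + 46); first by sing 1 5.
  below v (8 * g + 47); first by sing 7 7.
  by sing 1 1.
- apply: perm_surj; rewrite ?iota_uniq //; last move=> v.
    by rewrite size_iota /=; do 19? rewrite ?size_cat ?size_pairmap ?size_zig /=; lia.
  rewrite mem_iota => /andP[lo hiN].
  below v (2); first by jump 0 0.
  below v (3); first by jump 0 3.
  below v (4); first by jump 2 2.
  below v (5); first by enter 7.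
  below v (6); first by jump 0 6.
  below v (7); first by jump 4 1.
  below v (8); first by enter 1.
  below v (9); first by within 3 dzig_up.
  below v (2 * g + 9); first by parity v; [within 3 dzig_up|within 1 dzig_down].
  below v (2 * g + 10); first by within 1 dzig_down.
  below v (2 * g + 11); first by jump 6 1.
  below v (2 * g + 12); first by jump 2 0.
  below v (2 * g + 13); first by jump 2 1.
  below v (2 * g + 14); first by jump 8 5.
  below v (2 * g + 15); first by jump 8 3.
  below v (2 * g + 16); first by enter 9.
  below v (2 * g + 17); first by jump 8 7.
  below v (2 * g + 18); first by jump 6 0.
  below v (2 * g + 19); first by within 7 dzig_down'.
  below v (4 * g + 19); first by parity v; [within 7 dzig_down'|within 9 dzig_up'].
  below v (4 * g + 20); first by within 9 dzig_up'.
  below v (4 * g + 21); first by jump 8 2.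
  below v (4 * g + 22); first by jump 6 7.
  below v (4 * g + 23); first by jump 6 2.
  below v (4 * g + 24); first by jump 2 4.
  below v (4 * g + 25); first by jump 6 4.
  below v (4 * g + 26); first by jump 6 3.
  below v (4 * g + 27); first by jump 6 5.
  below v (4 * g + 28); first by jump 0 2.
  below v (4 * g + 29); first by within 9 dzig_down'.
  below v (4 * g + 30); first by jump 8 1.
  below v (4 * g + 31); first by within 9 dzig_down'.
  below v (6 * g + 30); first by parity v; [within 9 dzig_down'|within 7 dzig_up'].
  below v (6 * g + 31); first by within 9 dzig_down'.
  below v (6 * g + 32); first by jump 8 0.
  below v (6 * g + 33); first by jump 0 5.
  below v (6 * g + 34); first by jump 0 4.
  below v (6 * g + 35); first by jump 8 8.
  below v (6 * g + 36); first by jump 6 6.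
  below v (6 * g + 37); first by jump 2 3.
  below v (6 * g + 38); first by jump 6 8.
  below v (6 * g + 39); first by within 1 dzig_up.
  below v (6 * g + 40); first by enter 3.
  below v (6 * g + 41); first by within 1 dzig_up.
  below v (8 * g + 40); first by parity v; [within 1 dzig_up|within 3 dzig_down].
  below v (8 * g + 41); first by within 1 dzig_up.
  below v (8 * g + 42); first by jump 4 0.
  below v (8 * g + 43); first by jump 0 7.
  below v (8 * g + 44); first by jump 4 2.
  below v (8 * g + 45); first by closing 5.
  below v (8 * g + 46); first by jump 8 6.
  below v (8 * g + 47); first by jump 0 1.
  by jump 8 4.
- by rewrite /= ?last_cat /= ?last_cat /= ?last_zig /=; lia.
by apply: (@arcs_flatten 0 2); rewrite //=; congr (_, _); lia.
Qed.

Lemma r2_family_odd g : r2_ok (2 * g + 13)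
    [:: [:: 1; 8 * g + 51; 2 * g + 12; 4 * g + 28; 4 * g + 30; 6 * g + 39; 4 * g + 27];
     zig (4) (8 * g + 50) (g + 2);
     [:: 7 * g + 44];
     zig (5 * g + 35) (3 * g + 17) (g + 3);
     [:: 6 * g + 38; 3; 2 * g + 13; 4 * g + 31; 2 * g + 14; 4 * g + 26]]
    (4 * g + 25)
    [:: [:: 4 * g + 29; 6 * g + 40; 2];
     zig (6 * g + 41) (2 * g + 11) (g + 2);
     [:: 7 * g + 43; 7 * g + 48; 7 * g + 45; g + 8; 7 * g + 46; 3 * g + 21; 7 * g + 47; 3 * g + 20; g + 9; 5 * g + 33; 3 * g + 23; g + 7; g + 6; 5 * g + 34; 3 * g + 19; 3 * g + 22; 3 * g + 18];
     zig (3 * g + 24) (5 * g + 32) (g + 1)].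
Proof.
split.
- by rewrite /=; do 9? rewrite ?size_cat ?size_zig /=; lia.
- apply: perm_surj; rewrite ?iota_uniq //; last move=> v.
    by rewrite size_iota /=; do 19? rewrite ?size_cat ?size_zig /=; lia.
  rewrite mem_iota => /andP[lo hiN].
  below v (1); first by sing 0 0.
  below v (2); first by sing 1 0.
  below v (3); first by sing 7 2.
  below v (4); first by sing 5 1.
  below v (g + 6); first by inz 2.
  below v (g + 7); first by sing 9 12.
  below v (g + 8); first by sing 9 11.
  below v (g + 9); first by sing 9 3.
  below v (g + 10); first by sing 9 8.
  below v (2 * g + 12); first by inz 8.
  below v (2 * g + 13); first by sing 1 2.
  below v (2 * g + 14); first by sing 5 2.
  below v (2 * g + 15); first by sing 5 4.
  below v (3 * g + 18); first by inz 4.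
  below v (3 * g + 19); first by sing 9 16.
  below v (3 * g + 20); first by sing 9 14.
  below v (3 * g + 21); first by sing 9 7.
  below v (3 * g + 22); first by sing 9 5.
  below v (3 * g + 23); first by sing 9 15.
  below v (3 * g + 24); first by sing 9 10.
  below v (4 * g + 25); first by inz 10.
  below v (4 * g + 26); first by sing 6 0.
  below v (4 * g + 27); first by sing 5 5.
  below v (4 * g + 28); first by sing 1 6.
  below v (4 * g + 29); first by sing 1 3.
  below v (4 * g + 30); first by sing 7 0.
  below v (4 * g + 31); first by sing 1 4.
  below v (4 * g + 32); first by sing 5 3.
  below v (5 * g + 33); first by inz 10.
  below v (5 * g + 34); first by sing 9 9.
  below v (5 * g + 35); first by sing 9 13.
  below v (6 * g + 38); first by inz 4.
  below v (6 * g + 39); first by sing 5 0.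
  below v (6 * g + 40); first by sing 1 5.
  below v (6 * g + 41); first by sing 7 1.
  below v (7 * g + 43); first by inz 8.
  below v (7 * g + 44); first by sing 9 0.
  below v (7 * g + 45); first by sing 3 0.
  below v (7 * g + 46); first by sing 9 2.
  below v (7 * g + 47); first by sing 9 4.
  below v (7 * g + 48); first by sing 9 6.
  below v (7 * g + 49); first by sing 9 1.
  below v (8 * g + 51); first by inz 2.
  by sing 1 1.
- apply: perm_surj; rewrite ?iota_uniq //; last move=> v.
    by rewrite size_iota /=; do 19? rewrite ?size_cat ?size_pairmap ?size_zig /=; lia.
  rewrite mem_iota => /andP[lo hiN].
  below v (2); first by jump 0 0.
  below v (3); first by jump 0 4.
  below v (4); first by jump 8 15.
  below v (5); first by jump 6 0.
  below v (6); first by jump 8 1.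
  below v (7); first by enter 9.
  below v (8); first by within 1 dzig_down.
  below v (2 * g + 8); first by parity v; [within 9 dzig_up|within 1 dzig_down].
  below v (2 * g + 9); first by within 9 dzig_up.
  below v (2 * g + 10); first by jump 0 5.
  below v (2 * g + 11); first by jump 4 2.
  below v (2 * g + 12); first by jump 6 1.
  below v (2 * g + 13); first by jump 4 5.
  below v (2 * g + 14); first by jump 0 2.
  below v (2 * g + 15); first by jump 6 2.
  below v (2 * g + 16); first by jump 8 3.
  below v (2 * g + 17); first by jump 0 3.
  below v (2 * g + 18); first by jump 4 1.
  below v (2 * g + 19); first by jump 4 3.
  below v (2 * g + 20); first by within 3 dzig_up'.
  below v (4 * g + 22); first by parity v; [within 7 dzig_down'|within 3 dzig_up'].
  below v (4 * g + 23); first by within 7 dzig_down'.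
  below v (4 * g + 24); first by jump 4 0.
  below v (4 * g + 25); first by jump 8 9.
  below v (4 * g + 26); first by jump 8 7.
  below v (4 * g + 27); first by jump 8 6.
  below v (4 * g + 28); first by jump 8 5.
  below v (4 * g + 29); first by jump 8 13.
  below v (4 * g + 30); first by enter 1.
  below v (4 * g + 31); first by within 3 dzig_down'.
  below v (6 * g + 32); first by parity v; [within 3 dzig_down'|within 7 dzig_up'].
  below v (6 * g + 33); first by within 3 dzig_down'.
  below v (6 * g + 34); first by jump 8 0.
  below v (6 * g + 35); first by within 3 dzig_down'.
  below v (6 * g + 36); first by jump 4 4.
  below v (6 * g + 37); first by jump 8 11.
  below v (6 * g + 38); first by jump 8 14.
  below v (6 * g + 39); first by jump 8 4.
  below v (6 * g + 40); first by enter 7.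
  below v (6 * g + 41); first by jump 0 6.
  below v (6 * g + 42); first by jump 8 8.
  below v (6 * g + 43); first by jump 8 10.
  below v (6 * g + 44); first by enter 3.
  below v (6 * g + 45); first by within 1 dzig_up.
  below v (8 * g + 44); first by parity v; [within 1 dzig_up|within 9 dzig_down].
  below v (8 * g + 45); first by within 1 dzig_up.
  below v (8 * g + 46); first by closing 5.
  below v (8 * g + 47); first by within 1 dzig_up.
  below v (8 * g + 48); first by jump 2 0.
  below v (8 * g + 49); first by jump 8 16.
  below v (8 * g + 50); first by jump 8 2.
  below v (8 * g + 51); first by jump 0 1.
  by jump 8 12.
- by rewrite /= ?last_cat /= ?last_cat /= ?last_zig /=; lia.
by apply: (@arcs_flatten 0 3); rewrite //=; congr (_, _); lia.
Qed.

(** Path without its initial 0, and cycle, for h = 4, ..., 11. *)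
Definition r2_table : seq (seq nat * seq nat) :=
  [:: ([:: 1; 15; 7; 10; 12; 8], [:: 14; 2; 13; 4; 3; 9; 6; 11; 5]);
     ([:: 1; 19; 15; 7; 12; 14; 3; 10], [:: 18; 6; 9; 13; 4; 17; 16; 11; 5; 2; 8]);
     ([:: 1; 23; 10; 9; 17; 14; 16; 19; 7; 12], [:: 22; 4; 13; 5; 15; 8; 21; 11; 6; 2; 20; 3; 18]);
     ([:: 1; 27; 11; 7; 21; 16; 18; 23; 13; 20; 26; 14], [:: 25; 8; 5; 24; 9; 17; 4; 3; 12; 6; 10; 2; 19; 22; 15]);
     ([:: 1; 31; 17; 29; 18; 20; 19; 10; 14; 22; 7; 26; 3; 16], [:: 30; 4; 15; 11; 8; 24; 6; 9; 2; 12; 27; 21; 28; 23; 13; 5; 25]);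
     ([:: 1; 35; 28; 14; 29; 20; 22; 16; 12; 7; 27; 15; 4; 3; 21; 18], [:: 34; 24; 30; 5; 13; 23; 6; 10; 33; 11; 32; 8; 17; 9; 25; 2; 19; 26; 31]);
     ([:: 1; 39; 12; 9; 34; 22; 24; 10; 19; 18; 2; 32; 25; 35; 14; 30; 26; 20], [:: 38; 13; 27; 4; 31; 36; 7; 11; 17; 6; 37; 5; 8; 29; 21; 28; 23; 3; 15; 33; 16]);
     ([:: 1; 43; 25; 42; 30; 2; 12; 9; 34; 8; 4; 38; 16; 21; 27; 10; 24; 26; 33; 22], [:: 3; 41; 20; 15; 19; 6; 17; 37; 40; 5; 18; 39; 7; 36; 35; 28; 14; 29; 13; 32; 23; 31; 11])].

Definition dec_table_ok m n (L : seq (seq (seq nat))) : bool :=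
  all (fun F => all (fun c => size c == m) F && perm_eq (flatten F) (iota 0 n)) L &&
  perm_eq (larcs L) [seq a <- [seq (x, y) | x <- iota 0 n, y <- iota 0 n] | a.1 != a.2].

Lemma dec_table m n L : dec_table_ok m n L -> dec m (size L) (fun x => x < n) (Kstar n).
Proof.
move=> /andP[/allP FL /permP aL]; exists L; split=> //.
  move=> F /FL /andP[sF /permP cF]; split=> // x.
  by rewrite cF count_uniq_mem ?iota_uniq // mem_iota.
move=> x y; rewrite aL count_uniq_mem.
  rewrite mem_filter /=; congr nat_of_bool.
  have -> : ((x, y) \in [seq (x, y) | x <- iota 0 n, y <- iota 0 n]) = (x < n) && (y < n).
    apply/allpairsP/andP => [[[u v] /=]|[xn yn]].
      by rewrite !mem_iota => -[/= un vn [-> ->]].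
    by exists (x, y); rewrite !mem_iota.
  by rewrite /Kstar andbC andbA.
by apply: filter_uniq; apply: allpairs_uniq; rewrite ?iota_uniq // => -[a b] [c d] _ _ [-> ->].
Qed.

Lemma two_groups_5 : dec 5 9 (fun x => x < 10) (Kstar 10).
Proof.
exact: (@dec_table 5 10
  [:: [:: [:: 0; 1; 5; 8; 7]; [:: 2; 6; 3; 4; 9]];
     [:: [:: 0; 2; 1; 3; 6]; [:: 4; 7; 5; 9; 8]];
     [:: [:: 0; 3; 2; 4; 1]; [:: 5; 7; 8; 9; 6]];
     [:: [:: 0; 4; 3; 8; 5]; [:: 1; 2; 9; 7; 6]];
     [:: [:: 0; 5; 3; 9; 4]; [:: 1; 8; 6; 2; 7]];
     [:: [:: 0; 6; 4; 2; 8]; [:: 1; 7; 9; 3; 5]];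
     [:: [:: 0; 7; 3; 1; 9]; [:: 2; 5; 4; 6; 8]];
     [:: [:: 0; 8; 3; 7; 2]; [:: 1; 4; 5; 6; 9]];
     [:: [:: 0; 9; 5; 2; 3]; [:: 1; 6; 7; 4; 8]]]).
Qed.

Lemma two_groups_7 : dec 7 13 (fun x => x <= 13) (Kstar 14).
Proof.
exact: (@rot_table 12 7 [:: 12; 0; 11; 4; 8; 6] [:: [:: 10; 1; 7; 9; 5; 2; 3]]
  3 [:: 1; 11; 4; 2; 7] [:: [:: 0; 5; 12; 6; 10; 9; 8]]
  [:: (11, 4); (11, 4); (4, 8); (11, 4); (4, 8); (8, 6);
      (12, 0); (8, 6); (8, 6); (0, 11); (0, 11); (6, 12)]).
Qed.

Theorem two_groups h : 1 < h ->
  dec (2 * h).+1 (4 * h).+1 (fun x => x < (4 * h).+2) (Kstar (4 * h).+2).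
Proof.
move=> h1; have [->|h2] := eqVneq h 2; first exact: two_groups_5.
have [->|h3] := eqVneq h 3; first exact: two_groups_7.
have [h12|h12] := ltnP h 12.
  pose t := nth ([::], [::]) r2_table (h - 4).
  apply: (@r2_of_ok h [:: t.1] (head 0 t.2) [:: behead t.2]); first lia.
  have : h \in iota 4 8 by rewrite mem_iota; lia.
  rewrite /t {t} /= !inE.
  by do 7?[case/predU1P=> [->|]]; try (move/eqP->); split; vm_compute.
have [[g ->]|[g ->]] : (exists g, h = 2 * g + 12) \/ (exists g, h = 2 * g + 13).
  have := odd_double_half h; case: (odd h) => /= e.
    by right; exists (h./2 - 6); lia.
  by left; exists (h./2 - 6); lia.
- by apply: (r2_of_ok _ (r2_family_even g)); lia.
by apply: (r2_of_ok _ (r2_family_odd g)); lia.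
Qed.

(** * Blowing up: every vertex is replaced by g copies *)

Lemma count_big (T : Type) (P : pred T) s : count P s = \sum_(x <- s) (P x : nat).
Proof. by elim: s => [|x s IH]; rewrite ?big_nil ?big_cons //= IH. Qed.

Lemma count_flatten_map (I T : Type) (P : pred T) (h : I -> seq T) r :
  count P (flatten (map h r)) = \sum_(i <- r) count P (h i).
Proof. by elim: r => [|i r IH]; rewrite ?big_nil // big_cons /= count_cat IH. Qed.

Lemma larcs_count (T : eqType) (L : seq (seq (seq T))) a :
  count_mem a (larcs L) = \sum_(F <- L) \sum_(c <- F) count_mem a (arcs c).
Proof.
elim: L => [|F L IH]; rewrite ?big_nil // big_cons larcs_cons count_cat IH; congr (_ + _).
by elim: F {IH} => [|c F IH]; rewrite ?big_nil // big_cons farcs_cons count_cat IH.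
Qed.

Lemma arcs_pairmap (T : Type) (x : T) s :
  arcs (x :: s) = rcons (pairmap pair x s) (last x s, x).
Proof.
rewrite /arcs rot1_cons; move: {2 5}x => z.
by elim: s x => //= y s IH x; rewrite IH.
Qed.

(** When the lifts of a cycle are chained, the closing arc of the r-th lift is redirected to the
    start of the next one, cyclically. *)
Lemma perm_arcs_flatten (U T : eqType) (x : U) (F : nat -> U -> T) s g (h := x :: s) :
  0 < g ->
  perm_eq (arcs (flatten [seq map (F r) h | r <- iota 0 g]))
    (flatten [seq (F r (last x s), F (r.+1 %% g) x) ::
                  [seq (F r a.1, F r a.2) | a <- pairmap pair x s] | r <- iota 0 g]).
Proof.
case: g => // g _.
have map_pm r y u : [seq (F r a.1, F r a.2) | a <- pairmap pair y u] =
    pairmap pair (F r y) (map (F r) u) by elim: u y => //= z u IH y; rewrite IH.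
pose W a := [seq (F a b.1, F a b.2) | b <- pairmap pair x s].
have count_rcons Q (u : seq (T * T)) y : count Q (rcons u y) = count Q u + Q y.
  by rewrite -cats1 count_cat /= addn0.
(* Generalised to the copies from [a] to [a + n] and to an arbitrary final target [z], which makes
   the induction go through. *)
have H Q z n a : (forall i, i < n -> (a + i).+1 %% g.+1 = (a + i).+1) ->
    count Q (rcons (pairmap pair (F a x) (map (F a) s ++
        flatten [seq map (F r) h | r <- iota a.+1 n]))
        (last (F a x) (map (F a) s ++ flatten [seq map (F r) h | r <- iota a.+1 n]), z)) =
    count Q (flatten [seq (F r (last x s), F (r.+1 %% g.+1) x) :: W r | r <- iota a n]) +
    (Q (F (a + n) (last x s), z) + count Q (W (a + n))).
  elim: n a => [|n IH] a lt.
    by rewrite /= cats0 addn0 last_map /W map_pm count_rcons addnC.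
  rewrite [iota a.+1 n.+1]/= [iota a n.+1]/= !map_cons /= pairmap_cat last_cat.
  rewrite /= last_map -map_pm rcons_cat count_cat /= -addSnnS.
  have -> : a.+1 %% g.+1 = a.+1 by have := lt 0 isT; rewrite addn0.
  rewrite IH => [|i lti]; last by rewrite addSnnS; apply: lt.
  by rewrite count_cat -/(W a); lia.
apply/permP => Q; rewrite arcs_pairmap H => [|i lti]; last by rewrite add0n modn_small.
rewrite add0n -[in RHS]addn1 iotaD map_cat flatten_cat count_cat /= cats0 /= add0n addn1.
by rewrite modnn.
Qed.

(** The positions of a cycle have the types 0, 1, 2, 1, 2, .... Three types suffice for every
    length, since only neighbouring positions have to be compared. The last type is 2 for odd length
    and 1 for length 2. *)
Definition slot j := if j is j'.+1 then (odd j').+1 else 0.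

Arguments slot : simpl never.

Definition slotted (T : Type) (c : seq T) : seq (T * nat) := zip c (map slot (iota 0 (size c))).

Definition slot_adj a b := (a, b) \in [:: (0, 1); (1, 2); (2, 1)].

Lemma slot_adjP n : slot_adj (slot n) (slot n.+1).
Proof. by case: n => [|n] //; rewrite /slot_adj /slot /=; case: (odd n). Qed.

Lemma last_slotted (T : Type) n (x : T) s :
  last (x, slot n) (zip s (map slot (iota n.+1 (size s)))) = (last x s, slot (n + size s)).
Proof. by elim: s n x => [|y s IH] n x /=; rewrite ?addn0 // IH addSnnS. Qed.

Section Blow.
Variables (T : eqType) (p k g : nat) (V : pred T) (A : T -> T -> nat).
Variables (f : nat -> nat -> nat -> nat) (cl : nat -> nat).
Hypothesis p1 : 1 < p.
Hypothesis g0 : 0 < g.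
(** [f a t r] is the copy that the r-th lift in the t-th factor uses at type [a]. By [fV] one factor
    covers every copy once; by [fA] and [fC] every arc between copies is used once over all [t] and
    [r], along the cycle and where it closes on the copy [cl r]. *)
Hypothesis fV : forall n t i, t < g -> \sum_(r <- iota 0 g) (f (slot n) t r == i) = (i < g).
Hypothesis fA : forall a b i j, slot_adj a b ->
  \sum_(t <- iota 0 g) \sum_(r <- iota 0 g) ((f a t r == i) && (f b t r == j)) = (i < g) && (j < g).
Hypothesis fC : forall i j,
  \sum_(t <- iota 0 g) \sum_(r <- iota 0 g) ((f (slot p.-1) t r == i) && (cl r == j))
    = (i < g) && (j < g).

Let W (q : T * nat) := V q.1 && (q.2 < g).
Let B (q q' : T * nat) := A q.1 q'.1 * ((q.2 < g) && (q'.2 < g)).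
Let F t r (q : T * nat) := (q.1, f q.2 t r).

Let newarc t r (x : T) s (X Y : T) i j :=
  \sum_(q <- pairmap pair (x, 0) (zip s (map slot (iota 1 (size s)))))
     ((F t r q.1, F t r q.2) == ((X, i), (Y, j)))
  + [&& last x s == X, f (slot (size s)) t r == i, x == Y & cl r == j].

Lemma sum_newarc x s X Y i j : size s = p.-1 ->
  \sum_(t <- iota 0 g) \sum_(r <- iota 0 g) newarc t r x s X Y i j =
  count_mem (X, Y) (arcs (x :: s)) * ((i < g) && (j < g)).
Proof.
move=> ss; under eq_bigr => t _ do rewrite big_split /= exchange_big /=.
rewrite big_split /= exchange_big /= arcs_pairmap -cats1 count_cat /= addn0 mulnDl.
congr (_ + _); last first.
  have := fC i j; rewrite -ss => <-; rewrite big_distrr; apply: eq_bigr => t _.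
  rewrite big_distrr; apply: eq_bigr => r _; rewrite xpair_eqE /= mulnb.
  by congr nat_of_bool; case: (last x s == X); case: (x == Y); rewrite /= ?andbF ?andbT.
suff H n : \sum_(q <- pairmap pair (x, slot n) (zip s (map slot (iota n.+1 (size s)))))
    \sum_(t <- iota 0 g) \sum_(r <- iota 0 g) ((F t r q.1, F t r q.2) == ((X, i), (Y, j))) =
    count_mem (X, Y) (pairmap pair x s) * ((i < g) && (j < g)) by exact: (H 0).
elim: s n x {ss} => [|y s IH] n x /=; first by rewrite big_nil.
rewrite -/(slot n.+1).
rewrite big_cons IH mulnDl; congr (_ + _).
rewrite -(fA i j (slot_adjP n)) big_distrr /=; apply: eq_bigr => t _.
rewrite big_distrr; apply: eq_bigr => r _; rewrite !xpair_eqE /= mulnb.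
by congr nat_of_bool; case: (x == X); case: (y == Y); rewrite /= ?andbF ?andbT.
Qed.

Lemma blow_count x s X t i : t < g ->
  \sum_(r <- iota 0 g) count_mem (X, i) (map (F t r) (slotted (x :: s))) =
  count_mem X (x :: s) * (i < g).
Proof.
move=> tg; rewrite /slotted; move: (x :: s) => c.
suff H n : \sum_(r <- iota 0 g) count_mem (X, i) (map (F t r) (zip c (map slot (iota n (size c))))) =
    count_mem X c * (i < g) by exact: (H 0).
elim: c n => [|y c IH] n /=; first by rewrite big1.
rewrite big_split /= IH mulnDl; congr (_ + _); rewrite -(fV n i tg) big_distrr.
by apply: eq_bigr => r _ /=; rewrite xpair_eqE /= mulnb.
Qed.

Let parts (c : seq T) : size c = p -> exists x s, c = x :: s /\ size s = p.-1.
Proof. by case: c => [|x s] /= e; [move: p1; rewrite -e|exists x, s; split=> //; rewrite -e]. Qed.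

(** Two ways to close the lifts of a cycle of length p: each on itself, giving g cycles of length p,
    or all chained together, giving one cycle g times as long. *)
Let parallel (F0 : seq (seq T)) t := flatten [seq [seq map (F t r) (slotted c) | r <- iota 0 g] | c <- F0].
Let winding (F0 : seq (seq T)) t := [seq flatten [seq map (F t r) (slotted c) | r <- iota 0 g] | c <- F0].

Let blow_dec m (new : seq (seq T) -> nat -> seq (seq (T * nat))) :
  (forall F0 t, is_fac p V F0 -> t < g -> is_fac m W (new F0 t)) ->
  (forall F0 t X Y i j, is_fac p V F0 -> t < g ->
     count_mem ((X, i), (Y, j)) (farcs (new F0 t)) =
     \sum_(c <- F0) \sum_(r <- iota 0 g) newarc t r (head X c) (behead c) X Y i j) ->
  dec p k V A -> dec m (k * g) W B.
Proof.
move=> newF newA [L [sL LF LA]].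
exists [seq new F0 t | F0 <- L, t <- iota 0 g]; split.
- by rewrite size_allpairs size_iota sL.
- move=> H /allpairsP[[F0 t] [F0L]]; rewrite mem_iota => tg ->.
  by apply: newF => //; apply: LF.
move=> [X i] [Y j]; rewrite /B /= -LA larcs_count big_distrl /=.
elim: L LF {sL LA} => [|F0 L IH] LF; first by rewrite big_nil.
rewrite /= larcs_cat count_cat IH; last by move=> F' F'L; apply: LF; rewrite inE F'L orbT.
rewrite big_cons; congr (_ + _).
have fF := LF F0 (mem_head _ _).
have -> : count_mem ((X, i), (Y, j)) (larcs [seq new F0 t | t <- iota 0 g]) =
    \sum_(t <- iota 0 g) count_mem ((X, i), (Y, j)) (farcs (new F0 t)).
  elim: (iota 0 g) => [|t r IHr]; rewrite ?big_nil //.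
  by rewrite big_cons /= larcs_cons count_cat IHr.
rewrite (eq_big_seq (fun t => \sum_(c <- F0) \sum_(r <- iota 0 g)
    newarc t r (head X c) (behead c) X Y i j)); last first.
  by move=> t; rewrite mem_iota => tg; apply: newA.
rewrite exchange_big big_distrl /=; apply: eq_big_seq => c cF.
have [/allP sF _] := fF; have [x [s [-> ss]]] := parts (eqP (sF _ cF)).
exact: sum_newarc.
Qed.

Lemma dec_parallel : (forall r, r < g -> cl r = r) -> (forall t r, f 0 t r = r) ->
  dec p k V A -> dec p (k * g) W B.
Proof.
move=> clE f0; apply: (blow_dec (new := parallel)) => F0 t.
  move=> [sF cF] tg; split.
    apply/allP => _ /flattenP[_ /mapP[c cF0 ->] /mapP[r _ ->]].
    by rewrite size_map size_zip size_map size_iota minnn (allP sF).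
  move=> [X i]; rewrite /W /= -mulnb -cF /parallel.
  elim: F0 sF {cF} => [//|c F0 IH] /= /andP[/eqP sc sF].
  rewrite flatten_cat !count_cat IH // mulnDl; congr (_ + _).
  have [x [s [-> ss]]] := parts sc; rewrite -(blow_count x s X i tg).
  by rewrite count_flatten_map.
move=> X Y i j [sF _] tg; rewrite /parallel.
elim: F0 sF => [|c F0 IH] /=; first by rewrite big_nil.
move=> /andP[/eqP sc sF]; rewrite farcs_cat count_cat IH // big_cons; congr (_ + _).
have [x [s [-> ss]]] := parts sc.
rewrite /farcs -map_comp count_flatten_map; apply: eq_big_seq => r.
rewrite mem_iota => /clE cr.
rewrite -[LHS]/(count_mem _ (arcs (map (F t r) ((x, slot 0) :: zip s (map slot (iota 1 (size s))))))).
rewrite arcs_map arcs_pairmap map_rcons -cats1 count_cat /= addn0 /newarc.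
congr (_ + _); first by rewrite count_map count_big.
by rewrite (last_slotted 0) add0n /F /= [f 0 _ _]f0 cr !xpair_eqE /= -!andbA.
Qed.

Lemma dec_winding : (forall r, r < g -> cl r = r.+1 %% g) -> (forall t r, f 0 t r = r) ->
  dec p k V A -> dec (p * g) (k * g) W B.
Proof.
move=> clE f0; apply: (blow_dec (new := winding)) => F0 t.
  move=> [sF cF] tg; split.
    apply/allP => _ /mapP[c cF0 ->]; rewrite size_flatten /shape -map_comp.
    suff H a n : sumn (map (size \o (fun r => map (F t r) (slotted c))) (iota a n)) = p * n by rewrite H.
    elim: n a => [|n IH] a; rewrite ?muln0 //= IH size_map size_zip size_map size_iota minnn.
    by rewrite (eqP (allP sF _ cF0)) mulnS.
  move=> [X i]; rewrite /W /= -mulnb -cF /winding.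
  elim: F0 sF {cF} => [//|c F0 IH] /= /andP[/eqP sc sF].
  rewrite !count_cat IH // mulnDl; congr (_ + _).
  have [x [s [-> ss]]] := parts sc; rewrite -(blow_count x s X i tg).
  by rewrite count_flatten_map.
move=> X Y i j [sF _] tg; rewrite /winding.
elim: F0 sF => [|c F0 IH] /=; first by rewrite big_nil.
move=> /andP[/eqP sc sF]; rewrite farcs_cons count_cat IH // big_cons; congr (_ + _).
have [x [s [-> ss]]] := parts sc; rewrite /slotted /=.
rewrite (permP (perm_arcs_flatten (x, slot 0) (F t) _ g0)) count_flatten_map.
apply: eq_big_seq => r; rewrite mem_iota => /clE cr /=.
rewrite /newarc addnC; congr (_ + _); first by rewrite count_map count_big.
by rewrite (last_slotted 0) add0n /F /= [f 0 _ _]f0 cr !xpair_eqE /= -!andbA.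
Qed.
End Blow.

(** An injective map of a finite set into itself takes each value once, so the conditions on the
    offsets reduce to injectivity; [uniq_sum2] does the same for pairs. *)
Lemma uniq_sum g (u : nat -> nat) i :
  (forall r, r < g -> u r < g) -> {in [pred r | r < g] &, injective u} ->
  \sum_(r <- iota 0 g) (u r == i) = (i < g).
Proof.
move=> ug uI; rewrite -(count_big (fun r => u r == i)) -(count_map u (pred1 i)).
have U : uniq (map u (iota 0 g)).
  by rewrite map_inj_in_uniq ?iota_uniq // => x y; rewrite !mem_iota; apply: uI.
have S : {subset map u (iota 0 g) <= iota 0 g}.
  by move=> _ /mapP[r + ->]; rewrite !mem_iota; apply: ug.
rewrite (count_uniq_mem _ U); have [|_ ->] := uniq_min_size U S; first by rewrite size_map.
by rewrite mem_iota.
Qed.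

Lemma uniq_sum2 g (u v : nat -> nat -> nat) i j :
  (forall t r, t < g -> r < g -> u t r < g /\ v t r < g) ->
  uniq [seq (u t r, v t r) | t <- iota 0 g, r <- iota 0 g] ->
  \sum_(t <- iota 0 g) \sum_(r <- iota 0 g) ((u t r == i) && (v t r == j)) = (i < g) && (j < g).
Proof.
move=> uvg U; pose Q := [seq (u t r, v t r) | t <- iota 0 g, r <- iota 0 g].
have -> : \sum_(t <- iota 0 g) \sum_(r <- iota 0 g) ((u t r == i) && (v t r == j)) =
    count_mem (i, j) Q.
  rewrite count_flatten_map; apply: eq_bigr => t _.
  by rewrite count_map count_big; apply: eq_bigr => r _; rewrite /= xpair_eqE.
rewrite count_uniq_mem //.
have S : {subset Q <= [seq (a, b) | a <- iota 0 g, b <- iota 0 g]}.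
  move=> _ /allpairsP[[t r] /= [tg rg ->]]; apply/allpairsP; exists (u t r, v t r).
  by move: tg rg; rewrite !mem_iota => tg rg; have [] := uvg _ _ tg rg.
have [|_ ->] := uniq_min_size U S; first by rewrite !size_allpairs.
congr nat_of_bool; apply/allpairsP/andP => [[[a b] /=]|[ig jg]].
  by rewrite !mem_iota => -[ag bg [-> ->]].
by exists (i, j); rewrite !mem_iota.
Qed.

Lemma uniq_pairs g (u v : nat -> nat -> nat) :
  (forall t r t' r', t < g -> r < g -> t' < g -> r' < g ->
     u t r = u t' r' -> v t r = v t' r' -> t = t' /\ r = r') ->
  uniq [seq (u t r, v t r) | t <- iota 0 g, r <- iota 0 g].
Proof.
move=> I; rewrite (allpairs_uniq (f := fun t r => (u t r, v t r))) ?iota_uniq //.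
move=> [t r] [t' r'] /allpairsP[[a b] /= [+ + [-> ->]]] /allpairsP[[c d] /= [+ + [-> ->]]].
rewrite !mem_iota /= => ag bg cg dg [e1 e2].
by have [-> ->] := I _ _ _ _ ag bg cg dg e1 e2.
Qed.

(** Offsets 0, t, 2t modulo g. Neighbouring types differ by t, so two neighbouring copies determine
    both t and r. *)
Definition cyc_off g a t r := if a == 0 then r else if a == 1 then (r + t) %% g else (r + t + t) %% g.

Section Cyc.
Variable g : nat.
Hypothesis g0 : 0 < g.

Let small x y : x < g -> y < g -> x = y %[mod g] -> x = y.
Proof. by move=> xg yg; rewrite !modn_small. Qed.

Let cancel_r z x y : x < g -> y < g -> z + x = z + y %[mod g] -> x = y.
Proof. by move=> xg yg /eqP; rewrite eqn_modDl => /eqP; apply: small. Qed.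

Lemma cyc_off_sum a t i : t < g ->
  \sum_(r <- iota 0 g) (cyc_off g a t r == i) = (i < g).
Proof.
move=> tg; apply: uniq_sum => [r rg|r r']; rewrite /cyc_off.
  by case: ifP => // _; case: ifP => _; rewrite ltn_pmod.
rewrite !inE => rg rg'; case: ifP => // _; case: ifP => _ H.
  by apply: (@cancel_r t) => //; rewrite addnC H addnC.
by apply: (@cancel_r (t + t)) => //; rewrite ![t + t + _]addnC !addnA.
Qed.

Lemma cyc_off_adj a b i j : slot_adj a b ->
  \sum_(t <- iota 0 g) \sum_(r <- iota 0 g) ((cyc_off g a t r == i) && (cyc_off g b t r == j))
    = (i < g) && (j < g).
Proof.
have c1 t r t' r' : t < g -> r < g -> t' < g -> r' < g ->
    (r + t) %% g = (r' + t') %% g -> (r + t + t) %% g = (r' + t' + t') %% g -> t = t' /\ r = r'.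
  move=> tg rg tg' rg' e1 e2.
  have et : t = t'.
    by apply: (@cancel_r (r + t)) => //; rewrite e2 -[LHS]modnDml -e1 modnDml.
  by split=> //; subst t'; apply: (@cancel_r t) => //; rewrite addnC e1 addnC.
move=> adj; apply: uniq_sum2 => [t r tg rg|].
  by rewrite /cyc_off; do 4?case: ifP => _; rewrite ?ltn_pmod.
apply: uniq_pairs => t r t' r' tg rg tg' rg'.
move: adj; rewrite /slot_adj !inE => /or3P[] /eqP[-> ->]; rewrite /cyc_off /=.
- by move=> <- H; split=> //; apply: (@cancel_r r).
- exact: c1.
by move=> e2 e1; apply: c1.
Qed.

(** A 2-cycle closes from type 1, where t can be recovered whatever the parity of g. *)
Lemma cyc_off_close1 i j :
  \sum_(t <- iota 0 g) \sum_(r <- iota 0 g) ((cyc_off g 1 t r == i) && (r.+1 %% g == j))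
    = (i < g) && (j < g).
Proof.
apply: uniq_sum2 => [t r tg rg|]; first by rewrite /cyc_off /= !ltn_pmod.
apply: uniq_pairs => t r t' r' tg rg tg' rg'; rewrite /cyc_off /= => e1 e2.
have er : r = r' by apply: (@cancel_r 1).
by split=> //; subst r'; apply: (@cancel_r r).
Qed.

Hypothesis g_odd : odd g.

Let half x y : x < g -> y < g -> x + x = y + y %[mod g] -> x = y.
Proof.
move=> xg yg; rewrite !addnn -!mul2n; wlog le : x y xg yg / y <= x.
  by move=> H; have [/H|/ltnW/H] := leqP y x; [apply|move=> K /esym/K->].
move=> /eqP; rewrite eqn_mod_dvd ?leq_mul2l // -mulnBr Gauss_dvdr ?coprimen2 //.
by move=> d; apply: small => //; apply/eqP; rewrite eqn_mod_dvd.
Qed.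

(** Closing from type 2 to type 0 shows only 2t, hence the restriction to odd g. *)
Lemma cyc_off_close2 i j :
  \sum_(t <- iota 0 g) \sum_(r <- iota 0 g) ((cyc_off g 2 t r == i) && (r == j))
    = (i < g) && (j < g).
Proof.
apply: uniq_sum2 => [t r tg rg|]; first by rewrite /cyc_off /= ltn_pmod.
apply: uniq_pairs => t r t' r' tg rg tg' rg'; rewrite /cyc_off /= => e1 er; split=> //.
subst r'; apply: half => //; apply/eqP; rewrite -(eqn_modDl r) !addnA; exact/eqP.
Qed.

Lemma cyc_off_close2' i j :
  \sum_(t <- iota 0 g) \sum_(r <- iota 0 g) ((cyc_off g 2 t r == i) && (r.+1 %% g == j))
    = (i < g) && (j < g).
Proof.
apply: uniq_sum2 => [t r tg rg|]; first by rewrite /cyc_off /= !ltn_pmod.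
apply: uniq_pairs => t r t' r' tg rg tg' rg'; rewrite /cyc_off /= => e1 e2.
have er : r = r' by apply: (@cancel_r 1).
split=> //; subst r'; apply: half => //; apply/eqP; rewrite -(eqn_modDl r) !addnA; exact/eqP.
Qed.

End Cyc.

Definition xor4 x y := nth 0 (nth [::] [:: [:: 0; 1; 2; 3]; [:: 1; 0; 3; 2];
  [:: 2; 3; 0; 1]; [:: 3; 2; 1; 0]] x) y.

(** For g = 4 the group Z_4 fails, as 2 is not invertible. The offsets are 0, t, wt in the field of
    4 elements, where [[:: 0; 2; 3; 1]] is multiplication by a primitive element w; the multipliers
    1, w and w - 1 that occur between types are all nonzero. *)
Definition quad_off a t r :=
  if a == 0 then r else if a == 1 then xor4 r t else xor4 r (nth 0 [:: 0; 2; 3; 1] t).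

Lemma slot_last p : odd p -> 1 < p -> slot p.-1 = 2.
Proof. by case: p => [|[|p]] //=; rewrite negbK /slot /= => ->. Qed.

Section Lifts.
Variables (T : eqType) (V : pred T) (A : T -> T -> nat).

(** Multiplies the number of vertices and keeps the cycle length, whereas [dec_cols] multiplies
    both. *)
Lemma dec_lift p k g : odd p -> 1 < p -> odd g || (g == 4) -> dec p k V A ->
  dec p (k * g) (fun q : T * nat => V q.1 && (q.2 < g))
    (fun q q' => A q.1 q'.1 * ((q.2 < g) && (q'.2 < g))).
Proof.
move=> po p1 /orP[go|/eqP->].
  have g0 : 0 < g by case: g go.
  apply: (dec_parallel (f := cyc_off g) (cl := id)) => //.
  - by move=> n t i; apply: cyc_off_sum.
  - by move=> a b i j; apply: cyc_off_adj.
  rewrite (slot_last po p1).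
  exact: cyc_off_close2.
apply: (dec_parallel (f := quad_off) (cl := id)) => //.
- move=> n t i t4; apply: uniq_sum => [r|r r'].
    have : all (fun t => all (fun r => all (fun a => quad_off a t r < 4) [:: 0; 1; 2])
      (iota 0 4)) (iota 0 4) by [].
    move=> /allP/(_ t); rewrite mem_iota => /(_ t4) /allP H r4.
    have := H r; rewrite mem_iota => /(_ r4) /allP; apply.
    by case: n => [|n] //=; rewrite /slot; case: (odd n).
  have : all (fun t => all (fun r => all (fun r' => all (fun a => (quad_off a t r == quad_off a t r')
      ==> (r == r')) [:: 0; 1; 2]) (iota 0 4)) (iota 0 4)) (iota 0 4) by [].
  move=> /allP/(_ t); rewrite mem_iota => /(_ t4) /allP H; rewrite !inE => r4 r4' e.
  have := H r; rewrite mem_iota => /(_ r4) /allP/(_ r'); rewrite mem_iota => /(_ r4').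
  have nt : slot n \in [:: 0; 1; 2] by case: n {e} => [|n] //=; rewrite /slot; case: (odd n).
  by move=> /allP/(_ _ nt); rewrite e eqxx => /eqP.
- move=> a b i j ab; apply: uniq_sum2.
    move=> t r t4 r4; split.
      by move: ab; rewrite /slot_adj !inE => /or3P[] /eqP[-> _];
         move: t t4 r r4; do 5?[case=> //]; move=> _; do 5?[case=> //].
    by move: ab; rewrite /slot_adj !inE => /or3P[] /eqP[_ ->];
         move: t t4 r r4; do 5?[case=> //]; move=> _; do 5?[case=> //].
  by move: ab; rewrite /slot_adj !inE => /or3P[] /eqP[-> ->].
rewrite (slot_last po p1) => i j.
apply: uniq_sum2 => // t r t4 r4; split=> //.
by move: t t4 r r4; do 5?[case=> //]; move=> _; do 5?[case=> //].
Qed.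

Lemma dec_cols p k g : odd p -> 1 < p -> odd g -> dec p k V A ->
  dec (p * g) (k * g) (fun q : T * nat => V q.1 && (q.2 < g))
    (fun q q' => A q.1 q'.1 * ((q.2 < g) && (q'.2 < g))).
Proof.
move=> po p1 go; have g0 : 0 < g by case: g go.
apply: (dec_winding (f := cyc_off g) (cl := fun r => r.+1 %% g)) => //.
- by move=> n t i; apply: cyc_off_sum.
- by move=> a b i j; apply: cyc_off_adj.
rewrite (slot_last po p1).
exact: cyc_off_close2'.
Qed.

(** A 1-factor is regarded as a factor of 2-cycles; chaining the h lifts of a 2-cycle gives a cycle
    of length 2h that alternates between its two ends. *)
Lemma dec_edges k h : 0 < h -> dec 2 k V A ->
  dec (2 * h) (k * h) (fun q : T * nat => V q.1 && (q.2 < h))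
    (fun q q' => A q.1 q'.1 * ((q.2 < h) && (q'.2 < h))).
Proof.
move=> h0; apply: (dec_winding (f := cyc_off h) (cl := fun r => r.+1 %% h)) => //.
- by move=> n t i; apply: cyc_off_sum.
- by move=> a b i j; apply: cyc_off_adj.
exact: cyc_off_close1.
Qed.

End Lifts.

(** * One-factorizations and the general case of even m *)

Lemma dec_matching n (V : pred nat) (f : nat -> nat) :
  (forall x, V x -> x < n) -> (forall x, V x -> [&& V (f x), f x != x & f (f x) == x]) ->
  dec 2 1 V (fun x y => V x && (y == f x)).
Proof.
(* [r] keeps the smaller end of each edge, so that every 2-cycle is listed once. *)
move=> Vn Vf; pose r := [seq x <- iota 0 n | V x & x < f x].
have rP x : (x \in r) = V x && (x < f x).
  rewrite mem_filter mem_iota /=; case Vx: (V x) => //=.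
  by rewrite (Vn _ Vx) andbT.
have ur : uniq r by rewrite filter_uniq ?iota_uniq.
have cr (P : pred nat) v : (forall x, x \in r -> P x = (x == v)) -> count P r = (v \in r).
  by move=> H; rewrite -(count_uniq_mem _ ur); apply: eq_in_count => x /H ->.
have cf v : V v -> forall x, x \in r -> (f x == v) = (x == f v).
  move=> Vv x; rewrite rP => /andP[Vx _]; have /and3P[_ _ /eqP fx] := Vf _ Vx.
  by have /and3P[_ _ /eqP fv] := Vf _ Vv; apply/eqP/eqP => [<-|->].
have fl v : count_mem v (flatten [seq [:: x; f x] | x <- r]) = V v.
  rewrite count_flatten_map; under eq_bigr => x _ do rewrite /= addn0.
  rewrite big_split /= -!count_big (cr (fun x => x == v) v) //.
  case Vv: (V v); last first.
    rewrite rP Vv /= add0n; apply/eqP; rewrite -leqn0 leqNgt -has_count; apply/hasPn => x.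
    rewrite rP => /andP[Vx _]; have /and3P[Vfx _ _] := Vf _ Vx.
    by apply: contraFN Vv => /eqP <-.
  rewrite (cr (fun x => f x == v) (f v)); last exact: cf.
  have /and3P[Vfv fv /eqP ffv] := Vf _ Vv; rewrite !rP Vv Vfv ffv /=.
  by case: ltngtP fv.
exists [:: [seq [:: x; f x] | x <- r]]; split=> //.
  move=> F; rewrite inE => /eqP ->; split; last exact: fl.
  by apply/allP => _ /mapP[x _ ->].
move=> x y; rewrite /larcs /= cats0 /farcs -map_comp count_flatten_map.
rewrite (eq_bigr (fun z => ((z == x) && (f z == y)) + ((f z == x) && (z == y)))); last first.
  by move=> z _; rewrite /arcs /= !xpair_eqE addn0.
rewrite big_split /= -!count_big.
case Vx: (V x); last first.
  have H (P : pred nat) : (forall z, z \in r -> P z -> V x) -> count P r = 0.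
    move=> K; apply/eqP; rewrite -leqn0 leqNgt -has_count; apply/hasPn => z zr.
    by apply/negP => /(K _ zr); rewrite Vx.
  rewrite !H // => z; rewrite rP => /andP[Vz _] /andP[/eqP <- _] //.
  by have /and3P[] := Vf _ Vz.
have /and3P[Vfx fx /eqP ffx] := Vf _ Vx.
have [->|ny] := eqVneq y (f x); last first.
  rewrite !(@eq_in_count _ _ pred0) ?count_pred0 // => z; rewrite rP => /andP[Vz _] /=.
    apply/negP => /andP[/eqP e /eqP e']; move: ny; rewrite -e' -e.
    by have /and3P[_ _ /eqP ->] := Vf _ Vz; rewrite eqxx.
  by apply/negP => /andP[/eqP -> /eqP e']; rewrite e' eqxx in ny.
rewrite (cr _ x) => [|z zr]; last by rewrite /=; case: eqP => [->|] //=; rewrite eqxx.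
rewrite (cr _ (f x)) => [|z zr]; last by rewrite /= (cf _ Vx) // andbb.
by rewrite !rP Vx Vfx ffx /=; case: ltngtP fx.
Qed.

(* The classical one-factorization of K_(N+1) on Z_N and a point N at infinity, by sums. *)
Definition mate N c x :=
  if x == N then (if odd c then (c + N)./2 else c./2)
  else let y := if x <= c then c - x else c + N - x in if y == x then N else y.

Lemma mateP N c x : odd N -> c < N -> x <= N ->
  [&& mate N c x <= N, mate N c x != x & mate N c (mate N c x) == x].
Proof. by move=> oN cN xN; rewrite /mate; casesif; lia. Qed.

Lemma mate_sum N x y : odd N -> x <= N ->
  \sum_(c <- iota 0 N) (y == mate N c x) = (y <= N) && (x != y).
Proof.
move=> oN xN; rewrite -(count_big (fun c => y == mate N c x)).
have [/andP[yN xy]|H] := boolP ((y <= N) && (x != y)); last first.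
  rewrite (@eq_in_count _ _ pred0) ?count_pred0 // => c; rewrite mem_iota /= => cN.
  apply: contraNF H => /eqP ->; have /and3P[-> ] := mateP oN cN xN.
  by rewrite eq_sym => ->.
(* The only colour joining x and y is their sum, or twice the finite one if the other is
   infinity. *)
pose c0 := if x == N then (if y.*2 < N then y.*2 else y.*2 - N) else
  if y == N then (if x.*2 < N then x.*2 else x.*2 - N) else
  if x + y < N then x + y else x + y - N.
rewrite (@eq_in_count _ _ (pred1 c0)); first by rewrite count_uniq_mem ?iota_uniq // mem_iota /c0; casesif; lia.
move=> c; rewrite mem_iota /= => cN; rewrite /c0 /mate.
by apply/eqP/eqP; casesif; lia.
Qed.

Lemma dec_mate N c : odd N -> c < N ->
  dec 2 1 (fun x => x <= N) (fun x y => (x <= N) && (y == mate N c x)).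
Proof. by move=> oN cN; apply: (@dec_matching N.+1) => // x xN; apply: mateP. Qed.

Definition bl (V : pred nat) w (p : nat * nat) := V p.1 && (p.2 < w).

Definition Kbl (V : pred nat) w (p q : nat * nat) : nat := [&& bl V w p, bl V w q & p != q].

Definition blift (A : nat -> nat -> nat) w (p q : nat * nat) : nat :=
  A p.1 q.1 * ((p.2 < w) && (q.2 < w)).

Lemma dec_place m k w (s : seq nat) : 0 < w -> uniq s ->
  dec m k (fun x => x < size s * w) (Kstar (size s * w)) ->
  dec m k (bl (mem s) w) (Kbl (mem s) w).
Proof.
move=> w0 us; pose f x := (nth 0 s (x %/ w), x %% w).
have fV x : x < size s * w -> bl (mem s) w (f x).
  by move=> lt; rewrite /bl /f /= ltn_pmod // andbT mem_nth // ltn_divLR.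
have fI : {in (fun x => x < size s * w) &, injective f}.
  move=> x y; rewrite !unfold_in => xl yl [/eqP].
  rewrite nth_uniq ?ltn_divLR // => /eqP e1 e2.
  by rewrite (divn_eq x w) (divn_eq y w) e1 e2.
apply: (dec_map (f := f)) => //.
- move=> [a b] /andP[/= ain bw]; exists (index a s * w + b).
    by rewrite -ltn_divLR // divnMDl // divn_small // addn0 index_mem.
  by rewrite /f divnMDl // divn_small // addn0 modnMDl modn_small // nth_index.
- move=> x y xl yl; rewrite /Kbl !fV // /Kstar xl yl /=; congr nat_of_bool.
  by rewrite (inj_in_eq fI).
by move=> x y; rewrite /Kbl; case: (bl _ _ x); case: (bl _ _ y).
Qed.

Lemma dec_flat m k n w : 0 < w -> dec m k (bl (fun x => x < n) w) (Kbl (fun x => x < n) w) ->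
  dec m k (fun x => x < n * w) (Kstar (n * w)).
Proof.
move=> w0; pose f (p : nat * nat) := p.1 * w + p.2.
have fI : {in bl (fun x => x < n) w &, injective f}.
  move=> [a b] [c d]; rewrite !unfold_in /bl /f /= => /andP[_ bw] /andP[_ dw] e.
  have := congr1 (divn^~ w) e; rewrite !divnMDl // !divn_small // !addn0 => ac.
  by have := congr1 (modn^~ w) e; rewrite !modnMDl !modn_small // ac => ->.
apply: (dec_map (f := f)) => //.
- move=> [a b] /andP[/= an bw]; rewrite /f /=; nia.
- move=> x xl; exists (x %/ w, x %% w); last by rewrite /f -divn_eq.
  by rewrite /bl /= ltn_pmod // andbT ltn_divLR.
- move=> x y xV yV; rewrite /Kbl xV yV /Kstar (inj_in_eq fI) //; congr nat_of_bool.
  have H z : bl (fun x => x < n) w z -> f z < n * w by case: z => a b /andP[/= an bw]; rewrite /f /=; nia.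
  by rewrite !H.
by move=> x y; rewrite /Kstar; case: (x < _); case: (y < _).
Qed.

(* The edges of the matching of sum 0 are blown up, with the labels themselves, to copies of K*_(2w). *)
Lemma dec_pairs m w N : odd N -> 0 < w ->
  (forall k V A, dec 2 k V A -> dec m (k * w) (bl V w) (blift A w)) ->
  dec m (2 * w).-1 (fun x => x < 2 * w) (Kstar (2 * w)) ->
  dec m (N.+1 * w).-1 (fun x => x < N.+1 * w) (Kstar (N.+1 * w)).
Proof.
move=> oN w0 blow base; apply: dec_flat => //.
have N0 : 0 < N by case: N oN.
pose r := [seq x <- iota 0 N.+1 | x < mate N 0 x].
have rP x : x \in r -> [/\ x <= N, x < mate N 0 x & mate N 0 (mate N 0 x) = x].
  rewrite mem_filter mem_iota => /andP[lt xN]; split=> //.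
  by have /and3P[_ _ /eqP] := mateP oN N0 xN.
have D1 : dec m (2 * w).-1 (fun p => has (fun x => bl (mem [:: x; mate N 0 x]) w p) r)
    (fun p q => \sum_(x <- r) Kbl (mem [:: x; mate N 0 x]) w p q).
  apply: dec_bigunion.
  - by rewrite filter_uniq ?iota_uniq.
  - move=> x y p /rP[_ lx ex] /rP[_ ly ey]; rewrite /bl !inE => /andP[+ _] /andP[+ _].
    move=> /orP[] /eqP -> /orP[] /eqP e; first by [].
    + by move: lx; rewrite e ey; lia.
    + by move: ly; rewrite -e ex; lia.
    by rewrite -ex e ey.
  move=> x /rP[_ lt _]; apply: (@dec_place _ _ w [:: x; mate N 0 x]) => //.
  by rewrite /= inE andbT; lia.
have D2 : dec m (N.-1 * w) (bl (fun x => x <= N) w)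
    (blift (fun x y => \sum_(c <- iota 1 N.-1) ((x <= N) && (y == mate N c x))) w).
  apply: blow; rewrite -[X in dec _ X](size_iota 1) -sum1_size.
  by apply: dec_sum => c; rewrite mem_iota => cN; apply: dec_mate => //; lia.
have rep a : a <= N -> exists2 x, x \in r & forall y, y \in r -> (a \in [:: y; mate N 0 y]) = (y == x).
  move=> aN; have /and3P[maN nma /eqP mma] := mateP oN N0 aN.
  have inr z : z <= N -> z < mate N 0 z -> z \in r.
    by move=> zN lz; rewrite mem_filter lz mem_iota /=; lia.
  have [lt|le] := ltnP a (mate N 0 a).
    exists a; first exact: inr.
    move=> y /rP[yN ly my]; rewrite !inE eq_sym; case: eqP => //= ne.
    by apply/eqP => e; move: ly lt; rewrite e my; lia.
  exists (mate N 0 a); first by apply: inr; rewrite ?mma //; lia.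
  move=> y /rP[yN ly my]; rewrite !inE; apply/orP/eqP => [[/eqP e|/eqP ->]|->].
  - by move: ly le; rewrite -e; lia.
  - by rewrite my.
  by right; rewrite mma.
have D1' : dec m (2 * w).-1 (bl (fun x => x <= N) w)
    (fun p q => \sum_(x <- r) Kbl (mem [:: x; mate N 0 x]) w p q).
  apply: dec_ext D1 => // -[a b]; rewrite /bl /=.
  apply/hasP/andP => [[x /rP[xN lt mx]] /andP[]|[aN bw]].
    rewrite !inE => /orP[] /eqP -> //.
    by have /and3P[] := mateP oN N0 xN.
  have [x xr /(_ _ xr)] := rep _ aN; rewrite eqxx => ax.
  by exists x; rewrite // ax.
(* The N - 1 matchings of nonzero sum give w factors each, and the copies of K*_(2w) give the
   remaining 2w - 1. *)
have := dec_add D2 D1'; rewrite (_ : N.-1 * w + (2 * w).-1 = (N.+1 * w).-1); last by nia.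
apply: dec_ext => // -[a b] [c d]; rewrite /blift /Kbl /bl /= !ltnS.
case bw: (b < w); last by rewrite !(andbF, andFb) muln0 big1 // => x _; rewrite andbF.
case dw: (d < w); last by rewrite !(andbF, andFb) muln0 big1 // => x _; rewrite !(andbF, andFb).
rewrite muln1 !andbT.
have [aN|aN] := leqP a N; last first.
  rewrite big1 // big1_seq // => x /andP[_ /rP[xN _ _]]; rewrite !inE.
  have /and3P[mN _ _] := mateP oN N0 xN.
  by case: eqP => [e|_]; [lia|case: eqP => [e|//]; lia].
have [x xr xP] := rep _ aN.
under [X in _ + X = _]eq_bigr => y _ do rewrite !andbT.
rewrite /=.
have -> : \sum_(y <- r) [&& a \in [:: y; mate N 0 y], c \in [:: y; mate N 0 y] & (a, b) != (c, d)]
    = (c \in [:: a; mate N 0 a]) && ((a, b) != (c, d)).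
  rewrite (bigD1_seq x) ?filter_uniq ?iota_uniq //= big1_seq => [|y /andP[yx yr]]; last first.
    by rewrite xP // (negPf yx).
  rewrite addn0 xP // eqxx /=; congr (nat_of_bool (_ && _)).
  have /rP[xN lx mx] := xr; move: (xP _ xr); rewrite eqxx !inE => /orP[] /eqP -> //.
  by rewrite mx orbC.
have := mate_sum c oN aN; rewrite -[N in iota 0 N](prednK N0) /= big_cons.
have /and3P[mN nm _] := mateP oN N0 aN.
rewrite !inE !xpair_eqE [c == a]eq_sym; case: (a =P c) => [<-|ac] /=.
  by rewrite aN /= => /eqP; rewrite addn_eq0 => /andP[_ /eqP ->].
by rewrite !andbT => <-; rewrite addnC.
Qed.

(** * The case m = 6 *)

(** The labels stand on a cycle, with 3 points each, and arcs run inside a label or to a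
    neighbouring one. Each row is a 6-cycle on consecutive labels whose translates by even numbers
    of labels form a factor. Every point has out-degree 3 + 3 + 2, hence 8 rows. *)
Definition strip6 : seq (seq (nat * nat)) :=
  [:: [:: (2, 0); (1, 0); (2, 2); (1, 1); (2, 1); (3, 2)];
      [:: (2, 0); (3, 1); (2, 1); (2, 2); (1, 2); (1, 0)];
      [:: (2, 0); (1, 1); (0, 2); (1, 0); (2, 1); (1, 2)];
      [:: (0, 0); (1, 2); (0, 2); (1, 1); (1, 0); (0, 1)];
      [:: (0, 0); (0, 1); (1, 1); (1, 2); (2, 2); (1, 0)];
      [:: (2, 0); (1, 2); (0, 1); (1, 0); (1, 1); (2, 2)];
      [:: (2, 0); (2, 2); (2, 1); (1, 0); (1, 2); (1, 1)];
      [:: (0, 0); (1, 0); (0, 2); (1, 2); (2, 1); (1, 1)]].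

(** [d] is the step plus one, to remain a natural number: 0 goes back, 1 stays, 2 goes forward. *)
Definition cyc_step n d P Q :=
  if d == 1 then P == Q else if d == 2 then Q == (if P.+1 == n then 0 else P.+1)
  else P == (if Q.+1 == n then 0 else Q.+1).

Section Strip6.
Variable a : nat.
Hypothesis a1 : 1 < a.
Let n := a.*2.

Definition mod2 n x := if x < n then x else x - n.

Lemma strip_shift p P : p < 4 ->
  \sum_(i <- iota 0 a) (mod2 n (p + i.*2) == P) = (P < n) && (odd p == odd P).
Proof.
move=> p4; rewrite -(count_big (fun i => mod2 n (p + i.*2) == P)).
have [/andP[Pn e]|H] := boolP (_ && _); last first.
  rewrite (@eq_in_count _ _ pred0) ?count_pred0 // => i; rewrite mem_iota /= => lia_i.
  apply: contraNF H => /eqP <-; rewrite /mod2 /n in lia_i *; case: ifP; lia.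
rewrite (@eq_in_count _ _ (pred1 (if p <= P then (P - p)./2 else (P + n - p)./2))).
  rewrite count_uniq_mem ?iota_uniq // mem_iota /n in Pn *; case: ifP; lia.
move=> i; rewrite mem_iota /mod2 /n /= in Pn *; move=> ia; apply/eqP/eqP; do 2 case: ifP; lia.
Qed.

Lemma strip_shift2 p q P Q : p < 4 -> q < 4 -> p <= q.+1 -> q <= p.+1 ->
  \sum_(i <- iota 0 a) ((mod2 n (p + i.*2) == P) && (mod2 n (q + i.*2) == Q)) =
  [&& P < n, Q < n, odd p == odd P & cyc_step n (q.+1 - p) P Q].
Proof.
move=> p4 q4 pq qp; case H: (cyc_step n (q.+1 - p) P Q && (Q < n)); last first.
  have -> : [&& P < n, Q < n, odd p == odd P & cyc_step n (q.+1 - p) P Q] = false.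
    by move: H; case: (cyc_step _ _ _ _); rewrite ?andbF //= => ->; rewrite andbF.
  rewrite big1_seq // => i /andP[_]; rewrite mem_iota => ia; apply/eqP; rewrite eqb0.
  apply: contraFN H => /andP[/eqP <- /eqP <-]; rewrite /cyc_step /mod2 /n; casesif; lia.
move: H => /andP[H Qn]; rewrite H Qn andbT /= -strip_shift //.
apply: eq_big_seq => i; rewrite mem_iota => ia; congr nat_of_bool.
case: eqP => //= e; apply/eqP; move: H e; rewrite /cyc_step /mod2 /n in Qn *; casesif; lia.
Qed.

Let move_pt i (x : nat * nat) := (mod2 n (x.1 + i.*2), x.2).

(** Up to even translation an arc is determined by the parity of its tail, its two positions and its
    step. *)
Definition strip_count e l l' d :=
  count (fun b => [&& odd b.1.1 == e, b.1.2 == l, b.2.2 == l' & b.2.1.+1 - b.1.1 == d]) (farcs strip6).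

Lemma strip6_dec : dec 6 8 (bl (fun x => x < n) 3)
  (fun x y => (bl (fun x => x < n) 3 x && bl (fun x => x < n) 3 y) *
     (cyc_step n 1 x.1 y.1 * (x.2 != y.2) + cyc_step n 2 x.1 y.1 + cyc_step n 0 x.1 y.1)).
Proof.
have cw c : c \in strip6 -> all (fun x => (x.1 < 4) && (x.2 < 3)) c by move: c; apply/allP.
have cs c : c \in strip6 -> size c = 6 by move=> H; apply/eqP; move: c H; apply/allP.
have cv c : c \in strip6 -> all (fun l => all (fun e => count (fun x => (odd x.1 == e) && (x.2 == l)) c == 1)
    [:: true; false]) (iota 0 3) by move: c; apply/allP.
pose fac c := [seq map (move_pt i) c | i <- iota 0 a].
exists (map fac strip6); split=> //.
  move=> F /mapP[c cin ->]; split.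
    by apply/allP => _ /mapP[i _ ->]; rewrite size_map cs.
  move=> [P l]; rewrite /fac count_flatten_map.
  under eq_bigr => i _ do rewrite count_map count_big.
  rewrite exchange_big /= (eq_big_seq (fun x => (P < n) * ((odd x.1 == odd P) && (x.2 == l)))).
    rewrite -big_distrr /= -count_big /bl /=; case: (P < n) => //=; rewrite mul1n.
    have [l3|l3] := ltnP l 3.
      have := cv _ cin => /allP/(_ l); rewrite mem_iota => /(_ l3) /allP/(_ (odd P)).
      by rewrite !inE; case: (odd P) => /(_ isT) /eqP.
    apply/eqP; rewrite -leqn0 leqNgt -has_count; apply/hasPn => x /(allP (cw _ cin)) /andP[_ x3].
    by apply/negP => /andP[_ /eqP e]; move: x3; rewrite e ltnNge l3.
  move=> x /(allP (cw _ cin)) /andP[x4 _]; rewrite mulnb andbA -mulnb -strip_shift // big_distrl.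
  by apply: eq_bigr => i _ /=; rewrite xpair_eqE mulnb.
move=> [P l] [Q l']; rewrite larcs_count big_map.
have E c : c \in strip6 -> \sum_(d <- fac c) count_mem ((P, l), (Q, l')) (arcs d) =
    \sum_(b <- arcs c) \sum_(d <- [:: 0; 1; 2]) [&& P < n, Q < n & cyc_step n d P Q] *
      [&& odd b.1.1 == odd P, b.1.2 == l, b.2.2 == l' & b.2.1.+1 - b.1.1 == d].
  move=> cin; rewrite big_map; under eq_bigr => i _ do rewrite arcs_map count_map count_big.
  rewrite exchange_big; apply: eq_big_seq => -[[p k] [q k']] bin.
  have [/(allP (cw _ cin)) /andP[/= p4 _] /(allP (cw _ cin)) /andP[/= q4 _]] := arcs_mem bin.
  have /andP[pq qp] : (p <= q.+1) && (q <= p.+1).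
    have /allP/(_ _ cin) /allP/(_ _ bin) : all (fun c => all (fun b : (nat * nat) * (nat * nat) =>
      (b.1.1 <= b.2.1.+1) && (b.2.1 <= b.1.1.+1)) (arcs c)) strip6 by [].
    by [].
  rewrite /= (eq_bigr (fun i => ((k == l) && (k' == l')) *
      ((mod2 n (p + i.*2) == P) && (mod2 n (q + i.*2) == Q)))); last first.
    by move=> i _; rewrite !xpair_eqE mulnb; congr nat_of_bool; case: (k == l); case: (k' == l'); rewrite ?andbF ?andbT.
  rewrite -big_distrr /= strip_shift2 // !big_cons big_nil addn0.
  have d3 : q.+1 - p = 0 \/ q.+1 - p = 1 \/ q.+1 - p = 2 by lia.
  by case: d3 => [->|[->|->]]; case: (cyc_step n 0 P Q); case: (cyc_step n 1 P Q); case: (cyc_step n 2 P Q);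
    case: (P < n); case: (Q < n); case: (odd p == odd P); case: (k == l); case: (k' == l').
rewrite (eq_big_seq _ E) {E}.
transitivity (\sum_(b <- farcs strip6) \sum_(d <- [:: 0; 1; 2])
   [&& P < n, Q < n & cyc_step n d P Q] *
   [&& odd b.1.1 == odd P, b.1.2 == l, b.2.2 == l' & b.2.1.+1 - b.1.1 == d]).
  by rewrite /farcs big_flatten big_map.
rewrite exchange_big /=.
rewrite (eq_bigr (fun d => [&& P < n, Q < n & cyc_step n d P Q] * strip_count (odd P) l l' d)); last first.
  by move=> d _; rewrite -big_distrr /strip_count count_big.
have small d : ~~ ((l < 3) && (l' < 3)) -> strip_count (odd P) l l' d = 0.
  move=> ll; apply/eqP; rewrite -leqn0 leqNgt -has_count; apply/hasPn => b bin.
  apply: contraNN ll => /and4P[_ /eqP <- /eqP <- _].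
  by move: b bin; apply/allP.
have [/andP[l3 l3']|ll] := boolP ((l < 3) && (l' < 3)); last first.
  rewrite big1 => [|d _]; last by rewrite small ?muln0.
  by rewrite /bl /=; move: ll; case: (l < 3); case: (l' < 3) => //=; rewrite ?andbF.
(* Each class of arcs occurs once in the table; for the step that stays in a label, equal positions
   are excluded. *)
have T : all (fun e => all (fun l => all (fun l' => all (fun d =>
  strip_count e l l' d == if d == 1 then nat_of_bool (l != l') else 1)
  [:: 0; 1; 2]) (iota 0 3)) (iota 0 3)) [:: true; false] by vm_compute.
have {}T d : d \in [:: 0; 1; 2] -> strip_count (odd P) l l' d = if d == 1 then (l != l' : nat) else 1.
  move=> dd; apply/eqP; move: T => /allP/(_ (odd P)) H.
  have {}H := H (_ : _); move: (H ltac:(by case: (odd P))) => /allP/(_ l).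
  rewrite mem_iota => /(_ l3) /allP/(_ l'); rewrite mem_iota => /(_ l3') /allP.
  by apply.
rewrite !big_cons big_nil !T // /bl /= l3 l3'.
case: (P < n); case: (Q < n) => //=.
by case: (cyc_step _ _ _ _); case: (cyc_step _ _ _ _); case: (cyc_step _ _ _ _); case: (l == l').
Qed.

End Strip6.

Theorem even6 a : 1 < a -> dec 6 (a.*2 * 3).-1 (fun x => x < a.*2 * 3) (Kstar (a.*2 * 3)).
Proof.
move=> a1; set N := (a.*2).-1; have oN : odd N by rewrite /N; lia.
have nN : a.*2 = N.+1 by rewrite /N; lia.
have N2 : 2 < N by rewrite /N; lia.
apply: dec_flat => //.
(* The matchings of sums 0 and 1 together form the single cycle N, 0, 1, N - 1, 2, N - 2, ..., which
   [phi] lists. *)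
pose phi p := if p == 0 then N else if p == 1 then 0 else if odd p then N - p./2 else p./2.
have phiN p : p < a.*2 -> phi p < a.*2 by rewrite /phi /N; casesif; lia.
have phiI p q : p < a.*2 -> q < a.*2 -> phi p = phi q -> p = q.
  by rewrite /phi /N; casesif; lia.
have phiS y : y < a.*2 -> exists2 p, p < a.*2 & y = phi p.
  move=> yN; exists (if y == N then 0 else if y == 0 then 1 else if y < a then y.*2 else (N - y).*2.+1).
    by rewrite /N; casesif; lia.
  by rewrite /phi /N; casesif; lia.
have phiA p q : p < a.*2 -> q < a.*2 ->
    cyc_step a.*2 2 p q + cyc_step a.*2 0 p q = (phi q == mate N 0 (phi p)) + (phi q == mate N 1 (phi p)).
  move=> pN qN; rewrite /cyc_step /=.
  have -> : (phi q == mate N 0 (phi p)) = (q == if odd p then p.-1 else p.+1).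
    by rewrite /phi /mate /N /=; apply/eqP/eqP; casesif; lia.
  have -> : (phi q == mate N 1 (phi p)) = (q == if odd p then (if p.+1 == a.*2 then 0 else p.+1)
      else if p == 0 then (a.*2).-1 else p.-1).
    by rewrite /phi /mate /N /=; apply/eqP/eqP; casesif; lia.
  by casesif; do 4?[case: eqP => ?]; lia.
have D1 : dec 6 8 (bl (fun x => x < a.*2) 3) (fun x y =>
    (bl (fun x => x < a.*2) 3 x && bl (fun x => x < a.*2) 3 y) *
    ((x.1 == y.1) * (x.2 != y.2) + ((y.1 == mate N 0 x.1) + (y.1 == mate N 1 x.1)))).
  apply: (dec_map (f := fun x => (phi x.1, x.2)) _ _ _ _ _ (strip6_dec a1)).
  - move=> [p l] [q l']; rewrite !unfold_in /bl /= => /andP[pN _] /andP[qN _] [e ->].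
    by rewrite (phiI _ _ pN qN e).
  - by move=> [p l]; rewrite /bl /= => /andP[/phiN -> ->].
  - move=> [y l]; rewrite /bl /= => /andP[/phiS[p pN ->] l3].
    by exists (p, l); rewrite /= ?pN.
  - move=> [p l] [q l']; rewrite /bl /= => /andP[pN l3] /andP[qN l3'].
    rewrite !phiN // pN qN l3 l3' !mul1n -phiA // -addnA; congr (_ * _ + _).
    by rewrite /cyc_step /=; congr nat_of_bool; apply/eqP/eqP => [/(phiI _ _ pN qN)|->].
  by move=> x y; case: (bl _ _ x); case: (bl _ _ y).
have D2 : dec 6 ((N - 2) * 3) (bl (fun x => x < a.*2) 3)
    (blift (fun x y => \sum_(c <- iota 2 (N - 2)) ((x < a.*2) && (y == mate N c x))) 3).
  apply: (@dec_edges _ _ _ (N - 2) 3) => //.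
  rewrite -[X in dec _ X](size_iota 2) -sum1_size nN.
  by apply: dec_sum => c; rewrite mem_iota => cN; apply: dec_mate => //; lia.
have := dec_add D2 D1; rewrite (_ : (N - 2) * 3 + 8 = (a.*2 * 3).-1); last by rewrite nN; lia.
apply: dec_ext => // -[x l] [y l']; rewrite /blift /Kbl /bl /=.
case l3: (l < 3); last by rewrite !(andbF, andFb) muln0.
case l3': (l' < 3); last by rewrite !(andbF, andFb) muln0 mul0n.
have [xN|xN] := ltnP x a.*2; last by rewrite big1.
rewrite muln1 !andbT /=.
have xN' : x <= N by rewrite -ltnS -nN.
have := mate_sum y oN xN'; rewrite (_ : iota 0 N = [:: 0, 1 & iota 2 (N - 2)]); last by case: (N) N2 => [|[|k]] //; rewrite subn2.
rewrite !big_cons -ltnS -nN xpair_eqE.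
case: (y < a.*2) => /=; last by move=> /eqP; rewrite !addn_eq0 => /and3P[_ _ /eqP ->]; rewrite mul0n.
by case: (x =P y) => [->|_] /= e; rewrite mul1n ?mul0n ?mul1n; move: e; lia.
Qed.

(** * Strips: cycles that wind once around the columns, and the insertion of two columns *)

Definition pt : Type := (nat * nat)%type.

Definition inner (c : seq pt) : seq (pt * pt) := if c is x :: s then pairmap pair x s else [::].

Definition closing (c : seq pt) : pt * pt := (last (0, 0) c, head (0, 0) c).

Lemma count_arcs_inner a c : c != [::] ->
  count_mem a (arcs c) = count_mem a (inner c) + (closing c == a).
Proof. by case: c => // x s _; rewrite arcs_pairmap -cats1 count_cat /= addn0. Qed.

(** Narrow strips ([b] false) supply the step 1, to be scaled later to the steps from 3 on; wide
    strips supply the steps 0, 1 and 2 together. *)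
Definition step_ok (b : bool) d := (d == 1) || b && ((d == 0) || (d == 2)).

(* Cycles wind once around the columns: they are cut open at the column 0. *)
Definition cut_ok (b : bool) m (c : seq pt) :=
  let: (l, h) := ((closing c).1.2, (closing c).2.2) in
  (l == m.-1) && (h == 0) || b && ((l == m.-2) && (h == 0) || (l == m.-1) && (h == 1)).

(** The labels that this cycle will receive in the new last column, and in [cover_first] in the new
    first one. [strip_fac] asks that over a factor they cover each label once. *)
Definition cover_last m (c : seq pt) : seq nat :=
  let: ((x, l), (y, h)) := closing c in
  if h == 1 then [::] else if l == m.-1 then [:: y] else [:: x; y].

Definition cover_first m (c : seq pt) : seq nat :=
  let: ((x, l), (y, h)) := closing c in
  if h == 1 then [:: x; y] else if l == m.-1 then [:: x] else [::].

Definition strip_fac b m (V : pred nat) (F : seq (seq pt)) : Prop :=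
  [/\ all (fun c => (size c == m) && cut_ok b m c) F,
      forall p, count_mem p (flatten F) = bl V m p,
      forall v, count_mem v (flatten (map (cover_last m) F)) = V v
    & forall v, count_mem v (flatten (map (cover_first m) F)) = V v].

Definition inner_ok b m (a : pt * pt) :=
  [&& a.1.2 <= a.2.2, a.2.2 < m & step_ok b (a.2.2 - a.1.2)].

Definition closing_ok b m (a : pt * pt) :=
  (a.1.2 == m.-1) && (a.2.2 == 0) ||
  b && ((a.1.2 == m.-2) && (a.2.2 == 0) || (a.1.2 == m.-1) && (a.2.2 == 1)).

(** [I] indexes the holes of a frame, or has one element when there is no hole. Inner and closing
    arcs are counted apart because an insertion merely shifts the former but replaces the latter. *)
Definition strip b m k (I : seq nat) (V : nat -> pred nat) (A : nat -> nat -> nat) : Prop :=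
  exists L : nat -> seq (seq (seq pt)),
  [/\ forall z, z \in I -> size (L z) = k,
      forall z F, z \in I -> F \in L z -> strip_fac b m (V z) F,
      forall a, \sum_(z <- I) \sum_(F <- L z) \sum_(c <- F) count_mem a (inner c) =
        A a.1.1 a.2.1 * inner_ok b m a
    & forall a, \sum_(z <- I) \sum_(F <- L z) \sum_(c <- F) (closing c == a) =
        A a.1.1 a.2.1 * closing_ok b m a].

Definition up (c : seq pt) : seq pt := [seq (p.1, p.2.+1) | p <- c].

(** All columns move up by one, and 0 and m + 1 are new. The closing arc from label x to label y
    becomes a walk through two new points labelled x and y. If its step was 1, there is one of them
    in each new column and the walk makes three steps 1; if it was 2, both lie in the same new
    column and the walk makes a step 0 between two steps 2. *)
Definition extend m (c : seq pt) : seq pt :=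
  let: ((x, l), (y, h)) := closing c in
  if h == 1 then [:: (y, 0), (x, 0) & up c]
  else if l == m.-1 then (x, 0) :: rcons (up c) (y, m.+1)
  else up c ++ [:: (y, m.+1); (x, m.+1)].

Definition up_arcs (s : seq (pt * pt)) := [seq ((a.1.1, a.1.2.+1), (a.2.1, a.2.2.+1)) | a <- s].

Lemma inner_up c : inner (up c) = up_arcs (inner c).
Proof. by case: c => // x s /=; elim: s x => //= y s IH x; rewrite IH. Qed.

Lemma up_arcs_count s u l v l' :
  count_mem ((u, l), (v, l')) (up_arcs s) =
  if (0 < l) && (0 < l') then count_mem ((u, l.-1), (v, l'.-1)) s else 0.
Proof.
case: l => [|l]; last case: l' => [|l'] /=.
- by elim: s => //= a s ->; rewrite !xpair_eqE andbF.
- by elim: s => //= a s ->; rewrite !xpair_eqE !andbF.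
by rewrite count_map; apply: eq_count => -[[p i] [q j]]; rewrite /= !xpair_eqE !eqSS.
Qed.

Lemma perm_swap (T : eqType) (x y : T) s : perm_eq [:: x, y & s] [:: y, x & s].
Proof. by rewrite -[X in perm_eq X]/([:: x] ++ [:: y] ++ s) perm_catCA. Qed.

Lemma extend_cases b m c : 4 < m -> c != [::] -> cut_ok b m c ->
  exists x y,
  [\/ [/\ closing c = ((x, m.-1), (y, 0)), closing (extend m c) = ((y, m.+1), (x, 0)),
          perm_eq (inner (extend m c)) [:: ((x, 0), (y, 1)), ((x, m), (y, m.+1)) & up_arcs (inner c)],
          perm_eq (extend m c) [:: (x, 0), (y, m.+1) & up c] & true],
      [/\ closing c = ((x, m.-2), (y, 0)), closing (extend m c) = ((x, m.+1), (y, 1)),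
          perm_eq (inner (extend m c)) [:: ((x, m.-1), (y, m.+1)), ((y, m.+1), (x, m.+1)) & up_arcs (inner c)],
          perm_eq (extend m c) [:: (x, m.+1), (y, m.+1) & up c] & b]
    | [/\ closing c = ((x, m.-1), (y, 1)), closing (extend m c) = ((x, m), (y, 0)),
          perm_eq (inner (extend m c)) [:: ((y, 0), (x, 0)), ((x, 0), (y, 2)) & up_arcs (inner c)],
          perm_eq (extend m c) [:: (x, 0), (y, 0) & up c] & b]].
Proof.
case: c => [//|[y h] s] m4 _; rewrite /cut_ok /extend -inner_up /=.
case El: (last (y, h) s) => [x l] /=; rewrite /closing /= El.
have L : last (y, h.+1) (up s) = (x, l.+1).
  by rewrite -[(y, h.+1)]/((fun p : pt => (p.1, p.2.+1)) (y, h)) last_map El.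
have m2 : m.-2.+1 = m.-1 by lia.
have m1 : m.-1.+1 = m by lia.
move=> H; exists x, y; move: H L.
move=> /orP[/andP[/eqP -> /eqP ->]|/andP[-> /orP[]/andP[/eqP -> /eqP ->]]] L.
- apply: Or31; rewrite eqxx /= last_rcons -cats1 pairmap_cat L m1 /=; split=> //.
    by rewrite perm_cons cats1 perm_rcons.
  by rewrite perm_cons -cat_cons cats1 perm_rcons.
- apply: Or32; have -> : (m.-2 == m.-1) = false by lia.
  rewrite /= last_cat /= pairmap_cat L m2 /=; split=> //.
    by rewrite perm_catC.
  by rewrite -cat_cons perm_catC; apply: perm_swap.
apply: Or33; rewrite /= L m1; split=> //.
exact: perm_swap.
Qed.

Lemma count_swap2 (T : eqType) (p x y : T) s : count_mem p [:: x, y & s] = (x == p) + (y == p) + count_mem p s.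
Proof. by rewrite /= addnA. Qed.

(** [extend] exchanges the roles of [cover_first] and [cover_last], so both conditions survive and
    the insertion can be repeated. *)
Lemma extend_fac b m V F : 4 < m -> strip_fac b m V F -> strip_fac b m.+2 V (map (extend m) F).
Proof.
move=> m4 [aF cF c1 c2].
have cs c : c \in F -> [/\ c != [::], size c = m & cut_ok b m c].
  by move=> /(allP aF) /andP[/eqP sc cc]; split=> //; rewrite -size_eq0 sc; lia.
have m1 : m.-1.+1 = m by lia.
split.
- apply/allP => _ /mapP[c /cs[c0 sc /(extend_cases m4 c0)]] [x [y H]] ->.
  have sz z t : perm_eq (extend m c) [:: z, t & up c] -> size (extend m c) = m.+2.
    by move=> /perm_size ->; rewrite /= size_map sc.
  case: H => -[_ e _ /sz -> bb]; rewrite eqxx /cut_ok e /= !eqxx /= ?bb ?orbT //.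
- move=> [v l]; have up0 c : count_mem (v, l) (up c) = if l is l'.+1 then count_mem (v, l') c else 0.
    rewrite count_map; case: l => [|l]; last by apply: eq_count => -[p i]; rewrite /= !xpair_eqE eqSS.
    by rewrite (eq_count (a2 := pred0)) ?count_pred0 // => -[p i]; rewrite /= xpair_eqE andbF.
  have E c : c \in F -> count_mem (v, l) (extend m c) = (if l is l'.+1 then count_mem (v, l') c else 0)
      + (l == 0) * count_mem v (cover_first m c) + (l == m.+1) * count_mem v (cover_last m c).
    move=> /cs[c0 sc /(extend_cases m4 c0)] [x [y H]].
    have ne : (m.-2 == m.-1) = false by lia.
    case: H => -[e _ _ /permP -> _]; rewrite count_swap2 up0 /cover_first /cover_last e /= ?eqxx ?ne.
    + rewrite !xpair_eqE /= ![_ == l]eq_sym; case: (l == 0); case: (l == m.+1); rewrite ?andbF ?andbT; lia.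
    + rewrite !xpair_eqE /= ![_ == l]eq_sym; case: (l == 0); case: (l == m.+1); rewrite ?andbF ?andbT; lia.
    + rewrite !xpair_eqE /= ![_ == l]eq_sym; case: (l == 0); case: (l == m.+1); rewrite ?andbF ?andbT; lia.
  rewrite count_flatten_map (eq_big_seq _ E) !big_split /= -!big_distrr /= -!count_flatten_map c1 c2.
  rewrite /bl /=; case: l {up0 E} => [|l]; first by rewrite big1 //=; lia.
  have := cF (v, l); rewrite -[F in flatten F]map_id count_flatten_map => ->.
  by rewrite /bl /= !eqSS mul0n addn0; case: (V v) => /=; lia.
- move=> v; rewrite -(c2 v) -map_comp !count_flatten_map; apply: eq_big_seq => c.
  move=> /cs[c0 sc /(extend_cases m4 c0)] [x [y H]].
  have ne : (m.-2 == m.-1) = false by lia.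
  have ne' : (m == m.+1) = false by lia.
  by case: H => -[e e' _ _ _]; rewrite /= /cover_first /cover_last e e' /= ?eqxx ?ne ?ne' //= addnC.
move=> v; rewrite -(c1 v) -map_comp !count_flatten_map; apply: eq_big_seq => c.
move=> /cs[c0 sc /(extend_cases m4 c0)] [x [y H]].
have ne : (m.-2 == m.-1) = false by lia.
have ne' : (m == m.+1) = false by lia.
by case: H => -[e e' _ _ _]; rewrite /= /cover_first /cover_last e e' /= ?eqxx ?ne ?ne' //= addnC.
Qed.

Ltac abstract_bools := repeat match goal with |- context [nat_of_bool ?B] =>
  let n := fresh in set n := nat_of_bool B; clearbody n end.

Lemma inner_ok0 b m u l v : inner_ok b m ((u, l), (v, l)) = b && (l < m).
Proof. by rewrite /inner_ok /step_ok /= leqnn subnn /= andbT andbC. Qed.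

Lemma inner_ok1 b m u l v : inner_ok b m ((u, l), (v, l.+1)) = (l.+1 < m).
Proof. by rewrite /inner_ok /step_ok /= leqnSn subSnn /= andbT. Qed.

Lemma inner_ok2 b m u l v : inner_ok b m ((u, l), (v, l.+2)) = b && (l.+2 < m).
Proof.
by rewrite /inner_ok /step_ok /= (_ : l.+2 - l = 2) /= ?andbT 1?andbC ?leqW //; lia.
Qed.

Lemma inner_ok_far b m u l v l' : [&& l' != l, l' != l.+1 & l' != l.+2] ->
  inner_ok b m ((u, l), (v, l')) = false.
Proof.
move=> far; rewrite /inner_ok /step_ok /=; have [le|//] := leqP l l'.
rewrite (_ : (l' - l == 1) = false); last by lia.
rewrite (_ : (l' - l == 0) = false); last by lia.
rewrite (_ : (l' - l == 2) = false); last by lia.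
by rewrite !andbF.
Qed.

Lemma inner_extend_ok (b : bool) m u l v l' : 4 < m ->
  ((0 < l) && (0 < l')) * inner_ok b m ((u, l.-1), (v, l'.-1)) +
    ((l == 0) && (l' == 1) + (l == m) && (l' == m.+1)) + ((l == m.-1) && (l' == m.+1)) * b +
    ((l == m.+1) && (l' == m.+1)) * b + ((l == 0) && (l' == 0)) * b + ((l == 0) && (l' == 2)) * b =
  inner_ok b m.+2 ((u, l), (v, l')).
Proof.
move=> m4; have [->|[->|[->|far]]] : l' = l \/ l' = l.+1 \/ l' = l.+2 \/
      [&& l' != l, l' != l.+1 & l' != l.+2] by lia.
- rewrite !inner_ok0; case: l => [|l] /=; first by case: b; lia.
  by case: b => /=; rewrite ?muln0 ?muln1; lia.
- rewrite inner_ok1; case: l => [|l] /=; first by case: b; lia.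
  by rewrite inner_ok1; case: b => /=; rewrite ?muln0 ?muln1; lia.
- rewrite inner_ok2; case: l => [|l] /=; first by case: b; lia.
  by rewrite inner_ok2; case: b => /=; rewrite ?muln0 ?muln1; lia.
rewrite (inner_ok_far _ _ _ _ far) (_ : _ && _ * inner_ok _ _ _ = 0); last first.
  by case: l l' far => [|l] [|l'] //= far; rewrite inner_ok_far.
by case: b => /=; rewrite ?muln0 ?muln1; lia.
Qed.

Lemma closing_extend_ok (b : bool) m u l v l' : 4 < m ->
  (l == m.+1) && (l' == 0) + ((l == m.+1) && (l' == 1)) * b + ((l == m) && (l' == 0)) * b =
  closing_ok b m.+2 ((u, l), (v, l')).
Proof. by move=> m4; rewrite /closing_ok /=; case: b => /=; rewrite ?muln0 ?muln1; lia. Qed.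

(** Some of the new arcs lead from y to x where the closing arc led from x to y; this is where the
    symmetry of [A] enters. *)
Lemma strip_extend b m k I V A : 4 < m -> (forall x y, A x y = A y x) ->
  strip b m k I V A -> strip b m.+2 k I V A.
Proof.
move=> m4 symA [L [sL FL iL cL]]; exists (fun z => map (map (extend m)) (L z)).
have cs z F c : z \in I -> F \in L z -> c \in F -> c != [::] /\ cut_ok b m c.
  move=> zI FLz cF; have [/allP/(_ _ cF)/andP[/eqP sc cc] _ _ _] := FL _ _ zI FLz.
  by rewrite -size_eq0 sc; split=> //; lia.
have E (G : seq pt -> nat) : \sum_(z <- I) \sum_(F <- map (map (extend m)) (L z)) \sum_(c <- F) G c =
    \sum_(z <- I) \sum_(F <- L z) \sum_(c <- F) G (extend m c).
  by apply: eq_bigr => z _; rewrite big_map; apply: eq_bigr => F _; rewrite big_map.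
have cong (G H : seq pt -> nat) : (forall c, c != [::] -> cut_ok b m c -> G c = H c) ->
    \sum_(z <- I) \sum_(F <- L z) \sum_(c <- F) G c = \sum_(z <- I) \sum_(F <- L z) \sum_(c <- F) H c.
  move=> GH; apply: eq_big_seq => z zI; apply: eq_big_seq => F FL'; apply: eq_big_seq => c cF.
  by have [] := cs _ _ _ zI FL' cF; apply: GH.
pose S (G : seq pt -> nat) := \sum_(z <- I) \sum_(F <- L z) \sum_(c <- F) G c.
have SD (G H : seq pt -> nat) : S (fun c => G c + H c) = S G + S H.
  by rewrite /S -big_split; apply: eq_bigr => z _; rewrite -big_split; apply: eq_bigr => F _; rewrite -big_split.
have SM k' (G : seq pt -> nat) : S (fun c => k' * G c) = k' * S G.
  rewrite /S big_distrr; apply: eq_bigr => z _; rewrite big_distrr; apply: eq_bigr => F _.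
  by rewrite big_distrr.
have ne : (m.-2 == m.-1) = false by lia.
split.
- by move=> z zI; rewrite size_map sL.
- by move=> z _ zI /mapP[F FLz ->]; apply: extend_fac => //; apply: FL.
- move=> [[u l] [v l']]; rewrite E.
  rewrite (cong _ (fun c => ((0 < l) && (0 < l')) * count_mem ((u, l.-1), (v, l'.-1)) (inner c) +
    ((l == 0) && (l' == 1) + (l == m) && (l' == m.+1)) * (closing c == ((u, m.-1), (v, 0))) +
    ((l == m.-1) && (l' == m.+1)) * (closing c == ((u, m.-2), (v, 0))) +
    ((l == m.+1) && (l' == m.+1)) * (closing c == ((v, m.-2), (u, 0))) +
    ((l == 0) && (l' == 0)) * (closing c == ((v, m.-1), (u, 1))) +
    ((l == 0) && (l' == 2)) * (closing c == ((u, m.-1), (v, 1))))).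
    rewrite -/(S _) !SD !SM [S (fun c => count_mem _ _)]iL ![S (fun c => _ == _ : nat)]cL /= ![A v u]symA.
    rewrite ![_ * (A u v * _)]mulnCA -!mulnDr; congr (A u v * _).
    rewrite -inner_extend_ok // /closing_ok /= !eqxx ne (_ : (m.-1 == m.-2) = false); last by lia.
    by rewrite /= ?andbF ?andbT ?orbF ?muln1.
  move=> c c0 /(extend_cases m4 c0) [x [y H]].
  have ne1 : (m.-1 == m.-2) = false by lia.
  case: H => -[e _ /permP -> _ _]; rewrite count_swap2 up_arcs_count e !xpair_eqE /=;
    (have -> : (if (0 < l) && (0 < l') then count_mem ((u, l.-1), (v, l'.-1)) (inner c) else 0) =
      ((0 < l) && (0 < l')) * count_mem ((u, l.-1), (v, l'.-1)) (inner c)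
      by case: ((0 < l) && (0 < l')); rewrite ?mul1n);
    move: (_ * count_mem _ _) => w; rewrite !eqxx ?ne ?ne1;
    case: (x == u); case: (y == v); case: (x == v); case: (y == u);
    rewrite /= ?(andbF, andbT) /= ?muln0 ?muln1 ?addn0 ?add0n ?[_ == l]eq_sym ?[_ == l']eq_sym; abstract_bools; lia.
move=> [[u l] [v l']]; rewrite E.
rewrite (cong _ (fun c => ((l == m.+1) && (l' == 0)) * (closing c == ((v, m.-1), (u, 0))) +
   ((l == m.+1) && (l' == 1)) * (closing c == ((u, m.-2), (v, 0))) +
   ((l == m) && (l' == 0)) * (closing c == ((u, m.-1), (v, 1))))).
  rewrite -/(S _) !SD !SM ![S (fun c => _ == _ : nat)]cL /= [A v u]symA.
  rewrite ![_ * (A u v * _)]mulnCA -!mulnDr; congr (A u v * _).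
  rewrite -closing_extend_ok // /closing_ok /= !eqxx ne (_ : (m.-1 == m.-2) = false); last by lia.
  by rewrite /= ?andbF ?andbT ?orbF ?muln1.
move=> c c0 /(extend_cases m4 c0) [x [y H]].
have ne1 : (m.-1 == m.-2) = false by lia.
case: H => -[e -> _ _ _]; rewrite e !xpair_eqE /= !eqxx ?ne ?ne1;
  case: (x == u); case: (y == v); case: (x == v); case: (y == u);
  rewrite /= ?(andbF, andbT) /= ?muln0 ?muln1 ?addn0 ?add0n ?[_ == l]eq_sym ?[_ == l']eq_sym; abstract_bools; lia.
Qed.

(** * The three exceptions, by exhaustive search *)

Section Search.
Variables (I T : eqType).

(** Backtracking over one choice per class, pairwise disjoint; [used] collects the arcs of the
    choices already made. *)
Fixpoint packing (cs : seq (seq (seq T))) (used : seq T) : bool :=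
  if cs is C :: cs' then has (fun a => ~~ has (mem used) a && packing cs' (a ++ used)) C else true.

Lemma packing_complete (C : I -> seq (seq T)) (a : I -> seq T) ys used : uniq ys ->
  (forall y, y \in ys -> a y \in C y) ->
  (forall y z, y \in ys -> z \in ys -> y != z -> ~~ has (mem (a y)) (a z)) ->
  (forall y, y \in ys -> ~~ has (mem used) (a y)) ->
  packing (map C ys) used.
Proof.
elim: ys used => //= y ys IH used /andP[yys uys] aC dis dused.
apply/hasP; exists (a y); first by apply: aC; rewrite mem_head.
rewrite dused ?mem_head //=; apply: IH => // [z zys|z w zys wys|z zys].
- by apply: aC; rewrite inE zys orbT.
- by apply: dis; rewrite inE ?zys ?wys orbT.
have zin : z \in y :: ys by rewrite inE zys orbT.
have yz : y != z by apply: contraNneq yys => ->.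
apply/hasPn => u uz; rewrite /= mem_cat negb_or.
by rewrite (hasPn (dis y z (mem_head _ _) zin yz)) // (hasPn (dused z zin)).
Qed.

End Search.

(** Rotating the cycle of the vertex 0 and moving it to the front changes no arc, so only the orders
    of the other vertices have to be enumerated. *)
Definition factors_at0 n m k : seq (seq (seq nat)) :=
  [seq reshape (nseq k m) (0 :: s) | s <- permutations (iota 1 n.-1)].

Definition arc_choices n m k y : seq (seq (nat * nat)) :=
  [seq farcs F | F <- factors_at0 n m k & (0, y) \in farcs F].

Lemma reshape_id (T : Type) m (F : seq (seq T)) :
  all (fun c => size c == m) F -> reshape (nseq (size F) m) (flatten F) = F.
Proof.
move=> aF; have -> : nseq (size F) m = shape F; last exact: flattenK.
by elim: F aF => //= c F IH /andP[/eqP -> /IH ->].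
Qed.

Lemma factor_normal n m k (F : seq (seq nat)) : n = k * m -> 0 < n -> 0 < m ->
  all (fun c => size c == m) F -> perm_eq (flatten F) (iota 0 n) ->
  exists2 F', F' \in factors_at0 n m k & farcs F =i farcs F'.
Proof.
move=> nE n0 m0 aF pF.
have /flattenP[c cF c0] : 0 \in flatten F by rewrite (perm_mem pF) mem_iota.
have [i s rE] := rot_to c0.
have pF2 : perm_eq F (c :: rem c F) by apply: perm_to_rem.
pose F' := (0 :: s) :: rem c F.
have aF' : all (fun c => size c == m) F'.
  move: aF; rewrite (perm_all _ pF2) /= => /andP[/eqP sc ->]; rewrite andbT.
  by rewrite -[_.+1]/(size (0 :: s)) -rE size_rot sc.
have pfl : perm_eq (flatten F') (iota 0 n).
  apply: perm_trans _ pF; rewrite perm_sym (permPl (perm_flatten pF2)) /= -cat_cons -rE perm_cat2r.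
  by rewrite perm_sym perm_rot.
have sF' : size F' = k.
  have := perm_size pfl; rewrite size_iota nE size_flatten /shape.
  have -> : sumn (map size F') = size F' * m.
    by elim: (F') aF' => //= d G IH /andP[/eqP -> /IH ->]; rewrite mulSn.
  by move=> /eqP; rewrite eqn_pmul2r // => /eqP.
exists F'.
  apply/mapP; exists (s ++ flatten (rem c F)).
    rewrite mem_permutations -(perm_cons 0); move: pfl; rewrite /= => /permPl ->.
    by rewrite -[n in iota 0 n](prednK n0).
  by rewrite -[LHS](reshape_id aF') sF'.
move=> a; have -> : (a \in farcs F) = (a \in farcs (c :: rem c F)).
  rewrite /farcs; apply/flattenP/flattenP => -[x /mapP[d dF ->] ad];
    exists (arcs d) => //; apply: map_f; move: dF; by rewrite (perm_mem pF2).
rewrite /F' !farcs_cons !mem_cat; congr (_ || _).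
by rewrite -rE (perm_mem (arcs_rot _ _)).
Qed.

Lemma count1_eq (T : eqType) (P : pred T) s x y :
  count P s = 1 -> x \in s -> P x -> y \in s -> P y -> x = y.
Proof.
move=> c1 xs Px ys Py; have : size (filter P s) = 1 by rewrite size_filter.
have xf : x \in filter P s by rewrite mem_filter Px.
have yf : y \in filter P s by rewrite mem_filter Py.
by case: (filter P s) xf yf => [|z [|//]] //; rewrite !inE => /eqP -> /eqP ->.
Qed.

Lemma uniq_fst (T U : eqType) (s : seq (T * U)) x y z :
  uniq (unzip1 s) -> (x, y) \in s -> (x, z) \in s -> y = z.
Proof.
have unz a b (t : seq (T * U)) : (a, b) \in t -> a \in unzip1 t by apply: (map_f fst).
elim: s => //= -[a b] s IH /andP[/negP nas us]; rewrite !inE !xpair_eqE.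
move=> /orP[/andP[/eqP xa /eqP ->]|xy] /orP[/andP[/eqP xa' /eqP ->]|xz] //.
- by case: nas; rewrite -xa; apply: unz xz.
- by case: nas; rewrite -xa'; apply: unz xy.
exact: IH.
Qed.

(** The factors containing the arcs (0, y), for y = 1, ..., n - 1, are distinct and hence
    arc-disjoint, so a factorization would give a successful [packing]. *)
Lemma no_factorization n m k : n = k * m -> 0 < n -> 0 < m ->
  ~~ packing (map (arc_choices n m k) (iota 1 n.-1)) [::] ->
  ~ exists L : seq (seq (seq 'I_n)), Cm_factorization m L.
Proof.
move=> nE n0 m0 /negP + [L [aL cL]]; apply.
pose natF (F : seq (seq 'I_n)) := map (map val) F.
have good F : F \in L -> [/\ all (fun c => size c == m) (natF F), perm_eq (flatten (natF F)) (iota 0 n)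
    & uniq (flatten F)].
  move=> /(allP aL) /andP[/andP[sF pF] _]; split.
  - by rewrite all_map; apply: sub_all sF => c /andP[/eqP sc _] /=; rewrite size_map sc.
  - by rewrite -map_flatten -(val_enum_ord n); apply: perm_map.
  by rewrite (perm_uniq pF) enum_uniq.
have arcE F x y : ((x, y) \in farcs F) = ((val x, val y) \in farcs (natF F)).
  rewrite /natF farcs_map; apply/idP/mapP => [xy|[[u v] uv /= [/val_inj -> /val_inj ->]] //].
  by exists (x, y).
have choice y : y \in iota 1 n.-1 -> exists F, (F \in L) && ((0, y) \in farcs (natF F)).
  rewrite mem_iota => yn; have yn' : y < n by lia.
  pose a := (Ordinal n0, Ordinal yn').
  have : Kstar_arc a by rewrite /Kstar_arc -val_eqE /=; lia.
  move=> /cL c1; have : has (fun F => a \in factor_arcs F) L by rewrite has_count c1.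
  by move=> /hasP[F FL]; rewrite factor_arcsE /a arcE /= => H; exists F; rewrite FL.
pose pickF y := nth [::] L (find (fun F => (0, y) \in farcs (natF F)) L).
have pickP y : y \in iota 1 n.-1 -> pickF y \in L /\ (0, y) \in farcs (natF (pickF y)).
  move=> /choice[F /andP[FL Fy]].
  have H : has (fun F => (0, y) \in farcs (natF F)) L by apply/hasP; exists F.
  by split; [apply: mem_nth; rewrite -has_find|apply: (nth_find [::] H)].
have normal y : y \in iota 1 n.-1 -> exists F', (F' \in factors_at0 n m k) && perm_eq (undup (farcs (natF (pickF y)))) (undup (farcs F')).
  move=> /pickP[pL _]; have [aF pF _] := good _ pL.
  have [F' F'in E] := factor_normal nE n0 m0 aF pF; exists F'; rewrite F'in.
  by apply: uniq_perm; rewrite ?undup_uniq // => b; rewrite !mem_undup E.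
(* Equality of arc sets is expressed by a boolean, so that [find] can select the normal form. *)
pose same y F' := perm_eq (undup (farcs (natF (pickF y)))) (undup (farcs F')).
pose normF y := nth [::] (factors_at0 n m k) (find (same y) (factors_at0 n m k)).
have normP y : y \in iota 1 n.-1 -> normF y \in factors_at0 n m k /\ farcs (normF y) =i farcs (natF (pickF y)).
  move=> /normal[F' /andP[F'in pe]].
  have H : has (same y) (factors_at0 n m k) by apply/hasP; exists F'.
  split; first by apply: mem_nth; rewrite -has_find.
  by move=> b; have := perm_mem (nth_find [::] H) b; rewrite !mem_undup.
apply: (packing_complete (a := fun y => farcs (normF y))) => //; first exact: iota_uniq.
  move=> y yn; have [nF nE'] := normP _ yn; have [_ p0] := pickP _ yn.
  by apply: map_f; rewrite mem_filter nF nE' p0.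
  move=> y z yn zn yz; have [_ Ey] := normP _ yn; have [_ Ez] := normP _ zn.
have [yL y0] := pickP _ yn; have [zL z0] := pickP _ zn.
apply/hasPn => b; rewrite /= Ez Ey => bz; apply/negP => bz'.
have [[u v] uv bE] : exists2 a, a \in farcs (pickF y) & b = (val a.1, val a.2).
  by move: bz'; rewrite /natF farcs_map => /mapP.
have Ka : Kstar_arc (u, v).
  have /andP[_ /allP K] := allP aL _ yL; move: uv => /flattenP[x /mapP[c cF ->] ac].
  by have /forallP/(_ (u, v)) := K _ cF; rewrite cycle_arcsE ac.
have e : pickF y = pickF z.
  apply: (count1_eq (cL _ Ka)) => //; rewrite factor_arcsE //.
  by move: bz; rewrite bE -arcE.
have [_ pF _] := good _ yL.
(* The vertex 0 has a single outgoing arc in a factor, so the factors of two different y cannot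
   coincide. *)
have U : uniq (unzip1 (farcs (natF (pickF y)))) by rewrite farcs_unzip1 (perm_uniq pF) iota_uniq.
rewrite -e in z0.
by rewrite (uniq_fst U y0 z0) eqxx in yz.
by move=> y _; apply/hasPn.
Qed.

Lemma no_1_4 : ~ exists L : seq (seq (seq 'I_(1 * 4))), Cm_factorization 4 L.
Proof. by apply: (@no_factorization _ _ 1) => //; vm_compute. Qed.

Lemma no_1_6 : ~ exists L : seq (seq (seq 'I_(1 * 6))), Cm_factorization 6 L.
Proof. by apply: (@no_factorization _ _ 1) => //; vm_compute. Qed.

Lemma no_2_3 : ~ exists L : seq (seq (seq 'I_(2 * 3))), Cm_factorization 3 L.
Proof. by apply: (@no_factorization _ _ 2) => //; vm_compute. Qed.

(** * Systems with prescribed column steps, and their scaling modulo a prime *)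

(** What remains of a strip once the winding is forgotten: for each hole [k] factors, which together
    use every arc with an admissible pair of labels and a pair of columns in [S] once. *)
Definition step_sys m k (I : seq nat) (V : nat -> pred nat) (A : nat -> nat -> nat)
    (S : nat -> nat -> bool) : Prop :=
  exists B : nat -> pt -> pt -> nat,
    (forall z, z \in I -> dec m k (bl (V z) m) (B z)) /\
    forall p q, \sum_(z <- I) B z p q = A p.1 q.1 * [&& p.2 < m, q.2 < m & S p.2 q.2].

Lemma step_sys_ext m k k' I V A S S' : k = k' ->
  (forall l l', l < m -> l' < m -> S l l' = S' l l') ->
  step_sys m k I V A S -> step_sys m k' I V A S'.
Proof.
move=> <- SS' [B [BD BE]]; exists B; split=> // p q; rewrite BE; congr (_ * nat_of_bool _).
by case pm: (_ < m); case qm: (_ < m) => //=; apply: SS'.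
Qed.

Lemma step_sys_sum m I V A (r : seq nat) k S : uniq r ->
  (forall c, c \in r -> step_sys m k I V A (fun l l' => S l l' == c)) ->
  step_sys m (size r * k) I V A (fun l l' => S l l' \in r).
Proof.
elim: r => [|c r IH] /=.
  move=> _ _; exists (fun _ _ _ => 0); split=> [z _|p q]; first exact: dec_nil.
  by rewrite big1 // !andbF muln0.
move=> /andP[cr ur] H; have [B [BD BE]] := H c (mem_head _ _).
have [B' [BD' BE']] : step_sys m (size r * k) I V A (fun l l' => S l l' \in r).
  by apply: IH => // d dr; apply: H; rewrite inE dr orbT.
exists (fun z p q => B z p q + B' z p q); split=> [z zI|p q]; first by rewrite mulSn; apply: dec_add; auto.
rewrite big_split /= BE BE' -mulnDr inE; congr (_ * _).
case: (_ < m) => //=; case: (_ < m) => //=.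
by case: eqP => [->|_]; rewrite ?(negPf cr).
Qed.

Lemma step_sys_add m k k' I V A (S S' : nat -> nat -> bool) : (forall l l', S l l' -> ~~ S' l l') ->
  step_sys m k I V A S -> step_sys m k' I V A S' ->
  step_sys m (k + k') I V A (fun l l' => S l l' || S' l l').
Proof.
move=> SS' [B [BD BE]] [B' [BD' BE']].
exists (fun z p q => B z p q + B' z p q); split=> [z zI|p q]; first by apply: dec_add; auto.
rewrite big_split /= BE BE' -mulnDr; congr (_ * _).
case: (_ < m) => //=; case: (_ < m) => //=.
by case s: (S _ _) => //=; rewrite (negPf (SS' _ _ s)).
Qed.

Definition diffm m l l' := (l' + (m - l)) %% m.

Lemma diffmP m l l' c : l < m -> l' < m -> c < m -> (diffm m l l' == c) = (l' == l + c %[mod m]).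
Proof.
move=> lm lm' cm; rewrite /diffm -{1}(modn_small cm).
by rewrite -(eqn_modDr l) -addnA subnK 1?ltnW // modnDr addnC.
Qed.

(** The closing arcs are exactly those whose column step passes from m - 1 to 0, so together with
    the inner arcs they give all pairs of columns at the wanted step modulo m. *)
Lemma strip_dec b m k I V A : 4 < m -> (forall x y, A x y = A y x) -> strip b m k I V A ->
  step_sys m k I V A (fun l l' => step_ok b (diffm m l l')).
Proof.
move=> m4 symA [L [sL FL iL cL]]; exists (fun z p q => count_mem (p, q) (larcs (L z))); split.
  move=> z zI; exists (L z); split=> //; first exact: sL.
  move=> F FLz; have [aF cF _ _] := FL _ _ zI FLz; split=> //.
  by apply: sub_all aF => c /andP[].
move=> [u l] [v l'].
have -> : \sum_(z <- I) count_mem ((u, l), (v, l')) (larcs (L z)) =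
    A u v * inner_ok b m ((u, l), (v, l')) + A u v * closing_ok b m ((u, l), (v, l')).
  rewrite -(iL ((u, l), (v, l'))) -(cL ((u, l), (v, l'))) -big_split; apply: eq_big_seq => z zI.
  rewrite larcs_count -big_split; apply: eq_big_seq => F FLz; rewrite -big_split.
  apply: eq_big_seq => c cF; apply: count_arcs_inner.
  by have [/allP/(_ _ cF)/andP[/eqP sc _] _ _ _] := FL _ _ zI FLz; rewrite -size_eq0 sc; lia.
rewrite -mulnDr; congr (_ * _); rewrite /=.
have [lm|lm] := ltnP l m; last first.
  rewrite /inner_ok /closing_ok /=; case: b {FL iL cL} => /=; lia.
have [lm'|lm'] := ltnP l' m; last first.
  rewrite /inner_ok /closing_ok /= [l' < m]ltnNge lm' andbF /=; case: b {FL iL cL} => /=; lia.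
rewrite /step_ok /= !diffmP //; try lia.
have red c : c < 3 -> (l' == l + c %[mod m]) = (l' == l + c) || (l' + m == l + c).
  move=> c3; rewrite (modn_small lm'); have [lt|ge] := ltnP (l + c) m.
    by rewrite modn_small // orbC; case: eqP => //; lia.
  rewrite -[l + c](subnK ge) modnDr modn_small; last by lia.
  by apply/eqP/orP => [->|[/eqP|/eqP]]; [right|lia|lia].
rewrite !red //; clear red iL cL FL sL symA; rewrite /closing_ok /=.
have [e|[e|[e|far]]] : l' = l \/ l' = l.+1 \/ l' = l.+2 \/ [&& l' != l, l' != l.+1 & l' != l.+2] by lia.
- by subst l'; rewrite inner_ok0; case: b => /=; lia.
- by subst l'; rewrite inner_ok1; case: b => /=; lia.
- by subst l'; rewrite inner_ok2; case: b => /=; lia.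
by rewrite inner_ok_far //; case: b => /=; lia.
Qed.

(** Multiplication of the columns by c is a bijection modulo p and takes the step 1 to the step
    c. *)
Lemma step_sys_scale p c k I V A : prime p -> 0 < c < p ->
  step_sys p k I V A (fun l l' => diffm p l l' == 1) ->
  step_sys p k I V A (fun l l' => diffm p l l' == c).
Proof.
move=> pp /andP[c0 cp] [B [BD BE]]; have p0 := prime_gt0 pp; have p1 := prime_gt1 pp.
pose f l := (l * c) %% p.
have cancel1 x y : y <= x -> x * c == y * c %[mod p] -> x == y %[mod p].
  move=> le; rewrite !eqn_mod_dvd ?leq_mul2r ?le ?orbT // -mulnBl Gauss_dvdl //.
  by rewrite prime_coprime // gtnNdvd.
have cancel x y : x * c == y * c %[mod p] -> x == y %[mod p].
  have [/cancel1//|/ltnW le] := leqP y x; rewrite eq_sym => e; rewrite eq_sym.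
  exact: cancel1.
have fI x y : x < p -> y < p -> f x = f y -> x = y.
  by move=> xp yp /eqP/cancel; rewrite !modn_small // => /eqP.
have fS y : y < p -> exists x, (x < p) && (f x == y).
  move=> yp; have := @uniq_sum p f y (fun r _ => ltn_pmod _ p0) _; rewrite yp.
  rewrite -(count_big (fun r => f r == y)) => H; have : has (fun r => f r == y) (iota 0 p).
    by rewrite has_count H // => r r'; rewrite !inE; apply: fI.
  by move=> /hasP[x]; rewrite mem_iota /= => xp fx; exists x; rewrite fx andbT.
pose g y := find (fun x => f x == y) (iota 0 p).
have gP y : y < p -> g y < p /\ f (g y) = y.
  move=> yp; have [x /andP[xp fx]] := fS y yp.
  have H : has (fun x => f x == y) (iota 0 p) by apply/hasP; exists x; rewrite ?mem_iota.
  have lt : g y < p by rewrite -[p](size_iota 0) -has_find.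
  by split=> //; have /eqP := nth_find 0 H; rewrite nth_iota.
have gf x : x < p -> g (f x) = x.
  by move=> xp; have [lt e] := gP (f x) (ltn_pmod _ p0); apply: fI.
pose B' z (q q' : pt) := if (q.2 < p) && (q'.2 < p) then B z (q.1, g q.2) (q'.1, g q'.2) else 0.
exists B'; split.
  move=> z zI; apply: (dec_map (f := fun q : pt => (q.1, f q.2)) _ _ _ _ _ (BD _ zI)).
  - move=> [x l] [y l']; rewrite !unfold_in /bl /= => /andP[_ lp] /andP[_ lp'] [-> e].
    by rewrite (fI _ _ lp lp' e).
  - by move=> [x l]; rewrite /bl /= => /andP[-> _]; rewrite ltn_pmod.
  - move=> [y l]; rewrite /bl /= => /andP[Vy /gP[lt e]]; exists (y, g l); rewrite /= ?e //.
    by rewrite Vy lt.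
  - move=> [x l] [y l']; rewrite /bl /B' /= => /andP[_ lp] /andP[_ lp'].
    by rewrite !ltn_pmod //= !gf.
  - move=> [x l] [y l']; rewrite /B' /=; case: ifP => // /andP[lp lp'] nz.
    have := dec_supp (BD _ zI) nz; rewrite /bl /= lp lp' !andbT.
    by move=> /andP[/andP[-> _] /andP[-> _]].
move=> [x l] [y l']; rewrite /B' /=; case lpp: ((l < p) && (l' < p)); last first.
  by rewrite big1 // andbA lpp muln0.
have /andP[lp lp'] := lpp.
rewrite BE /= lp lp' /=; have [lg lE] := gP _ lp; have [lg' lE'] := gP _ lp'.
rewrite lg lg' /=; congr (_ * nat_of_bool _); rewrite !diffmP //.
have -> : (l' == l + c %[mod p]) = ((g l' * c) == (g l + 1) * c %[mod p]).
  by rewrite -{1}lE' -{1}lE /f modn_mod modnDml mulnDl mul1n.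
by apply/idP/idP => [/eqP e|]; [rewrite -modnMml e modnMml|apply: cancel].
Qed.

Lemma strip_iter b k I V A j : (forall x y, A x y = A y x) -> strip b 5 k I V A ->
  strip b (5 + j.*2) k I V A.
Proof.
move=> symA S5; elim: j => [|j IH]; first exact: S5.
by rewrite doubleS !addnS; apply: strip_extend => //; lia.
Qed.

(** The steps 0, 1, 2 cost 3k factors together, and each of the other p - 3 steps costs k. *)
Theorem strip_prime p k I V A : prime p -> 4 < p -> (forall x y, A x y = A y x) ->
  strip true 5 (3 * k) I V A -> strip false 5 k I V A ->
  step_sys p (k * p) I V A (fun _ _ => true).
Proof.
move=> pp p4 symA St Sf; have op : odd p by case: (even_prime pp) => // e; move: p4; rewrite e.
have pE : p = 5 + ((p - 5)./2).*2 by lia.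
have {St} St : step_sys p (3 * k) I V A (fun l l' => step_ok true (diffm p l l')).
  by apply: strip_dec => //; rewrite pE; apply: strip_iter.
have {Sf} Sf : step_sys p k I V A (fun l l' => diffm p l l' == 1).
  have := @strip_dec false p k I V A p4 symA; rewrite {1}pE => /(_ (strip_iter _ symA Sf)).
  by apply: step_sys_ext => // l l' _ _; rewrite /step_ok andFb orbF.
have R : step_sys p (size (iota 3 (p - 3)) * k) I V A (fun l l' => diffm p l l' \in iota 3 (p - 3)).
  apply: step_sys_sum; first exact: iota_uniq.
  by move=> c; rewrite mem_iota => cp; apply: step_sys_scale => //; lia.
have dis l l' : step_ok true (diffm p l l') -> diffm p l l' \notin iota 3 (p - 3).
  by rewrite mem_iota /step_ok; lia.
apply: step_sys_ext (step_sys_add dis St R).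
  by rewrite size_iota -mulnDl subnKC 1?mulnC //; lia.
move=> l l' lp lp'; have : diffm p l l' < p by rewrite ltn_pmod ?prime_gt0.
by rewrite mem_iota /step_ok /=; lia.
Qed.

(* [perm_eq], tested separately for each tail. *)
Definition perm_by (T U : eqType) (r : seq T) (s t : seq (T * U)) : bool :=
  all (fun q => perm_eq [seq a <- s | a.1 == q] [seq a <- t | a.1 == q]) r &&
  all (fun a => a.1 \in r) (s ++ t).

Lemma perm_byP (T U : eqType) (r : seq T) (s t : seq (T * U)) : perm_by r s t -> perm_eq s t.
Proof.
move=> /andP[/allP H /allP K]; apply/allP => a /K /H /permP/(_ (pred1 a)) /=.
rewrite !count_filter => e; apply/eqP; move: e; congr (_ = _); apply: eq_count => b /=.
  by case: eqP => //= ->; rewrite eqxx.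
by case: eqP => //= ->; rewrite eqxx.
Qed.

(** * Tables on five columns *)

Definition strip_ok b n k I (V : nat -> pred nat) (A : rel nat) (L : nat -> seq (seq (seq pt))) : bool :=
  let D z := [seq x <- iota 0 n | V z x] in
  let grid := [seq (x, l) | x <- iota 0 n, l <- iota 0 5] in
  let arcs_where P := [seq a <- [seq (p, q) | p <- grid, q <- grid] | A a.1.1 a.2.1 && P a] in
  [&& all (fun z => (size (L z) == k) && all (fun F =>
        [&& all (fun c => (size c == 5) && cut_ok b 5 c) F,
            perm_eq (flatten F) [seq (x, l) | x <- D z, l <- iota 0 5],
            perm_eq (flatten (map (cover_last 5) F)) (D z)
          & perm_eq (flatten (map (cover_first 5) F)) (D z)]) (L z)) I,
      perm_by grid (flatten [seq inner c | c <- flatten (flatten [seq L z | z <- I])]) (arcs_where (inner_ok b 5))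
    & perm_by grid [seq closing c | c <- flatten (flatten [seq L z | z <- I])] (arcs_where (closing_ok b 5))].

Lemma strip_table b n k I V A L : strip_ok b n k I V A L ->
  (forall z x, V z x -> x < n) -> (forall x y, A x y -> (x < n) && (y < n)) ->
  strip b 5 k I V (fun x y => A x y).
Proof.
move=> /and3P[/allP H /perm_byP inn /perm_byP clo] Vn An; exists L.
have grid (q : pt) : q.1 < n -> q.2 < 5 -> q \in [seq (x, l) | x <- iota 0 n, l <- iota 0 5].
  by case: q => x l xn l5; apply/allpairsP; exists (x, l); rewrite !mem_iota.
have D z v : count_mem v [seq x <- iota 0 n | V z x] = V z v.
  rewrite count_uniq_mem ?filter_uniq ?iota_uniq // mem_filter mem_iota /=.
  by case vz: (V z v) => //=; rewrite (Vn _ _ vz).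
have W (P : pred (pt * pt)) a : (forall a, P a -> (a.1.2 < 5) && (a.2.2 < 5)) ->
    count_mem a [seq a <- [seq (p, q) | p <- [seq (x, l) | x <- iota 0 n, l <- iota 0 5],
     q <- [seq (x, l) | x <- iota 0 n, l <- iota 0 5]] | A a.1.1 a.2.1 && P a] = A a.1.1 a.2.1 * P a.
  move=> P5; have ug : uniq [seq (x, l) | x <- iota 0 n, l <- iota 0 5].
    by apply: allpairs_uniq; rewrite ?iota_uniq // => -[? ?] [? ?] _ _ [-> ->].
  rewrite count_uniq_mem; last first.
    by apply: filter_uniq; apply: allpairs_uniq => // -[? ?] [? ?] _ _ [-> ->].
  rewrite mem_filter mulnb; congr nat_of_bool; case Aa: (A _ _ && P _) => //=.
  move: Aa => /andP[/An /andP[xn yn] /P5 /andP[l5 l5']].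
  apply/allpairsP; exists a; split; last by case: a {xn yn l5 l5'}.
    exact: (grid a.1).
  exact: (grid a.2).
have S3 (G : seq pt -> nat) : \sum_(z <- I) \sum_(F <- L z) \sum_(c <- F) G c =
    \sum_(c <- flatten (flatten [seq L z | z <- I])) G c.
  by rewrite !big_flatten big_map; apply: eq_bigr => z _.
split.
- by move=> z /H /andP[/eqP].
- move=> z F /H /andP[_ /allP K] /K /and4P[aF /permP cF /permP c1 /permP c2]; split=> // [[v l]|v|v].
  + rewrite cF count_uniq_mem; last first.
      by apply: allpairs_uniq; rewrite ?filter_uniq ?iota_uniq // => -[? ?] [? ?] _ _ [-> ->].
    rewrite /bl; congr nat_of_bool; apply/allpairsP/andP => [[[x i] /=]|[Vv l5]].
      by rewrite mem_filter => -[/andP[Vx _] i5 [-> ->]]; rewrite Vx; split=> //; move: i5; rewrite !inE; lia.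
    exists (v, l); split; [|by rewrite mem_iota; apply: l5|by []].
    by rewrite mem_filter [V z _]Vv mem_iota; apply: Vn Vv.
  + by rewrite c1 D.
  by rewrite c2 D.
- move=> a; rewrite S3 -count_flatten_map (permP inn) W // => b' /and3P[/= le lt _].
  by rewrite (leq_ltn_trans le lt) lt.
move=> a; rewrite S3 -(W (closing_ok b 5)) -?(permP clo) ?count_map ?count_big //.
by move=> -[[x i] [y j]]; rewrite /closing_ok /=; case: b {H inn clo} => /=; lia.
Qed.

Definition relabel (g : seq nat) (F : seq (seq pt)) : seq (seq pt) :=
  map (map (fun p => (nth 0 g p.1, p.2))) F.

Definition all_steps (l l' : nat) := true.

Definition Krel n (x y : nat) := [&& x < n, y < n & x != y].

(** The factors of a frame are listed without order and assigned to their holes by the label they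
    miss. *)
Definition avoids (F : seq (seq pt)) z := ~~ has (fun p => p.1 == z) (flatten F).

(* The arcs between different labels, and the frame with singleton groups. *)
Definition msys_E m n := step_sys m (n.-1 * m) [:: 0] (fun _ x => x < n) (fun x y => Krel n x y) all_steps.

Definition msys_F m n :=
  step_sys m m (iota 0 n) (fun z x => (x < n) && (x != z)) (fun x y => Krel n x y) all_steps.

Lemma KrelC n x y : Krel n x y = Krel n y x.
Proof. by rewrite /Krel eq_sym andbCA. Qed.

Lemma E_table p n Lt Lf :
  strip_ok true n (3 * n.-1) [:: 0] (fun _ x => x < n) (Krel n) (fun _ => Lt) ->
  strip_ok false n n.-1 [:: 0] (fun _ x => x < n) (Krel n) (fun _ => Lf) ->
  prime p -> 4 < p -> msys_E p n.
Proof.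
move=> Ht Hf pp p4; apply: strip_prime => //; first by move=> x y; rewrite KrelC.
- by apply: (strip_table Ht) => // x y /and3P[-> ->].
by apply: (strip_table Hf) => // x y /and3P[-> ->].
Qed.

Lemma F_table p n Lt Lf :
  strip_ok true n 3 (iota 0 n) (fun z x => (x < n) && (x != z)) (Krel n) (fun z => [seq F <- Lt | avoids F z]) ->
  strip_ok false n 1 (iota 0 n) (fun z x => (x < n) && (x != z)) (Krel n) (fun z => [seq F <- Lf | avoids F z]) ->
  prime p -> 4 < p -> msys_F p n.
Proof.
move=> Ht Hf pp p4; rewrite /msys_F -{2}[p]mul1n; apply: strip_prime => //; first by move=> x y; rewrite KrelC.
- by apply: (strip_table Ht) => [z x /andP[]|x y /and3P[-> ->]].
by apply: (strip_table Hf) => [z x /andP[]|x y /and3P[-> ->]].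
Qed.

Definition strip_k3 : seq (seq (seq pt)) :=
  [:: [:: [:: (2, 0); (0, 0); (1, 1); (2, 2); (1, 4)]; [:: (1, 0); (0, 2); (1, 3); (2, 3); (0, 3)]; [:: (2, 1); (0, 1); (1, 2); (2, 4); (0, 4)]];
      [:: [:: (0, 0); (2, 2); (0, 2); (1, 2); (2, 3)]; [:: (1, 0); (2, 0); (1, 1); (0, 3); (2, 4)]; [:: (0, 1); (2, 1); (1, 3); (0, 4); (1, 4)]];
      [:: [:: (0, 0); (1, 0); (2, 1); (0, 2); (1, 4)]; [:: (0, 1); (1, 1); (2, 3); (0, 4); (2, 4)]; [:: (2, 0); (1, 2); (2, 2); (0, 3); (1, 3)]];
      [:: [:: (2, 1); (1, 1); (0, 2); (2, 4); (1, 4)]; [:: (2, 0); (1, 0); (0, 1); (2, 2); (0, 4)]; [:: (0, 0); (1, 2); (0, 3); (2, 3); (1, 3)]];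
      [:: [:: (0, 0); (2, 0); (0, 1); (1, 3); (2, 4)]; [:: (1, 1); (2, 1); (0, 3); (1, 4); (0, 4)]; [:: (1, 0); (2, 2); (1, 2); (0, 2); (2, 3)]];
      [:: [:: (2, 0); (0, 2); (2, 2); (1, 3); (0, 3)]; [:: (1, 0); (0, 0); (2, 1); (1, 2); (0, 4)]; [:: (1, 1); (0, 1); (2, 3); (1, 4); (2, 4)]]].

(** With step 1 only, a cycle meets the columns once each in order, so its row of labels determines
    it. *)
Definition rows_k3 : seq (seq (seq pt)) := map (map (zip^~ (iota 0 5)))
  [:: [:: [:: 0; 1; 2; 0; 1]; [:: 1; 2; 0; 1; 2]; [:: 2; 0; 1; 2; 0]];
      [:: [:: 0; 2; 1; 0; 2]; [:: 1; 0; 2; 1; 0]; [:: 2; 1; 0; 2; 1]]].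

Lemma E3_prime p : prime p -> 4 < p -> msys_E p 3.
Proof. by apply: (E_table (n := 3) (Lt := strip_k3) (Lf := rows_k3)); vm_compute. Qed.

(** Three base factors developed by the rotation of the labels 1, 2, 3: nine factors, three for each
    of the n - 1. *)
Definition strip_k4 : seq (seq (seq pt)) :=
  flatten [seq [seq relabel g F | g <- [:: [:: 0; 1; 2; 3]; [:: 0; 2; 3; 1]; [:: 0; 3; 1; 2]]] | F <-
   [:: [:: [:: (1, 0); (2, 2); (3, 3); (1, 3); (3, 4)]; [:: (1, 1); (0, 1); (3, 2); (1, 4); (2, 4)]; [:: (3, 0); (2, 1); (0, 2); (2, 3); (0, 3)]; [:: (2, 0); (0, 0); (3, 1); (1, 2); (0, 4)]];
      [:: [:: (0, 0); (3, 0); (1, 1); (2, 1); (1, 3)]; [:: (2, 0); (1, 0); (0, 2); (1, 2); (3, 3)]; [:: (0, 1); (2, 3); (3, 4); (0, 4); (1, 4)]; [:: (3, 1); (2, 2); (3, 2); (0, 3); (2, 4)]];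
      [:: [:: (3, 0); (0, 1); (2, 1); (3, 3); (2, 3)]; [:: (1, 1); (3, 1); (0, 3); (1, 3); (0, 4)]; [:: (1, 0); (2, 0); (1, 2); (3, 2); (2, 4)]; [:: (0, 0); (2, 2); (0, 2); (1, 4); (3, 4)]]]].

Definition rows_k4 : seq (seq (seq pt)) := map (map (zip^~ (iota 0 5)))
  [:: [:: [:: 0; 1; 0; 1; 3]; [:: 1; 0; 1; 0; 2]; [:: 2; 3; 2; 3; 1]; [:: 3; 2; 3; 2; 0]];
      [:: [:: 0; 2; 0; 2; 1]; [:: 1; 3; 1; 3; 0]; [:: 2; 0; 2; 0; 3]; [:: 3; 1; 3; 1; 2]];
      [:: [:: 0; 3; 0; 3; 2]; [:: 1; 2; 1; 2; 3]; [:: 2; 1; 2; 1; 0]; [:: 3; 0; 3; 0; 1]]].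

Lemma E4_prime p : prime p -> 4 < p -> msys_E p 4.
Proof. by apply: (E_table (n := 4) (Lt := strip_k4) (Lf := rows_k4)); vm_compute. Qed.

Definition strip_k5 : seq (seq (seq pt)) :=
  flatten [seq [seq relabel g F | g <- [:: [:: 0; 1; 2; 3; 4]; [:: 1; 2; 3; 0; 4]; [:: 2; 3; 0; 1; 4]; [:: 3; 0; 1; 2; 4]]] | F <-
   [:: [:: [:: (0, 0); (2, 1); (1, 2); (0, 2); (1, 4)]; [:: (2, 0); (1, 0); (2, 2); (3, 2); (4, 4)]; [:: (3, 0); (4, 2); (0, 3); (2, 3); (1, 3)]; [:: (4, 0); (1, 1); (3, 1); (4, 3); (2, 4)]; [:: (0, 1); (4, 1); (3, 3); (0, 4); (3, 4)]];
      [:: [:: (0, 0); (3, 2); (1, 2); (4, 3); (1, 3)]; [:: (4, 0); (3, 0); (1, 0); (0, 1); (3, 3)]; [:: (2, 0); (3, 1); (0, 2); (2, 3); (1, 4)]; [:: (2, 1); (0, 3); (4, 4); (2, 4); (3, 4)]; [:: (4, 1); (1, 1); (4, 2); (2, 2); (0, 4)]];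
      [:: [:: (2, 1); (1, 1); (3, 2); (2, 4); (0, 4)]; [:: (3, 0); (0, 0); (2, 2); (4, 2); (1, 4)]; [:: (1, 0); (4, 0); (0, 2); (3, 3); (0, 3)]; [:: (2, 0); (4, 1); (1, 2); (2, 3); (4, 3)]; [:: (3, 1); (0, 1); (1, 3); (3, 4); (4, 4)]]]].

Definition rows_k5 : seq (seq (seq pt)) := map (map (zip^~ (iota 0 5)))
  [:: [:: [:: 0; 1; 2; 3; 4]; [:: 1; 2; 3; 4; 0]; [:: 2; 3; 4; 0; 1]; [:: 3; 4; 0; 1; 2]; [:: 4; 0; 1; 2; 3]];
      [:: [:: 0; 2; 4; 1; 3]; [:: 1; 3; 0; 2; 4]; [:: 2; 4; 1; 3; 0]; [:: 3; 0; 2; 4; 1]; [:: 4; 1; 3; 0; 2]];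
      [:: [:: 0; 3; 1; 4; 2]; [:: 1; 4; 2; 0; 3]; [:: 2; 0; 3; 1; 4]; [:: 3; 1; 4; 2; 0]; [:: 4; 2; 0; 3; 1]];
      [:: [:: 0; 4; 3; 2; 1]; [:: 1; 0; 4; 3; 2]; [:: 2; 1; 0; 4; 3]; [:: 3; 2; 1; 0; 4]; [:: 4; 3; 2; 1; 0]]].

Lemma E5_prime p : prime p -> 4 < p -> msys_E p 5.
Proof. by apply: (E_table (n := 5) (Lt := strip_k5) (Lf := rows_k5)); vm_compute. Qed.

Definition strip_k6 : seq (seq (seq pt)) :=
  flatten [seq [seq relabel g F | g <- [:: [:: 0; 1; 2; 3; 4; 5]; [:: 1; 2; 3; 4; 0; 5]; [:: 2; 3; 4; 0; 1; 5]; [:: 3; 4; 0; 1; 2; 5]; [:: 4; 0; 1; 2; 3; 5]]] | F <-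
   [:: [:: [:: (3, 0); (4, 1); (5, 3); (3, 4); (1, 4)]; [:: (3, 1); (1, 2); (4, 2); (5, 4); (0, 4)]; [:: (5, 1); (3, 2); (2, 2); (4, 3); (2, 4)]; [:: (2, 0); (0, 1); (5, 2); (2, 3); (4, 4)]; [:: (5, 0); (0, 0); (2, 1); (1, 1); (0, 3)]; [:: (4, 0); (1, 0); (0, 2); (3, 3); (1, 3)]];
      [:: [:: (5, 0); (1, 1); (4, 1); (1, 2); (3, 4)]; [:: (0, 1); (2, 3); (1, 3); (2, 4); (4, 4)]; [:: (2, 1); (3, 1); (5, 1); (0, 3); (5, 4)]; [:: (0, 0); (3, 2); (4, 2); (0, 4); (1, 4)]; [:: (2, 0); (5, 2); (2, 2); (5, 3); (3, 3)]; [:: (1, 0); (4, 0); (3, 0); (0, 2); (4, 3)]];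
      [:: [:: (2, 1); (3, 3); (0, 3); (1, 3); (0, 4)]; [:: (3, 1); (2, 2); (4, 2); (5, 2); (4, 4)]; [:: (1, 0); (0, 1); (1, 2); (2, 3); (5, 3)]; [:: (0, 0); (5, 1); (4, 1); (1, 1); (4, 3)]; [:: (3, 0); (4, 0); (0, 2); (3, 4); (5, 4)]; [:: (2, 0); (5, 0); (3, 2); (2, 4); (1, 4)]]]].

Definition rows_k6 : seq (seq (seq pt)) := map (map (zip^~ (iota 0 5)))
  [:: [:: [:: 2; 1; 5; 3; 4]; [:: 4; 2; 0; 1; 0]; [:: 1; 3; 4; 2; 5]; [:: 5; 0; 2; 4; 1]; [:: 0; 5; 1; 0; 3]; [:: 3; 4; 3; 5; 2]];
      [:: [:: 3; 2; 5; 4; 0]; [:: 0; 3; 1; 2; 1]; [:: 2; 4; 0; 3; 5]; [:: 5; 1; 3; 0; 2]; [:: 1; 5; 2; 1; 4]; [:: 4; 0; 4; 5; 3]];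
      [:: [:: 4; 3; 5; 0; 1]; [:: 1; 4; 2; 3; 2]; [:: 3; 0; 1; 4; 5]; [:: 5; 2; 4; 1; 3]; [:: 2; 5; 3; 2; 0]; [:: 0; 1; 0; 5; 4]];
      [:: [:: 0; 4; 5; 1; 2]; [:: 2; 0; 3; 4; 3]; [:: 4; 1; 2; 0; 5]; [:: 5; 3; 0; 2; 4]; [:: 3; 5; 4; 3; 1]; [:: 1; 2; 1; 5; 0]];
      [:: [:: 1; 0; 5; 2; 3]; [:: 3; 1; 4; 0; 4]; [:: 0; 2; 3; 1; 5]; [:: 5; 4; 1; 3; 0]; [:: 4; 5; 0; 4; 2]; [:: 2; 3; 2; 5; 1]]].

Lemma E6_prime p : prime p -> 4 < p -> msys_E p 6.
Proof. by apply: (E_table (n := 6) (Lt := strip_k6) (Lf := rows_k6)); vm_compute. Qed.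

(** The labels are Z_7, and the base factors are developed by the six multiplications. The narrow
    table consists of the lines x + dj in the column j. *)
Definition strip_k7 : seq (seq (seq pt)) :=
  flatten [seq [seq relabel g F | g <- [:: [:: 0; 1; 2; 3; 4; 5; 6]; [:: 0; 3; 6; 2; 5; 1; 4]; [:: 0; 2; 4; 6; 1; 3; 5]; [:: 0; 6; 5; 4; 3; 2; 1]; [:: 0; 4; 1; 5; 2; 6; 3]; [:: 0; 5; 3; 1; 6; 4; 2]]] | F <-
   [:: [:: [:: (6, 0); (0, 2); (2, 3); (3, 4); (5, 4)]; [:: (3, 1); (0, 1); (3, 2); (4, 2); (2, 4)]; [:: (4, 1); (1, 2); (2, 2); (0, 3); (1, 4)]; [:: (2, 0); (1, 0); (5, 2); (4, 4); (6, 4)]; [:: (0, 0); (3, 0); (5, 1); (6, 2); (1, 3)]; [:: (5, 0); (1, 1); (5, 3); (6, 3); (0, 4)]; [:: (4, 0); (6, 1); (2, 1); (4, 3); (3, 3)]];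
      [:: [:: (0, 1); (5, 3); (3, 3); (2, 4); (6, 4)]; [:: (2, 1); (1, 1); (6, 2); (4, 2); (5, 4)]; [:: (3, 0); (2, 0); (4, 1); (3, 1); (2, 3)]; [:: (6, 0); (5, 2); (4, 3); (6, 3); (3, 4)]; [:: (4, 0); (1, 0); (6, 1); (0, 3); (1, 3)]; [:: (5, 0); (2, 2); (3, 2); (0, 2); (4, 4)]; [:: (0, 0); (5, 1); (1, 2); (0, 4); (1, 4)]];
      [:: [:: (3, 1); (6, 1); (3, 3); (2, 3); (5, 4)]; [:: (1, 1); (5, 2); (3, 4); (4, 4); (0, 4)]; [:: (4, 1); (5, 1); (0, 2); (1, 2); (6, 4)]; [:: (5, 0); (6, 2); (4, 3); (1, 4); (2, 4)]; [:: (3, 0); (0, 1); (2, 1); (5, 3); (0, 3)]; [:: (2, 0); (0, 0); (4, 2); (2, 2); (1, 3)]; [:: (4, 0); (6, 0); (1, 0); (3, 2); (6, 3)]]]].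

Definition rows_k7 : seq (seq (seq pt)) := map (map (zip^~ (iota 0 5)))
  [:: [:: [:: 0; 1; 2; 3; 4]; [:: 1; 2; 3; 4; 5]; [:: 2; 3; 4; 5; 6]; [:: 3; 4; 5; 6; 0]; [:: 4; 5; 6; 0; 1]; [:: 5; 6; 0; 1; 2]; [:: 6; 0; 1; 2; 3]];
      [:: [:: 0; 2; 4; 6; 1]; [:: 1; 3; 5; 0; 2]; [:: 2; 4; 6; 1; 3]; [:: 3; 5; 0; 2; 4]; [:: 4; 6; 1; 3; 5]; [:: 5; 0; 2; 4; 6]; [:: 6; 1; 3; 5; 0]];
      [:: [:: 0; 3; 6; 2; 5]; [:: 1; 4; 0; 3; 6]; [:: 2; 5; 1; 4; 0]; [:: 3; 6; 2; 5; 1]; [:: 4; 0; 3; 6; 2]; [:: 5; 1; 4; 0; 3]; [:: 6; 2; 5; 1; 4]];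
      [:: [:: 0; 4; 1; 5; 2]; [:: 1; 5; 2; 6; 3]; [:: 2; 6; 3; 0; 4]; [:: 3; 0; 4; 1; 5]; [:: 4; 1; 5; 2; 6]; [:: 5; 2; 6; 3; 0]; [:: 6; 3; 0; 4; 1]];
      [:: [:: 0; 5; 3; 1; 6]; [:: 1; 6; 4; 2; 0]; [:: 2; 0; 5; 3; 1]; [:: 3; 1; 6; 4; 2]; [:: 4; 2; 0; 5; 3]; [:: 5; 3; 1; 6; 4]; [:: 6; 4; 2; 0; 5]];
      [:: [:: 0; 6; 5; 4; 3]; [:: 1; 0; 6; 5; 4]; [:: 2; 1; 0; 6; 5]; [:: 3; 2; 1; 0; 6]; [:: 4; 3; 2; 1; 0]; [:: 5; 4; 3; 2; 1]; [:: 6; 5; 4; 3; 2]]].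

Lemma E7_prime p : prime p -> 4 < p -> msys_E p 7.
Proof. by apply: (E_table (n := 7) (Lt := strip_k7) (Lf := rows_k7)); vm_compute. Qed.

Definition strip_k8 : seq (seq (seq pt)) :=
  flatten [seq [seq relabel g F | g <- [:: [:: 0; 1; 2; 3; 4; 5; 6; 7]; [:: 1; 2; 3; 4; 5; 6; 0; 7]; [:: 2; 3; 4; 5; 6; 0; 1; 7]; [:: 3; 4; 5; 6; 0; 1; 2; 7]; [:: 4; 5; 6; 0; 1; 2; 3; 7]; [:: 5; 6; 0; 1; 2; 3; 4; 7]; [:: 6; 0; 1; 2; 3; 4; 5; 7]]] | F <-
   [:: [:: [:: (5, 1); (6, 1); (3, 1); (0, 2); (6, 4)]; [:: (4, 1); (7, 3); (4, 4); (5, 4); (3, 4)]; [:: (7, 0); (2, 0); (1, 1); (3, 3); (2, 4)]; [:: (0, 0); (4, 0); (2, 1); (1, 3); (4, 3)]; [:: (6, 0); (4, 2); (6, 3); (0, 3); (2, 3)]; [:: (5, 0); (0, 1); (2, 2); (5, 3); (0, 4)]; [:: (3, 0); (7, 2); (1, 2); (3, 2); (1, 4)]; [:: (1, 0); (7, 1); (6, 2); (5, 2); (7, 4)]];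
      [:: [:: (3, 1); (1, 2); (7, 2); (6, 4); (1, 4)]; [:: (2, 1); (0, 3); (3, 4); (2, 4); (5, 4)]; [:: (6, 1); (2, 2); (6, 3); (0, 4); (7, 4)]; [:: (0, 1); (6, 2); (0, 2); (3, 2); (4, 4)]; [:: (0, 0); (5, 0); (1, 0); (4, 2); (5, 3)]; [:: (6, 0); (7, 0); (1, 1); (4, 1); (1, 3)]; [:: (4, 0); (5, 2); (4, 3); (3, 3); (7, 3)]; [:: (3, 0); (2, 0); (5, 1); (7, 1); (2, 3)]];
      [:: [:: (5, 0); (6, 0); (5, 2); (2, 4); (6, 4)]; [:: (7, 0); (3, 2); (7, 3); (2, 3); (6, 3)]; [:: (2, 1); (7, 2); (3, 3); (7, 4); (4, 4)]; [:: (7, 1); (6, 1); (0, 2); (4, 2); (0, 4)]; [:: (2, 0); (4, 0); (1, 2); (6, 2); (1, 4)]; [:: (0, 0); (2, 2); (0, 3); (5, 3); (3, 4)]; [:: (1, 0); (5, 1); (0, 1); (1, 3); (5, 4)]; [:: (3, 0); (4, 1); (3, 1); (1, 1); (4, 3)]]]].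

(** The labels are the field of 8 elements with bitwise addition. The rows are x, x + d, x, x + d, x
    + wd for a fixed w, and the differences d, (w - 1)d and wd all run through the nonzero elements;
    [rows_k4] is the same over the field of 4 elements. *)
Definition rows_k8 : seq (seq (seq pt)) := map (map (zip^~ (iota 0 5)))
  [:: [:: [:: 0; 1; 0; 1; 3]; [:: 1; 0; 1; 0; 2]; [:: 2; 3; 2; 3; 1]; [:: 3; 2; 3; 2; 0]; [:: 4; 5; 4; 5; 7]; [:: 5; 4; 5; 4; 6]; [:: 6; 7; 6; 7; 5]; [:: 7; 6; 7; 6; 4]];
      [:: [:: 0; 2; 0; 2; 6]; [:: 1; 3; 1; 3; 7]; [:: 2; 0; 2; 0; 4]; [:: 3; 1; 3; 1; 5]; [:: 4; 6; 4; 6; 2]; [:: 5; 7; 5; 7; 3]; [:: 6; 4; 6; 4; 0]; [:: 7; 5; 7; 5; 1]];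
      [:: [:: 0; 3; 0; 3; 5]; [:: 1; 2; 1; 2; 4]; [:: 2; 1; 2; 1; 7]; [:: 3; 0; 3; 0; 6]; [:: 4; 7; 4; 7; 1]; [:: 5; 6; 5; 6; 0]; [:: 6; 5; 6; 5; 3]; [:: 7; 4; 7; 4; 2]];
      [:: [:: 0; 4; 0; 4; 7]; [:: 1; 5; 1; 5; 6]; [:: 2; 6; 2; 6; 5]; [:: 3; 7; 3; 7; 4]; [:: 4; 0; 4; 0; 3]; [:: 5; 1; 5; 1; 2]; [:: 6; 2; 6; 2; 1]; [:: 7; 3; 7; 3; 0]];
      [:: [:: 0; 5; 0; 5; 4]; [:: 1; 4; 1; 4; 5]; [:: 2; 7; 2; 7; 6]; [:: 3; 6; 3; 6; 7]; [:: 4; 1; 4; 1; 0]; [:: 5; 0; 5; 0; 1]; [:: 6; 3; 6; 3; 2]; [:: 7; 2; 7; 2; 3]];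
      [:: [:: 0; 6; 0; 6; 1]; [:: 1; 7; 1; 7; 0]; [:: 2; 4; 2; 4; 3]; [:: 3; 5; 3; 5; 2]; [:: 4; 2; 4; 2; 5]; [:: 5; 3; 5; 3; 4]; [:: 6; 0; 6; 0; 7]; [:: 7; 1; 7; 1; 6]];
      [:: [:: 0; 7; 0; 7; 2]; [:: 1; 6; 1; 6; 3]; [:: 2; 5; 2; 5; 0]; [:: 3; 4; 3; 4; 1]; [:: 4; 3; 4; 3; 6]; [:: 5; 2; 5; 2; 7]; [:: 6; 1; 6; 1; 4]; [:: 7; 0; 7; 0; 5]]].

Lemma E8_prime p : prime p -> 4 < p -> msys_E p 8.
Proof. by apply: (E_table (n := 8) (Lt := strip_k8) (Lf := rows_k8)); vm_compute. Qed.

(** One base factor is developed by the 21 maps ux + v of Z_7 with u in {1, 2, 4}, where u also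
    turns the labels 7, 8, 9. The six other factors are made of lines of Z_7 and of cycles on 7, 8,
    9. *)
Definition strip_k10 : seq (seq (seq pt)) :=
  flatten [seq [seq relabel g F | g <- [:: [:: 0; 1; 2; 3; 4; 5; 6; 7; 8; 9]; [:: 1; 2; 3; 4; 5; 6; 0; 7; 8; 9]; [:: 0; 2; 4; 6; 1; 3; 5; 8; 9; 7]; [:: 2; 3; 4; 5; 6; 0; 1; 7; 8; 9]; [:: 2; 4; 6; 1; 3; 5; 0; 8; 9; 7]; [:: 1; 3; 5; 0; 2; 4; 6; 8; 9; 7]; [:: 0; 4; 1; 5; 2; 6; 3; 9; 7; 8]; [:: 3; 4; 5; 6; 0; 1; 2; 7; 8; 9]; [:: 4; 6; 1; 3; 5; 0; 2; 8; 9; 7]; [:: 3; 5; 0; 2; 4; 6; 1; 8; 9; 7]; [:: 4; 1; 5; 2; 6; 3; 0; 9; 7; 8]; [:: 2; 6; 3; 0; 4; 1; 5; 9; 7; 8]; [:: 1; 5; 2; 6; 3; 0; 4; 9; 7; 8]; [:: 4; 5; 6; 0; 1; 2; 3; 7; 8; 9]; [:: 6; 1; 3; 5; 0; 2; 4; 8; 9; 7]; [:: 5; 0; 2; 4; 6; 1; 3; 8; 9; 7]; [:: 6; 3; 0; 4; 1; 5; 2; 9; 7; 8]; [:: 5; 2; 6; 3; 0; 4; 1; 9; 7; 8]; [:: 3; 0; 4; 1; 5; 2; 6; 9; 7; 8]; [:: 5; 6; 0; 1; 2; 3; 4; 7; 8; 9]; [:: 6; 0; 1; 2; 3; 4; 5;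 7; 8; 9]]] | F <-
   [:: [:: [:: (6, 1); (1, 1); (8, 1); (6, 3); (9, 4)]; [:: (2, 1); (9, 2); (4, 2); (6, 4); (4, 4)]; [:: (0, 1); (2, 3); (0, 3); (8, 3); (3, 4)]; [:: (0, 0); (9, 1); (5, 1); (4, 1); (9, 3)]; [:: (7, 0); (1, 0); (9, 0); (3, 1); (1, 3)]; [:: (3, 0); (6, 2); (7, 2); (3, 3); (4, 3)]; [:: (2, 0); (4, 0); (5, 2); (7, 3); (5, 3)]; [:: (6, 0); (5, 0); (8, 2); (2, 4); (8, 4)]; [:: (8, 0); (0, 2); (2, 2); (0, 4); (1, 4)]; [:: (7, 1); (3, 2); (1, 2); (7, 4); (5, 4)]]]]
   ++ [:: [:: [:: (0, 0); (1, 1); (2, 2); (3, 3); (4, 4)]; [:: (1, 0); (2, 1); (3, 2); (4, 3); (5, 4)]; [:: (2, 0); (3, 1); (4, 2); (5, 3); (6, 4)]; [:: (3, 0); (4, 1); (5, 2); (6, 3); (0, 4)]; [:: (4, 0); (5, 1); (6, 2); (0, 3); (1, 4)]; [:: (5, 0); (6, 1); (0, 2); (1, 3); (2, 4)]; [:: (6, 0); (0, 1); (1, 2); (2, 3); (3, 4)]; [:: (9, 0); (7, 0); (8, 1); (9, 2); (8, 4)]; [:: (8, 0); (7, 2); (8, 3); (9, 3); (7, 3)]; [:: (9, 1); (7, 1); (8, 2); (9, 4); (7, 4)]];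
      [:: [:: (0, 0); (2, 1); (4, 2); (6, 3); (1, 4)]; [:: (1, 0); (3, 1); (5, 2); (0, 3); (2, 4)]; [:: (2, 0); (4, 1); (6, 2); (1, 3); (3, 4)]; [:: (3, 0); (5, 1); (0, 2); (2, 3); (4, 4)]; [:: (4, 0); (6, 1); (1, 2); (3, 3); (5, 4)]; [:: (5, 0); (0, 1); (2, 2); (4, 3); (6, 4)]; [:: (6, 0); (1, 1); (3, 2); (5, 3); (0, 4)]; [:: (7, 0); (9, 2); (7, 2); (8, 2); (9, 3)]; [:: (8, 0); (9, 0); (8, 1); (7, 3); (9, 4)]; [:: (7, 1); (9, 1); (8, 3); (7, 4); (8, 4)]];
      [:: [:: (0, 0); (3, 1); (6, 2); (2, 3); (5, 4)]; [:: (1, 0); (4, 1); (0, 2); (3, 3); (6, 4)]; [:: (2, 0); (5, 1); (1, 2); (4, 3); (0, 4)]; [:: (3, 0); (6, 1); (2, 2); (5, 3); (1, 4)]; [:: (4, 0); (0, 1); (3, 2); (6, 3); (2, 4)]; [:: (5, 0); (1, 1); (4, 2); (0, 3); (3, 4)]; [:: (6, 0); (2, 1); (5, 2); (1, 3); (4, 4)]; [:: (7, 0); (8, 0); (9, 1); (7, 2); (8, 4)]; [:: (7, 1); (8, 1); (9, 3); (7, 4); (9, 4)]; [:: (9, 0); (8, 2); (9, 2); (7, 3); (8, 3)]];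
      [:: [:: (0, 0); (4, 1); (1, 2); (5, 3); (2, 4)]; [:: (1, 0); (5, 1); (2, 2); (6, 3); (3, 4)]; [:: (2, 0); (6, 1); (3, 2); (0, 3); (4, 4)]; [:: (3, 0); (0, 1); (4, 2); (1, 3); (5, 4)]; [:: (4, 0); (1, 1); (5, 2); (2, 3); (6, 4)]; [:: (5, 0); (2, 1); (6, 2); (3, 3); (0, 4)]; [:: (6, 0); (3, 1); (0, 2); (4, 3); (1, 4)]; [:: (9, 1); (8, 1); (7, 2); (9, 4); (8, 4)]; [:: (9, 0); (8, 0); (7, 1); (9, 2); (7, 4)]; [:: (7, 0); (8, 2); (7, 3); (9, 3); (8, 3)]];
      [:: [:: (0, 0); (5, 1); (3, 2); (1, 3); (6, 4)]; [:: (1, 0); (6, 1); (4, 2); (2, 3); (0, 4)]; [:: (2, 0); (0, 1); (5, 2); (3, 3); (1, 4)]; [:: (3, 0); (1, 1); (6, 2); (4, 3); (2, 4)]; [:: (4, 0); (2, 1); (0, 2); (5, 3); (3, 4)]; [:: (5, 0); (3, 1); (1, 2); (6, 3); (4, 4)]; [:: (6, 0); (4, 1); (2, 2); (0, 3); (5, 4)]; [:: (7, 0); (9, 0); (7, 1); (8, 3); (9, 4)]; [:: (8, 1); (9, 1); (7, 3); (8, 4); (7, 4)]; [:: (8, 0); (9, 2); (8, 2); (7, 2); (9, 3)]];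
      [:: [:: (0, 0); (6, 1); (5, 2); (4, 3); (3, 4)]; [:: (1, 0); (0, 1); (6, 2); (5, 3); (4, 4)]; [:: (2, 0); (1, 1); (0, 2); (6, 3); (5, 4)]; [:: (3, 0); (2, 1); (1, 2); (0, 3); (6, 4)]; [:: (4, 0); (3, 1); (2, 2); (1, 3); (0, 4)]; [:: (5, 0); (4, 1); (3, 2); (2, 3); (1, 4)]; [:: (6, 0); (5, 1); (4, 2); (3, 3); (2, 4)]; [:: (9, 0); (7, 2); (9, 2); (8, 3); (7, 3)]; [:: (8, 0); (7, 0); (9, 1); (8, 2); (7, 4)]; [:: (8, 1); (7, 1); (9, 3); (8, 4); (9, 4)]]].

Definition rows_k10 : seq (seq (seq pt)) := map (map (zip^~ (iota 0 5)))
  [:: [:: [:: 7; 1; 0; 4; 3]; [:: 1; 7; 5; 8; 2]; [:: 5; 3; 7; 3; 0]; [:: 0; 2; 3; 5; 7]; [:: 6; 5; 8; 0; 5]; [:: 9; 4; 1; 7; 8]; [:: 2; 6; 9; 6; 4]; [:: 8; 0; 2; 1; 9]; [:: 4; 9; 6; 9; 1]; [:: 3; 8; 4; 2; 6]];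
      [:: [:: 8; 2; 1; 5; 4]; [:: 2; 8; 6; 0; 3]; [:: 6; 4; 8; 4; 1]; [:: 1; 3; 4; 6; 8]; [:: 7; 6; 0; 1; 6]; [:: 9; 5; 2; 8; 0]; [:: 3; 7; 9; 7; 5]; [:: 0; 1; 3; 2; 9]; [:: 5; 9; 7; 9; 2]; [:: 4; 0; 5; 3; 7]];
      [:: [:: 0; 3; 2; 6; 5]; [:: 3; 0; 7; 1; 4]; [:: 7; 5; 0; 5; 2]; [:: 2; 4; 5; 7; 0]; [:: 8; 7; 1; 2; 7]; [:: 9; 6; 3; 0; 1]; [:: 4; 8; 9; 8; 6]; [:: 1; 2; 4; 3; 9]; [:: 6; 9; 8; 9; 3]; [:: 5; 1; 6; 4; 8]];
      [:: [:: 1; 4; 3; 7; 6]; [:: 4; 1; 8; 2; 5]; [:: 8; 6; 1; 6; 3]; [:: 3; 5; 6; 8; 1]; [:: 0; 8; 2; 3; 8]; [:: 9; 7; 4; 1; 2]; [:: 5; 0; 9; 0; 7]; [:: 2; 3; 5; 4; 9]; [:: 7; 9; 0; 9; 4]; [:: 6; 2; 7; 5; 0]];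
      [:: [:: 2; 5; 4; 8; 7]; [:: 5; 2; 0; 3; 6]; [:: 0; 7; 2; 7; 4]; [:: 4; 6; 7; 0; 2]; [:: 1; 0; 3; 4; 0]; [:: 9; 8; 5; 2; 3]; [:: 6; 1; 9; 1; 8]; [:: 3; 4; 6; 5; 9]; [:: 8; 9; 1; 9; 5]; [:: 7; 3; 8; 6; 1]];
      [:: [:: 3; 6; 5; 0; 8]; [:: 6; 3; 1; 4; 7]; [:: 1; 8; 3; 8; 5]; [:: 5; 7; 8; 1; 3]; [:: 2; 1; 4; 5; 1]; [:: 9; 0; 6; 3; 4]; [:: 7; 2; 9; 2; 0]; [:: 4; 5; 7; 6; 9]; [:: 0; 9; 2; 9; 6]; [:: 8; 4; 0; 7; 2]];
      [:: [:: 4; 7; 6; 1; 0]; [:: 7; 4; 2; 5; 8]; [:: 2; 0; 4; 0; 6]; [:: 6; 8; 0; 2; 4]; [:: 3; 2; 5; 6; 2]; [:: 9; 1; 7; 4; 5]; [:: 8; 3; 9; 3; 1]; [:: 5; 6; 8; 7; 9]; [:: 1; 9; 3; 9; 7]; [:: 0; 5; 1; 8; 3]];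
      [:: [:: 5; 8; 7; 2; 1]; [:: 8; 5; 3; 6; 0]; [:: 3; 1; 5; 1; 7]; [:: 7; 0; 1; 3; 5]; [:: 4; 3; 6; 7; 3]; [:: 9; 2; 8; 5; 6]; [:: 0; 4; 9; 4; 2]; [:: 6; 7; 0; 8; 9]; [:: 2; 9; 4; 9; 8]; [:: 1; 6; 2; 0; 4]];
      [:: [:: 6; 0; 8; 3; 2]; [:: 0; 6; 4; 7; 1]; [:: 4; 2; 6; 2; 8]; [:: 8; 1; 2; 4; 6]; [:: 5; 4; 7; 8; 4]; [:: 9; 3; 0; 6; 7]; [:: 1; 5; 9; 5; 3]; [:: 7; 8; 1; 0; 9]; [:: 3; 9; 5; 9; 0]; [:: 2; 7; 3; 1; 5]]].

Lemma E10_prime p : prime p -> 4 < p -> msys_E p 10.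
Proof. by apply: (E_table (n := 10) (Lt := strip_k10) (Lf := rows_k10)); vm_compute. Qed.

(** One factor that misses the label 0, developed by the alternating group on four labels: three
    factors for each hole. *)
Definition strip_f4 : seq (seq (seq pt)) :=
  flatten [seq [seq relabel g F | g <- [:: [:: 0; 1; 2; 3]; [:: 0; 2; 3; 1]; [:: 1; 0; 3; 2]; [:: 0; 3; 1; 2]; [:: 1; 3; 2; 0]; [:: 2; 0; 1; 3]; [:: 1; 2; 0; 3]; [:: 2; 1; 3; 0]; [:: 3; 0; 2; 1]; [:: 3; 1; 0; 2]; [:: 2; 3; 0; 1]; [:: 3; 2; 1; 0]]] | F <-
   [:: [:: [:: (3, 1); (1, 1); (2, 3); (1, 3); (2, 4)]; [:: (1, 0); (3, 0); (2, 1); (1, 2); (3, 3)]; [:: (2, 0); (3, 2); (2, 2); (3, 4); (1, 4)]]]].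

Definition rows_f4 : seq (seq (seq pt)) := map (map (zip^~ (iota 0 5)))
  [:: [:: [:: 1; 2; 3; 1; 2]; [:: 2; 3; 1; 2; 3]; [:: 3; 1; 2; 3; 1]];
      [:: [:: 0; 3; 2; 0; 3]; [:: 2; 0; 3; 2; 0]; [:: 3; 2; 0; 3; 2]];
      [:: [:: 0; 1; 3; 0; 1]; [:: 1; 3; 0; 1; 3]; [:: 3; 0; 1; 3; 0]];
      [:: [:: 0; 2; 1; 0; 2]; [:: 1; 0; 2; 1; 0]; [:: 2; 1; 0; 2; 1]]].

Lemma frame4_prime p : prime p -> 4 < p -> msys_F p 4.
Proof. by apply: (F_table (n := 4) (Lt := strip_f4) (Lf := rows_f4)); vm_compute. Qed.

Definition strip_f5 : seq (seq (seq pt)) :=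
  flatten [seq [seq relabel g F | g <- [:: [:: 0; 1; 2; 3; 4]; [:: 1; 2; 3; 4; 0]; [:: 2; 3; 4; 0; 1]; [:: 3; 4; 0; 1; 2]; [:: 4; 0; 1; 2; 3]]] | F <-
   [:: [:: [:: (3, 0); (2, 0); (1, 2); (2, 4); (1, 4)]; [:: (2, 1); (1, 1); (3, 1); (1, 3); (4, 4)]; [:: (1, 0); (4, 1); (3, 2); (4, 2); (2, 3)]; [:: (4, 0); (2, 2); (3, 3); (4, 3); (3, 4)]];
      [:: [:: (4, 1); (2, 2); (4, 2); (1, 4); (3, 4)]; [:: (1, 1); (3, 2); (1, 2); (4, 4); (2, 4)]; [:: (2, 0); (4, 0); (3, 1); (2, 3); (4, 3)]; [:: (3, 0); (1, 0); (2, 1); (3, 3); (1, 3)]];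
      [:: [:: (4, 0); (1, 1); (2, 2); (1, 2); (3, 3)]; [:: (2, 0); (3, 0); (4, 2); (3, 4); (4, 4)]; [:: (1, 0); (3, 2); (2, 3); (1, 3); (2, 4)]; [:: (3, 1); (4, 1); (2, 1); (4, 3); (1, 4)]]]].

Definition rows_f5 : seq (seq (seq pt)) := map (map (zip^~ (iota 0 5)))
  [:: [:: [:: 1; 2; 4; 1; 4]; [:: 2; 4; 3; 2; 3]; [:: 3; 1; 2; 3; 2]; [:: 4; 3; 1; 4; 1]];
      [:: [:: 0; 4; 2; 0; 2]; [:: 2; 3; 0; 2; 0]; [:: 3; 0; 4; 3; 4]; [:: 4; 2; 3; 4; 3]];
      [:: [:: 0; 3; 4; 0; 4]; [:: 1; 0; 3; 1; 3]; [:: 3; 4; 1; 3; 1]; [:: 4; 1; 0; 4; 0]];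
      [:: [:: 0; 2; 1; 0; 1]; [:: 1; 4; 0; 1; 0]; [:: 2; 1; 4; 2; 4]; [:: 4; 0; 2; 4; 2]];
      [:: [:: 0; 1; 3; 0; 3]; [:: 1; 3; 2; 1; 2]; [:: 2; 0; 1; 2; 1]; [:: 3; 2; 0; 3; 0]]].

Lemma frame5_prime p : prime p -> 4 < p -> msys_F p 5.
Proof. by apply: (F_table (n := 5) (Lt := strip_f5) (Lf := rows_f5)); vm_compute. Qed.

Definition strip_f6 : seq (seq (seq pt)) :=
  flatten [seq [seq relabel g F | g <- [:: [:: 0; 1; 2; 3; 4; 5]; [:: 1; 2; 3; 4; 0; 5]; [:: 2; 3; 4; 0; 1; 5]; [:: 3; 4; 0; 1; 2; 5]; [:: 4; 0; 1; 2; 3; 5]]] | F <-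
   [:: [:: [:: (4, 0); (2, 2); (1, 2); (4, 2); (5, 3)]; [:: (1, 0); (5, 0); (2, 1); (3, 1); (2, 3)]; [:: (3, 0); (2, 0); (5, 2); (4, 4); (5, 4)]; [:: (4, 1); (1, 3); (3, 3); (4, 3); (3, 4)]; [:: (1, 1); (5, 1); (3, 2); (1, 4); (2, 4)]];
      [:: [:: (1, 0); (3, 0); (2, 2); (5, 2); (3, 3)]; [:: (5, 0); (4, 0); (3, 1); (1, 1); (4, 3)]; [:: (2, 0); (4, 2); (1, 2); (5, 4); (3, 4)]; [:: (5, 1); (2, 3); (1, 3); (5, 3); (1, 4)]; [:: (2, 1); (4, 1); (3, 2); (2, 4); (4, 4)]];
      [:: [:: (3, 0); (4, 0); (2, 0); (3, 2); (2, 3)]; [:: (3, 1); (2, 1); (3, 3); (1, 3); (5, 4)]; [:: (1, 1); (5, 2); (4, 2); (1, 4); (4, 4)]; [:: (5, 0); (1, 2); (2, 2); (3, 4); (2, 4)]; [:: (1, 0); (5, 1); (4, 1); (5, 3); (4, 3)]]]]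
   ++ [:: [:: [:: (0, 0); (1, 1); (2, 2); (3, 3); (4, 4)]; [:: (1, 0); (2, 1); (3, 2); (4, 3); (0, 4)]; [:: (2, 0); (3, 1); (4, 2); (0, 3); (1, 4)]; [:: (3, 0); (4, 1); (0, 2); (1, 3); (2, 4)]; [:: (4, 0); (0, 1); (1, 2); (2, 3); (3, 4)]];
      [:: [:: (0, 0); (2, 1); (4, 2); (1, 3); (3, 4)]; [:: (1, 0); (3, 1); (0, 2); (2, 3); (4, 4)]; [:: (2, 0); (4, 1); (1, 2); (3, 3); (0, 4)]; [:: (3, 0); (0, 1); (2, 2); (4, 3); (1, 4)]; [:: (4, 0); (1, 1); (3, 2); (0, 3); (2, 4)]];
      [:: [:: (0, 0); (3, 1); (1, 2); (4, 3); (2, 4)]; [:: (1, 0); (4, 1); (2, 2); (0, 3); (3, 4)]; [:: (2, 0); (0, 1); (3, 2); (1, 3); (4, 4)]; [:: (3, 0); (1, 1); (4, 2); (2, 3); (0, 4)]; [:: (4, 0); (2, 1); (0, 2); (3, 3); (1, 4)]]].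

Definition rows_f6 : seq (seq (seq pt)) := map (map (zip^~ (iota 0 5)))
  [:: [:: [:: 3; 5; 4; 2; 1]; [:: 4; 2; 1; 3; 5]; [:: 1; 3; 5; 4; 2]; [:: 5; 4; 2; 1; 3]; [:: 2; 1; 3; 5; 4]];
      [:: [:: 4; 5; 0; 3; 2]; [:: 0; 3; 2; 4; 5]; [:: 2; 4; 5; 0; 3]; [:: 5; 0; 3; 2; 4]; [:: 3; 2; 4; 5; 0]];
      [:: [:: 0; 5; 1; 4; 3]; [:: 1; 4; 3; 0; 5]; [:: 3; 0; 5; 1; 4]; [:: 5; 1; 4; 3; 0]; [:: 4; 3; 0; 5; 1]];
      [:: [:: 1; 5; 2; 0; 4]; [:: 2; 0; 4; 1; 5]; [:: 4; 1; 5; 2; 0]; [:: 5; 2; 0; 4; 1]; [:: 0; 4; 1; 5; 2]];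
      [:: [:: 2; 5; 3; 1; 0]; [:: 3; 1; 0; 2; 5]; [:: 0; 2; 5; 3; 1]; [:: 5; 3; 1; 0; 2]; [:: 1; 0; 2; 5; 3]];
      [:: [:: 0; 1; 2; 3; 4]; [:: 1; 2; 3; 4; 0]; [:: 2; 3; 4; 0; 1]; [:: 3; 4; 0; 1; 2]; [:: 4; 0; 1; 2; 3]]].

Lemma frame6_prime p : prime p -> 4 < p -> msys_F p 6.
Proof. by apply: (F_table (n := 6) (Lt := strip_f6) (Lf := rows_f6)); vm_compute. Qed.

Definition strip_f7 : seq (seq (seq pt)) :=
  flatten [seq [seq relabel g F | g <- [:: [:: 0; 1; 2; 3; 4; 5; 6]; [:: 1; 2; 3; 4; 5; 6; 0]; [:: 0; 2; 4; 6; 1; 3; 5]; [:: 2; 3; 4; 5; 6; 0; 1]; [:: 2; 4; 6; 1; 3; 5; 0]; [:: 1; 3; 5; 0; 2; 4; 6]; [:: 0; 4; 1; 5; 2; 6; 3]; [:: 3; 4; 5; 6; 0; 1; 2]; [:: 4; 6; 1; 3; 5; 0; 2]; [:: 3; 5; 0; 2; 4; 6; 1]; [:: 4; 1; 5; 2; 6; 3; 0]; [:: 2; 6; 3; 0; 4; 1; 5]; [:: 1; 5; 2; 6; 3; 0; 4]; [:: 4; 5; 6; 0; 1; 2; 3]; [:: 6; 1; 3; 5; 0; 2; 4]; [:: 5; 0; 2; 4; 6; 1; 3]; [:: 6; 3; 0; 4; 1; 5; 2]; [:: 5; 2; 6; 3; 0; 4; 1]; [:: 3; 0; 4; 1; 5;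 2; 6]; [:: 5; 6; 0; 1; 2; 3; 4]; [:: 6; 0; 1; 2; 3; 4; 5]]] | F <-
   [:: [:: [:: (4, 1); (5, 1); (6, 2); (4, 2); (5, 4)]; [:: (3, 1); (4, 3); (3, 4); (4, 4); (2, 4)]; [:: (4, 0); (1, 1); (6, 1); (2, 2); (5, 3)]; [:: (3, 0); (2, 1); (1, 3); (3, 3); (2, 3)]; [:: (6, 0); (3, 2); (5, 2); (6, 3); (1, 4)]; [:: (1, 0); (2, 0); (5, 0); (1, 2); (6, 4)]]]].

Definition rows_f7 : seq (seq (seq pt)) := map (map (zip^~ (iota 0 5)))
  [:: [:: [:: 1; 2; 4; 1; 6]; [:: 2; 4; 1; 2; 5]; [:: 3; 6; 5; 3; 4]; [:: 4; 1; 2; 4; 3]; [:: 5; 3; 6; 5; 2]; [:: 6; 5; 3; 6; 1]];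
      [:: [:: 0; 6; 4; 0; 2]; [:: 2; 3; 5; 2; 0]; [:: 3; 5; 2; 3; 6]; [:: 4; 0; 6; 4; 5]; [:: 5; 2; 3; 5; 4]; [:: 6; 4; 0; 6; 3]];
      [:: [:: 0; 5; 1; 0; 4]; [:: 1; 0; 5; 1; 3]; [:: 3; 4; 6; 3; 1]; [:: 4; 6; 3; 4; 0]; [:: 5; 1; 0; 5; 6]; [:: 6; 3; 4; 6; 5]];
      [:: [:: 0; 4; 5; 0; 6]; [:: 1; 6; 2; 1; 5]; [:: 2; 1; 6; 2; 4]; [:: 4; 5; 0; 4; 2]; [:: 5; 0; 4; 5; 1]; [:: 6; 2; 1; 6; 0]];
      [:: [:: 0; 3; 2; 0; 1]; [:: 1; 5; 6; 1; 0]; [:: 2; 0; 3; 2; 6]; [:: 3; 2; 0; 3; 5]; [:: 5; 6; 1; 5; 3]; [:: 6; 1; 5; 6; 2]];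
      [:: [:: 0; 2; 6; 0; 3]; [:: 1; 4; 3; 1; 2]; [:: 2; 6; 0; 2; 1]; [:: 3; 1; 4; 3; 0]; [:: 4; 3; 1; 4; 6]; [:: 6; 0; 2; 6; 4]];
      [:: [:: 0; 1; 3; 0; 5]; [:: 1; 3; 0; 1; 4]; [:: 2; 5; 4; 2; 3]; [:: 3; 0; 1; 3; 2]; [:: 4; 2; 5; 4; 1]; [:: 5; 4; 2; 5; 0]]].

Lemma frame7_prime p : prime p -> 4 < p -> msys_F p 7.
Proof. by apply: (F_table (n := 7) (Lt := strip_f7) (Lf := rows_f7)); vm_compute. Qed.

(** * Multiplying columns and labels, and filling frames *)

(** A column of the larger system is read as quotient and remainder by g; chaining the lifts
    lengthens the cycles along with the columns. This reduces odd m to a prime divisor. *)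
Lemma step_sys_cols p g k I V A : odd p -> 1 < p -> odd g ->
  step_sys p k I V A all_steps -> step_sys (p * g) (k * g) I V A all_steps.
Proof.
move=> po p1 go [B [BD BE]]; have g0 : 0 < g by case: g go.
exists (fun z (q q' : pt) => B z (q.1, q.2 %/ g) (q'.1, q'.2 %/ g)); split.
  move=> z zI; have := dec_cols po p1 go (BD z zI).
  apply: (dec_map (f := fun q : pt * nat => (q.1.1, q.1.2 * g + q.2))).
  - move=> [[x l] r] [[y l'] r']; rewrite !unfold_in /bl /= => /andP[_ rg] /andP[_ rg'] [-> e].
    have := congr1 (divn^~ g) e; rewrite !divnMDl // !divn_small // !addn0 => ->.
    by have := congr1 (modn^~ g) e; rewrite !modnMDl !modn_small // => ->.
  - by move=> [[x l] r]; rewrite /bl /= => /andP[/andP[-> lp] rg] /=; nia.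
  - move=> [x l]; rewrite /bl /= => /andP[Vx lp]; exists ((x, l %/ g), l %% g); last by rewrite /= -divn_eq.
    by rewrite /= ltn_pmod // Vx ltn_divLR // lp.
  - move=> [[x l] r] [[y l'] r']; rewrite /bl /= => /andP[_ rg] /andP[_ rg'].
    by rewrite !divnMDl // !divn_small // !addn0 rg rg' muln1.
  move=> [x l] [y l'] /= nz; have := dec_supp (BD _ zI) nz.
  by rewrite /bl /= !ltn_divLR.
by move=> [x l] [y l']; rewrite BE /= !ltn_divLR.
Qed.

Lemma step_sys_lift m g k I V A : odd m -> 1 < m -> odd g || (g == 4) ->
  step_sys m k I V A all_steps ->
  step_sys m (k * g) I (fun z x => V z (x %/ g)) (fun x y => A (x %/ g) (y %/ g)) all_steps.
Proof.
move=> mo m1 go [B [BD BE]]; have g0 : 0 < g by case/orP: go => [|/eqP->] //; case: g.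
exists (fun z (q q' : pt) => B z (q.1 %/ g, q.2) (q'.1 %/ g, q'.2)); split.
  move=> z zI; have := dec_lift mo m1 go (BD z zI).
  apply: (dec_map (f := fun q : pt * nat => (q.1.1 * g + q.2, q.1.2))).
  - move=> [[x l] r] [[y l'] r']; rewrite !unfold_in /bl /= => /andP[_ rg] /andP[_ rg'] [e ->].
    have := congr1 (divn^~ g) e; rewrite !divnMDl // !divn_small // !addn0 => ->.
    by have := congr1 (modn^~ g) e; rewrite !modnMDl !modn_small // => ->.
  - by move=> [[x l] r]; rewrite /bl /= => /andP[/andP[Vx lp] rg]; rewrite divnMDl // divn_small // addn0 Vx.
  - move=> [x l]; rewrite /bl /= => /andP[Vx lp]; exists ((x %/ g, l), x %% g); last by rewrite /= -divn_eq.
    by rewrite /= ltn_pmod // Vx lp.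
  - move=> [[x l] r] [[y l'] r']; rewrite /bl /= => /andP[_ rg] /andP[_ rg'].
    by rewrite !divnMDl // !divn_small // !addn0 rg rg' muln1.
  by move=> [x l] [y l'] /= nz; have := dec_supp (BD _ zI) nz; rewrite /bl /=.
by move=> [x l] [y l']; rewrite BE.
Qed.

Definition Karcs m n (p q : pt) : nat := Krel n p.1 q.1 * ((p.2 < m) && (q.2 < m)).

(** For n = 2 and odd m this is impossible, because arcs between two labels form a bipartite
    digraph; hence the care below to avoid groups of size 1. *)
Definition E m n := dec m (n.-1 * m) (bl (fun x => x < n) m) (Karcs m n).

Lemma E_of_sys m n : msys_E m n -> E m n.
Proof.
move=> [B [BD BE]]; apply: dec_ext (BD 0 (mem_head _ _)) => // p q.
by have := BE p q; rewrite big_seq1 /Karcs /all_steps => ->; rewrite andbT.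
Qed.

Lemma sys_of_E m n : E m n -> msys_E m n.
Proof.
move=> H; exists (fun=> Karcs m n); split=> [z _|p q]; first exact: H.
by rewrite big_seq1 /Karcs /all_steps andbT.
Qed.

Definition arcs_on m (s : seq nat) (p q : pt) : nat :=
  [&& p.1 \in s, q.1 \in s, p.1 != q.1, p.2 < m & q.2 < m].

Lemma place m k (s : seq nat) (V : pred nat) (A : pt -> pt -> nat) : uniq s -> (forall x, V x -> x < size s) ->
  dec m k (bl V m) A ->
  dec m k (fun q => (q.1 \in s) && bl V m (index q.1 s, q.2))
    (fun p q => ((p.1 \in s) && (q.1 \in s)) * A (index p.1 s, p.2) (index q.1 s, q.2)).
Proof.
move=> us Vs D; apply: (dec_map (f := fun q : pt => (nth 0 s q.1, q.2)) _ _ _ _ _ D).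
- move=> [x l] [y l']; rewrite !unfold_in /bl /= => /andP[/Vs xs _] /andP[/Vs ys _] [/eqP + ->].
  by rewrite nth_uniq // => /eqP ->.
- by move=> [x l]; rewrite /bl /= => /andP[Vx lm]; rewrite mem_nth ?Vs // index_uniq ?Vs // Vx.
- by move=> [y l] /= /andP[ys H]; exists (index y s, l); rewrite //= nth_index.
- move=> [x l] [y l']; rewrite /bl /= => /andP[Vx _] /andP[Vy _].
  by rewrite !mem_nth ?Vs //= !index_uniq ?Vs // mul1n.
move=> [x l] [y l'] /=; case xs: (x \in s); case ys: (y \in s) => //=; rewrite mul1n => nz.
by have := dec_supp D nz.
Qed.

Lemma E_place m s : uniq s -> E m (size s) ->
  dec m ((size s).-1 * m) (bl (fun x => x \in s) m) (arcs_on m s).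
Proof.
move=> us /(place us (fun x h => h)); apply: dec_ext => [[x l]|[x l] [y l']].
  by rewrite /bl /=; case xs: (x \in s); rewrite //= index_mem xs.
rewrite /arcs_on /Karcs /Krel /=; case xs: (x \in s); case ys: (y \in s) => //=.
rewrite !index_mem xs ys /= mul1n mulnb.
rewrite (_ : (index x s != index y s) = (x != y)) -?andbA //.
by congr negb; apply/eqP/eqP => [e|-> //]; rewrite -(nth_index 0 xs) e nth_index.
Qed.

(** The new label [n] joins every group. A factor that misses the group i is completed by a factor
    on this group and [n], and there are s i * m of both kinds. *)
Lemma frame_fill m n (I : seq nat) (grp s : nat -> nat) (B : nat -> pt -> pt -> nat) :
  uniq I -> (forall x, x < n -> grp x \in I) ->
  (forall i, i \in I -> size [seq x <- iota 0 n | grp x == i] = s i) ->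
  (forall i, i \in I -> dec m (s i * m) (bl (fun x => (x < n) && (grp x != i)) m) (B i)) ->
  (forall p q, \sum_(i <- I) B i p q =
     [&& p.1 < n, q.1 < n, grp p.1 != grp q.1, p.2 < m & q.2 < m]) ->
  (forall i, i \in I -> E m (s i).+1) -> E m n.+1.
Proof.
move=> uI gI sz BD BE HE.
pose blk i := rcons [seq x <- iota 0 n | grp x == i] n.
have mblk i x : (x \in blk i) = (x == n) || (x < n) && (grp x == i).
  by rewrite mem_rcons inE mem_filter mem_iota /= andbC.
have ublk i : uniq (blk i) by rewrite rcons_uniq filter_uniq ?iota_uniq // andbT mem_filter mem_iota /= add0n ltnn andbF.
have D i : i \in I -> dec m (s i * m) (bl (fun x => x < n.+1) m) (fun p q => B i p q + arcs_on m (blk i) p q).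
  move=> iI; have sb : size (blk i) = (s i).+1 by rewrite size_rcons sz.
  have := @E_place m (blk i) (ublk i); rewrite sb => /(_ (HE i iI)) DE.
  apply: dec_ext (dec_union _ (BD i iI) DE) => //.
    move=> [x l]; rewrite /bl /= mblk.
    by case: (l < m); rewrite ?andbF // !andbT; case: (grp x == i); rewrite /=; lia.
  move=> [x l]; rewrite /bl /= mblk => /andP[/andP[xn gx] ->].
  by rewrite (negPf gx) andbF orbF andbT; lia.
have := dec_sum D; rewrite -big_distrl /= (_ : \sum_(i <- I) s i = n).
  apply: dec_ext => // -[x l] [y l']; rewrite big_split /= BE /Karcs /Krel /arcs_on /=.
  case lm: (l < m); last by rewrite !andbF muln0 add0n big1 // => i _; rewrite !andbF.
  case lm': (l' < m); last by rewrite !andbF muln0 add0n big1 // => i _; rewrite !andbF.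
  rewrite !andbT muln1; under eq_bigr => i _ do rewrite !mblk.
  have cI z : z < n -> \sum_(i <- I) (grp z == i) = 1.
    move=> zn; rewrite -(count_big (fun i => grp z == i)) (eq_count (a2 := pred1 (grp z))).
      by rewrite count_uniq_mem // gI.
    by move=> i; rewrite /= eq_sym.
  have [xn|xn] := ltnP x n; have [yn|yn] := ltnP y n; rewrite /=.
  - rewrite !ltnS !(ltnW xn) !(ltnW yn) /= (_ : (x == n) = false) 1?(_ : (y == n) = false); try lia.
    case: (x =P y) => [->|xy] /=; first by rewrite eqxx big1 // => i _; rewrite !andbF.
    under eq_bigr => i _ do rewrite ?andbT.
    case: (grp x =P grp y) => [e|ne] /=; first by rewrite e; under eq_bigr => i _ do rewrite andbb; rewrite cI.
    rewrite big1 // => i _; case: eqP => // e; case: eqP => // e'; by case: ne; rewrite e e'.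
  - rewrite (_ : (x == n) = false); last by lia.
    case: (y =P n) => [->|yE] /=; last first.
      rewrite big1 => [|i _]; last by rewrite andbF.
      by rewrite (_ : (y < n.+1) = false) ?andbF //; lia.
    have -> : x != n by lia.
    under eq_bigr => i _ do rewrite ?andbT.
    by rewrite cI // !ltnS (ltnW xn) leqnn.
  - rewrite (_ : (y == n) = false); last by lia.
    case: (x =P n) => [->|xE] /=; last first.
      rewrite big1 => [|i _] //.
      by rewrite (_ : (x < n.+1) = false) //; lia.
    have -> : n != y by lia.
    under eq_bigr => i _ do rewrite ?andbT.
    by rewrite cI // !ltnS (ltnW yn) leqnn.
  rewrite big1 => [|i _]; first by apply/esym/eqP; rewrite eqb0; lia.
  by apply/eqP; rewrite eqb0; lia.
rewrite -[RHS](size_iota 0 n) -sum1_size.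
rewrite (eq_big_seq (fun i => \sum_(x <- iota 0 n) (grp x == i))).
  rewrite exchange_big; apply: eq_big_seq => x; rewrite mem_iota => xn.
  rewrite -(count_big (fun i => grp x == i)) (eq_count (a2 := pred1 (grp x))).
    by rewrite count_uniq_mem // gI.
  by move=> i; rewrite /= eq_sym.
by move=> i iI; rewrite -sz // size_filter count_big.
Qed.

Lemma count_div (u g i : nat) : 0 < g -> count (fun x => x %/ g == i) (iota 0 (u * g)) = (i < u) * g.
Proof.
move=> g0; have H k : count (fun x => x %/ g == i) (iota (k * g) g) = (i == k) * g.
  rewrite (@eq_in_count _ _ (fun=> k == i)).
    by rewrite eq_sym; case: eqP => _; rewrite ?count_predT ?count_pred0 ?size_iota ?mul1n.
  move=> x; rewrite mem_iota -mulSnr => /andP[lo hi]; congr (_ == i).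
  by apply/eqP; rewrite eqn_leq -ltnS ltn_divLR // hi leq_divRL.
elim: u => [|u IH]; first by rewrite mul0n.
rewrite mulSnr iotaD count_cat IH add0n H -mulnDl; congr (_ * g); case: (ltngtP i u) => h; lia.
Qed.

Lemma E_frame m u g : odd m -> 1 < m -> odd g || (g == 4) -> msys_F m u -> E m g.+1 -> E m (u * g).+1.
Proof.
move=> mo m1 go /(step_sys_lift mo m1 go) [B [BD BE]] Eg.
have g0 : 0 < g by case/orP: go => [|/eqP->] //; case: g {BD BE Eg}.
apply: (frame_fill (I := iota 0 u) (grp := fun x => x %/ g) (s := fun=> g) (B := B)) => //.
- exact: iota_uniq.
- by move=> x xn; rewrite mem_iota /= add0n ltn_divLR.
- by move=> i; rewrite mem_iota => /andP[_ iu]; rewrite size_filter count_div // iu mul1n.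
- move=> i iI; rewrite mulnC; apply: dec_ext (BD i iI) => // -[x l].
  by rewrite /bl /= ltn_divLR.
- move=> p q; rewrite BE /Krel /all_steps andbT /= mulnb !ltn_divLR //; congr nat_of_bool.
  by rewrite -!andbA.
Qed.

(** Arcs between labels with different quotients by b come from lifting [E m a]; those with equal
    quotients come from a disjoint copies of [E m b]. *)
Lemma E_mul m a b : odd m -> 1 < m -> odd b || (b == 4) -> E m a -> E m b -> 0 < a -> E m (a * b).
Proof.
move=> mo m1 bo /sys_of_E /(step_sys_lift mo m1 bo) [B [BD BE]] Eb a0.
have b0 : 0 < b by case/orP: bo => [|/eqP->] //; case: b {BD BE Eb}.
have D1 := BD 0 (mem_head _ _).
pose blk i := iota (i * b) b.
have mblk i x : (x \in blk i) = (x %/ b == i).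
  rewrite mem_iota -mulSnr -ltn_divLR // -leq_divRL // eq_sym; lia.
have D2 : dec m (b.-1 * m) (fun p => has (fun i => bl (fun x => x \in blk i) m p) (iota 0 a))
    (fun p q => \sum_(i <- iota 0 a) arcs_on m (blk i) p q).
  apply: dec_bigunion; first exact: iota_uniq.
    move=> i j [x l] _ _; rewrite /bl /= !mblk => /andP[/eqP <- _] /andP[/eqP <- _] //.
  move=> i _; have := @E_place m (blk i) (iota_uniq _ _); rewrite size_iota; exact.
have D2' : dec m (b.-1 * m) (bl (fun x => x %/ b < a) m)
    (fun p q => \sum_(i <- iota 0 a) arcs_on m (blk i) p q).
  apply: dec_ext D2 => // -[x l]; rewrite /bl /=; apply/hasP/andP => [[i]|[xa lm]].
    by rewrite mem_iota /= mblk => ia /andP[/eqP -> ->].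
  by exists (x %/ b); [rewrite mem_iota|rewrite mblk eqxx].
have := dec_add D1 D2'; rewrite -/(E m (a * b)) (_ : _ + _ = (a * b).-1 * m); last first.
  rewrite [a.-1 * m * b]mulnAC -mulnDl -[in RHS](prednK a0) mulSn.
  by congr (_ * m); move: (a.-1 * b) => w; lia.
apply: dec_ext => [[x l]|[x l] [y l']]; first by rewrite /bl /= ltn_divLR.
have := BE (x, l) (y, l'); rewrite big_seq1 => ->.
rewrite /Karcs /Krel /arcs_on /all_steps /= andbT !ltn_divLR //.
have [xa|xa] := ltnP x (a * b); last first.
  rewrite big1_seq // => i /andP[_]; rewrite mem_iota mblk => /andP[_ ia]; case: eqP => // e.
  have : x < a * b by rewrite -ltn_divLR // e.
  by rewrite ltnNge xa.
have [ya|ya] := ltnP y (a * b); last first.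
  rewrite big1_seq // => i /andP[_]; rewrite mem_iota !mblk => /andP[_ ia].
  case: (y %/ b =P i) => [e|_]; last by rewrite andbF.
  have : y < a * b by rewrite -ltn_divLR // e.
  by rewrite ltnNge ya.
rewrite /= (eq_bigr (fun i => [&& x %/ b == y %/ b, x != y, l < m & l' < m] * (i == x %/ b))); last first.
  move=> i _; rewrite !mblk mulnb; congr nat_of_bool.
  by rewrite [i == _]eq_sym; case: (x %/ b =P i) => [->|] //=; rewrite ?andbF // eq_sym andbT.
rewrite -big_distrr /= -(count_big (fun i => i == x %/ b)) count_uniq_mem ?iota_uniq //.
rewrite mem_iota /= add0n ltn_divLR // xa muln1 !mulnb.
case: (x %/ b =P y %/ b) => [_|ne] /=; rewrite ?addn0 // (_ : (x != y) = true) //.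
by apply/eqP => e; apply: ne; rewrite e.
Qed.

(* Wilson's construction: a pairwise balanced design whose blocks carry frames with singleton groups. *)
Lemma pbd_frame m n (J : eqType) (js : seq J) (b : J -> seq nat) (grp : nat -> nat) (I : seq nat) (s : nat -> nat) :
  uniq js -> (forall j, j \in js -> uniq (b j) /\ msys_F m (size (b j))) ->
  (forall j x, j \in js -> x \in b j -> x < n) ->
  (forall x y, x < n -> y < n -> x != y ->
     count (fun j => (x \in b j) && (y \in b j)) js = (grp x != grp y)) ->
  (forall i, i \in I -> size [seq x <- iota 0 n | grp x == i] = s i) ->
  (forall x, x < n -> grp x \in I) -> uniq I ->
  exists B : nat -> pt -> pt -> nat,
    (forall i, i \in I -> dec m (s i * m) (bl (fun x => (x < n) && (grp x != i)) m) (B i)) /\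
    forall p q, \sum_(i <- I) B i p q = [&& p.1 < n, q.1 < n, grp p.1 != grp q.1, p.2 < m & q.2 < m].
Proof.
move=> ujs bP bn pair sz gI uI.
(* The family of frames on the blocks is assembled by induction on [js], which replaces a choice
   principle. *)
have [Bj BjP] : exists Bj : J -> nat -> pt -> pt -> nat, forall j, j \in js ->
    (forall z, z \in b j -> dec m m (bl (fun x => (x \in b j) && (x != z)) m) (Bj j z)) /\
    (forall p q, \sum_(z <- b j) Bj j z p q = arcs_on m (b j) p q).
  suff H j : j \in js -> exists Bz : nat -> pt -> pt -> nat,
      (forall z, z \in b j -> dec m m (bl (fun x => (x \in b j) && (x != z)) m) (Bz z)) /\
      (forall p q, \sum_(z <- b j) Bz z p q = arcs_on m (b j) p q).
    elim: (js) ujs H => [|j r IH] /= u H; first by exists (fun _ _ _ _ => 0).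
    have /andP[jr ur] := u.
    have [Bz BzP] := H j (mem_head _ _).
    have [Br BrP] := IH ur (fun k kr => H k (predU1r _ _ kr)).
    exists (fun k => if k == j then Bz else Br k) => k; rewrite inE => /predU1P[->|kr].
      by rewrite eqxx.
    by case: eqP => [e|_]; [rewrite -e kr in jr|apply: BrP].
  move=> jj; have [ub [B [BD BE]]] := bP j jj.
  exists (fun z p q => ((p.1 \in b j) && (q.1 \in b j)) *
    B (index z (b j)) (index p.1 (b j), p.2) (index q.1 (b j), q.2)); split.
    move=> z zb; have := BD (index z (b j)); rewrite mem_iota /= index_mem => /(_ zb) D.
    apply: dec_ext (place ub _ D) => // [[x l]|x /andP[] //].
    rewrite /bl /=; case xb: (x \in b j) => //=; rewrite index_mem xb /=; congr (~~ _ && _).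
    by apply/eqP/eqP => [e|-> //]; rewrite -(nth_index 0 xb) e nth_index.
  move=> [x l] [y l']; rewrite /arcs_on /= -big_distrr /=.
  case xb: (x \in b j) => //=; case yb: (y \in b j) => //=; rewrite mul1n.
  have := BE (index x (b j), l) (index y (b j), l').
  rewrite /Krel /all_steps /= !index_mem xb yb andbT /= mulnb => _.
  transitivity (\sum_(z <- map (index^~ (b j)) (b j)) B z (index x (b j), l) (index y (b j), l')).
    by rewrite big_map.
  have -> : map (index^~ (b j)) (b j) = iota 0 (size (b j)).
    apply: (@eq_from_nth _ 0); rewrite ?size_map ?size_iota // => k kb.
    by rewrite (nth_map 0) // index_uniq // nth_iota.
  rewrite BE /Krel /all_steps /= !index_mem xb yb andbT /= mulnb; congr nat_of_bool; congr (~~ _ && _).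
  by apply/eqP/eqP => [e|-> //]; rewrite -(nth_index 0 xb) e nth_index.
(* Without z, the blocks through z are disjoint and cover just the points outside the group of z; so
   their frame factors with hole z can be united. *)
pose thru z := [seq j <- js | z \in b j].
have Dz z : z < n -> dec m m (bl (fun x => (x < n) && (grp x != grp z)) m)
    (fun p q => \sum_(j <- thru z) Bj j z p q).
  move=> zn; have D : dec m m (fun p => has (fun j => bl (fun x => (x \in b j) && (x != z)) m p) (thru z))
      (fun p q => \sum_(j <- thru z) Bj j z p q).
    apply: dec_bigunion; first by rewrite filter_uniq.
      move=> i j [x l]; rewrite !mem_filter => /andP[zi ijs] /andP[zj jjs].
      rewrite /bl /= => /andP[/andP[xi xz] _] /andP[/andP[xj _] _].
      have := pair x z (bn _ _ ijs xi) zn xz => c.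
      have c1 : count (fun j => (x \in b j) && (z \in b j)) js = 1.
        move: c; case: (grp x != grp z) => // /eqP; rewrite -leqn0 leqNgt -has_count.
        by move=> /hasPn/(_ i ijs); rewrite xi zi.
      have : size [seq j <- js | (x \in b j) && (z \in b j)] = 1 by rewrite size_filter.
      have fi : i \in [seq j <- js | (x \in b j) && (z \in b j)] by rewrite mem_filter xi zi.
      have fj : j \in [seq j <- js | (x \in b j) && (z \in b j)] by rewrite mem_filter xj zj.
      by case: [seq _ <- js | _] fi fj => [|k [|//]] //; rewrite !inE => /eqP -> /eqP ->.
    by move=> j; rewrite mem_filter => /andP[zj jjs]; have [+ _] := BjP j jjs; apply.
  apply: dec_ext D => // -[x l]; rewrite /bl /=; apply/hasP/idP => [[j]|].
    rewrite mem_filter => /andP[zj jjs] /andP[/andP[xj xz] ->]; rewrite (bn _ _ jjs xj) andbT /=.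
    have := pair x z (bn _ _ jjs xj) zn xz; case: (grp x != grp z) => // /eqP.
    by rewrite -leqn0 leqNgt -has_count => /hasPn/(_ j jjs); rewrite xj zj.
  move=> /andP[/andP[xn gx] lm]; have xz : x != z by apply: contraNneq gx => ->.
  have := pair x z xn zn xz; rewrite gx => c1.
  have /hasP[j jjs /andP[xj zj]] : has (fun j => (x \in b j) && (z \in b j)) js by rewrite has_count c1.
  by exists j; rewrite ?mem_filter ?zj //= xj xz.
exists (fun i p q => \sum_(z <- [seq x <- iota 0 n | grp x == i]) \sum_(j <- thru z) Bj j z p q); split.
  move=> i iI; rewrite -sz // -sum1_size big_distrl /=; apply: dec_sum => z.
  rewrite mem_filter mem_iota => /andP[/eqP gz zn]; rewrite mul1n -gz; exact: Dz.
move=> [x l] [y l'].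
have -> : \sum_(i <- I) \sum_(z <- [seq x <- iota 0 n | grp x == i]) \sum_(j <- thru z) Bj j z (x, l) (y, l') =
    \sum_(z <- iota 0 n) \sum_(j <- thru z) Bj j z (x, l) (y, l').
  under eq_bigr => i _ do rewrite big_filter big_mkcond.
  rewrite exchange_big; apply: eq_big_seq => z; rewrite mem_iota => zn /=.
  rewrite (bigD1_seq (grp z)) ?gI //= eqxx [X in _ + X]big1 => [|i /negPf]; first by rewrite addn0.
  by rewrite eq_sym => ->.
under eq_bigr => z _ do rewrite big_filter big_mkcond.
rewrite exchange_big (eq_big_seq (fun j => arcs_on m (b j) (x, l) (y, l'))); last first.
  move=> j jjs; have [_ /(_ (x, l) (y, l')) <-] := BjP j jjs.
  have [ub _] := bP j jjs; rewrite -big_mkcond -big_filter; apply: perm_big; apply: uniq_perm => //.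
    by rewrite filter_uniq ?iota_uniq.
  by move=> z; rewrite mem_filter mem_iota /=; case zj: (z \in b j) => //=; rewrite (bn _ _ jjs zj).
rewrite /arcs_on /=; case: (x =P y) => [->|/eqP xy].
  by rewrite big1 => [|j _]; rewrite ?eqxx ?andbF //.
case lm: ((l < m) && (l' < m)); last by rewrite big1 => [|j _]; rewrite ?andbF ?lm ?andbF //; rewrite !andbA -andbA lm andbF.
under eq_bigr => j _ do rewrite /= !andbT.
rewrite -(count_big (fun j => (x \in b j) && (y \in b j))) andbT.
have [xn|xn] := ltnP x n; last first.
  apply/eqP; rewrite -leqn0 leqNgt -has_count; apply/hasPn => j jjs; apply/negP => /andP[/(bn _ _ jjs)].
  by rewrite ltnNge xn.
have [yn|yn] := ltnP y n; last first.
  apply/eqP; rewrite /= -leqn0 leqNgt -has_count; apply/hasPn => j jjs; apply/negP => /andP[_ /(bn _ _ jjs)].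
  by rewrite ltnNge yn.
by rewrite pair.
Qed.

(** * Truncated transversal designs with six groups *)

Section TD.
Variables (t a b : nat).
Hypothesis t2 : coprime t 2.
Hypothesis t3 : coprime t 3.
Hypothesis t1 : 1 < t.
Hypothesis at_ : a <= t.
Hypothesis bt : b <= t.
Let n := 4 * t + a + b.

Definition td_grp x := if x < 4 * t then x %/ t else if x < 4 * t + a then 4 else 5.
Definition td_off x := if x < 4 * t then x %% t else if x < 4 * t + a then x - 4 * t else x - (4 * t + a).
(** The block (c, d) is the line c + id in the groups 0, ..., 4 and meets the group 5 in its slope
    d. Indices of groups differ by at most 4, so 2 and 3 must be invertible modulo t. *)
Definition td_coord i (cd : nat * nat) := if i < 5 then (cd.1 + i * cd.2) %% t else cd.2.
Definition td_block cd := [seq x <- iota 0 n | td_coord (td_grp x) cd == td_off x].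
Definition td_size i := if i < 4 then t else if i == 4 then a else b.

Lemma td_grp6 x : td_grp x < 6.
Proof.
rewrite /td_grp; case: ifP => [lt|_]; last by case: ifP.
by rewrite (@leq_trans 4) // ltn_divLR //; lia.
Qed.

Lemma td_off_lt x : x < n -> td_off x < t.
Proof. by rewrite /td_off /n => xn; do 2?case: ifP => ?; rewrite ?ltn_pmod; lia. Qed.

Lemma td_inj x y : x < n -> y < n -> td_grp x = td_grp y -> td_off x = td_off y -> x = y.
Proof.
have q4 z : z < 4 * t -> z %/ t < 4 by move=> zt; rewrite ltn_divLR //; lia.
rewrite /td_grp /td_off /n => xn yn; case: (ltnP x (4 * t)) => hx; case: (ltnP y (4 * t)) => hy.
- by move=> e1 e2; rewrite (divn_eq x t) (divn_eq y t) e1 e2.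
- by have := q4 _ hx; case: ifP => _; lia.
- by have := q4 _ hy; case: ifP => _; lia.
by do 2 case: ifP => ?; lia.
Qed.

Lemma td_group_size i : i < 6 -> size [seq x <- iota 0 n | td_grp x == i] = td_size i.
Proof.
move=> i6; rewrite size_filter /n.
rewrite -addnA (iotaD 0 (4 * t)) add0n (iotaD (4 * t) a) !count_cat.
rewrite (@eq_in_count _ _ (fun x => x %/ t == i) (iota 0 _)); last first.
  by move=> x; rewrite mem_iota add0n /td_grp => /andP[_ ->].
rewrite count_div ?(ltnW t1) // (@eq_in_count _ _ (fun=> 4 == i) (iota (4 * t) a)); last first.
  by move=> x; rewrite mem_iota /td_grp => /andP[lo hi]; rewrite ltnNge lo hi.
rewrite (@eq_in_count _ _ (fun=> 5 == i) (iota (4 * t + a) b)); last first.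
  by move=> x; rewrite mem_iota /td_grp => /andP[lo hi]; (case: ifP => ?; [lia|case: ifP => ?; lia]).
by rewrite /td_size; case: i i6 => [|[|[|[|[|[|i]]]]]] //= _;
   rewrite ?count_predT ?count_pred0 ?size_iota ?mul1n ?mul0n ?addn0 ?add0n.
Qed.

(** Two points in groups below 5 give the slope after division by the difference of the indices; the
    group 5 gives the slope directly. *)
Lemma td_coord_sum i k u v : i < 6 -> k < 6 -> i != k -> u < t -> v < t ->
  count (fun cd => (td_coord i cd == u) && (td_coord k cd == v))
    [seq (c, d) | c <- iota 0 t, d <- iota 0 t] = 1.
Proof.
move=> i6 k6 ik ut vt; have t0 := ltnW t1.
have small x y : x < t -> y < t -> x = y %[mod t] -> x = y by move=> xt yt; rewrite !modn_small.
have addI z x y : x < t -> y < t -> x + z = y + z %[mod t] -> x = y.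
  by move=> xt yt /eqP; rewrite eqn_modDr => /eqP; apply: small.
have cop e : 0 < e < 5 -> coprime t e.
  case: e => [|[|[|[|[|e]]]]] // _; first exact: coprimen1.
  by rewrite -[4]/(2 ^ 2) coprimeXr.
have mulI e x y : 0 < e < 5 -> x < t -> y < t -> e * x = e * y %[mod t] -> x = y.
  move=> e5; wlog le : x y / y <= x => [H xt yt h|xt yt /eqP].
    by have [le|/ltnW le] := leqP y x; [apply: H|apply/esym; apply: H].
  rewrite eqn_mod_dvd ?leq_mul2l ?le ?orbT // -mulnBr Gauss_dvdr ?cop // => d.
  by apply: small => //; apply/eqP; rewrite eqn_mod_dvd.
wlog lt : i k u v i6 k6 ik ut vt / i < k => [H|].
  have [lt|gt|e] := ltngtP i k; [exact: H|rewrite -(H k i v u) //|by rewrite e eqxx in ik].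
    by apply: eq_count => cd; rewrite /= andbC.
  by rewrite eq_sym.
have U : uniq [seq (td_coord i (c, d), td_coord k (c, d)) | c <- iota 0 t, d <- iota 0 t].
  apply: (@uniq_pairs t (fun c d => td_coord i (c, d)) (fun c d => td_coord k (c, d))).
  move=> c d c' d' ct dt ct' dt'; rewrite /td_coord /= (_ : i < 5); last by lia.
  move=> e1; case: ifP => k5 e2.
    have dd : d = d'.
      apply: (mulI (k - i)) => //; first by lia.
      apply/eqP; rewrite -(eqn_modDl (c + i * d)) -addnA -mulnDl subnKC ?(ltnW lt) //.
      by rewrite -(modnDml (c + i * d)) e1 modnDml e2 -addnA -mulnDl subnKC ?(ltnW lt).
    by subst d'; split=> //; apply: (addI (i * d)).
  by subst d'; split=> //; apply: (addI (i * d)).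
have R c d : c < t -> d < t -> td_coord i (c, d) < t /\ td_coord k (c, d) < t.
  by move=> ct dt; rewrite /td_coord /=; do 2 case: ifP => _; rewrite ?ltn_pmod.
have := uniq_sum2 u v R U; rewrite ut vt /= => <-; rewrite count_flatten_map.
by apply: eq_bigr => c _; rewrite count_map count_big.
Qed.

Lemma td_mem x cd : (x \in td_block cd) = (x < n) && (td_coord (td_grp x) cd == td_off x).
Proof. by rewrite mem_filter mem_iota andbC. Qed.

(** A block meets each of the four complete groups, and each truncated one at most once. *)
Lemma td_block_size cd : cd.1 < t -> cd.2 < t -> 4 <= size (td_block cd) <= 6.
Proof.
move=> ct dt; have t0 := ltnW t1; have ub : uniq (td_block cd) by rewrite filter_uniq ?iota_uniq.
apply/andP; split; last first.
  rewrite -(size_map td_grp) -(size_iota 0 6); apply: uniq_leq_size.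
    rewrite map_inj_in_uniq // => x y; rewrite !td_mem => /andP[xn /eqP ex] /andP[yn /eqP ey] e.
    by apply: td_inj => //; rewrite -ex -ey e.
  by move=> _ /mapP[x _ ->]; rewrite mem_iota td_grp6.
rewrite -(size_iota 0 4) -(size_map (fun i => i * t + (cd.1 + i * cd.2) %% t)); apply: uniq_leq_size.
  rewrite map_inj_in_uniq ?iota_uniq // => i j _ _ e.
  have := congr1 (divn^~ t) e.
  by rewrite !divnMDl // !divn_small ?ltn_pmod // !addn0.
move=> _ /mapP[i + ->]; rewrite mem_iota => /andP[_ i4]; rewrite td_mem.
have lt4 : i * t + (cd.1 + i * cd.2) %% t < 4 * t.
  by have := ltn_pmod (cd.1 + i * cd.2) t0; nia.
rewrite /td_grp /td_off lt4 divnMDl // modnMDl modn_mod divn_small ?ltn_pmod // addn0.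
rewrite /td_coord (_ : i < 5) ?eqxx ?andbT; last by lia.
by rewrite /n; lia.
Qed.

Lemma E_td m : (forall u, 4 <= u <= 6 -> msys_F m u) ->
  (forall i, i < 6 -> E m (td_size i).+1) -> E m n.+1.
Proof.
move=> HF HE; have t0 := ltnW t1.
have [] := @pbd_frame m n _ [seq (c, d) | c <- iota 0 t, d <- iota 0 t] td_block td_grp (iota 0 6) td_size.
- by apply: allpairs_uniq; rewrite ?iota_uniq // => -[? ?] [? ?] _ _ [-> ->].
- move=> _ /allpairsP[[c d] /= [+ + ->]]; rewrite !mem_iota => ct dt.
  by split; [rewrite filter_uniq ?iota_uniq|apply: HF; apply: td_block_size].
- by move=> cd x _; rewrite td_mem => /andP[].
- move=> x y xn yn xy; have [e|ne] := eqVneq (td_grp x) (td_grp y); last first.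
    rewrite /= -[RHS](td_coord_sum (td_grp6 x) (td_grp6 y) ne (td_off_lt xn) (td_off_lt yn)).
    by apply: eq_count => cd; rewrite !td_mem xn yn.
  rewrite (eq_count (a2 := pred0)) ?count_pred0 // => cd; rewrite !td_mem xn yn /= e.
  apply/negP => /andP[/eqP e1 /eqP e2]; move/negP: xy; apply; apply/eqP.
  by apply: td_inj; rewrite // -e1 -e2.
- by move=> i; rewrite mem_iota => /td_group_size.
- by move=> x _; rewrite mem_iota td_grp6.
- exact: iota_uniq.
move=> B [BD BE]; apply: (frame_fill (iota_uniq 0 6) _ _ BD BE).
- by move=> x _; rewrite mem_iota td_grp6.
- by move=> i; rewrite mem_iota => /td_group_size.
by move=> i; rewrite mem_iota => /HE.
Qed.
End TD.

(** * The recursion on the number of labels *)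

Section Closure.
Variable m : nat.
Hypothesis mo : odd m.
Hypothesis m1 : 1 < m.
Hypothesis frames : forall u, 4 <= u <= 7 -> msys_F m u.
(** The sizes left out up to 13 are products, 9 = 3 * 3 and 12 = 3 * 4, or come from a frame, 13 = 4
    * 3 + 1. *)
Hypothesis small : forall n, n \in [:: 3; 4; 5; 6; 7; 8; 10; 11] -> E m n.

Lemma E1 : E m 1.
Proof.
rewrite /E mul0n; apply: dec_ext (dec_nil m _) => // p q.
by rewrite /Karcs /Krel; case: p.1 => [|?]; case: q.1.
Qed.

Lemma E_td_fill t a b : coprime t 2 -> coprime t 3 -> 1 < t -> a <= t -> b <= t ->
  E m t.+1 -> E m a.+1 -> E m b.+1 -> E m (4 * t + a + b).+1.
Proof.
move=> t2 t3 t1 at_ bt Et Ea Eb; apply: (E_td t2 t3 t1 at_ bt) => [u /andP[u4 u6]|i i6].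
  by apply: frames; rewrite u4 ltnW.
by rewrite /td_size; case: ifP => // _; case: ifP.
Qed.

(* 13 is the size excluded because it would need an E m 14. *)
Definition ok x := [&& x != 1 & x != 13].

(** One group is filled first. A remainder of 1 or 13 is corrected by taking back one point, and a
    single group of 13 is split as 10 + 3. *)
Lemma split_two t s : 14 < t -> s <= 2 * t -> s != 1 ->
  exists a b, [/\ a <= t, b <= t, a + b = s, ok a & ok b].
Proof.
move=> t13 st s1; rewrite /ok.
have [le|lt] := leqP s t.
  have [->|s13] := eqVneq s 13; first by exists 10, 3; split=> //; lia.
  by exists s, 0; split=> //; lia.
have [e|n1] := eqVneq (s - t) 1; first by exists t.-1, 2; split; lia.
have [e|n13] := eqVneq (s - t) 13; last by exists t, (s - t); split; lia.
by exists t.-1, 14; split; lia.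
Qed.

Theorem E_all x : 1 < x -> x != 13 -> E m x.+1.
Proof.
elim/ltn_ind: x => x IH x1 x13.
have IHok y : ok y -> y < x -> E m y.+1.
  case: y => [_ _|y]; first exact: E1.
  by rewrite /ok => /andP[y1 y13] yx; apply: IH; lia.
have td t a b : coprime t 2 -> coprime t 3 -> 1 < t -> a <= t -> b <= t -> t != 13 -> ok a -> ok b ->
    x = 4 * t + a + b -> E m x.+1.
  move=> t2 t3 t1 at_ bt t13 oa ob e; rewrite e; apply: E_td_fill => //; apply: IHok => //; last 2 first.
  - by lia.
  - by lia.
  - by rewrite /ok t13; lia.
  by lia.
have fr u g : 4 <= u <= 7 -> odd g || (g == 4) -> 1 < g -> g != 13 -> x = u * g -> E m x.+1.
  move=> u47 og g1 g13 e; rewrite e; apply: E_frame => //; [exact: frames|apply: IHok; first by rewrite /ok; lia].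
  by rewrite e; nia.
have ml a b : odd b || (b == 4) -> 2 < a -> 2 < b -> a != 14 -> b != 14 -> x.+1 = a * b -> E m x.+1.
  move=> ob a2 b2 a14 b14 e.
  have Ea : E m a.-1.+1 by apply: IHok; rewrite /ok; nia.
  have Eb : E m b.-1.+1 by apply: IHok; rewrite /ok; nia.
  rewrite (ltn_predK a2) in Ea; rewrite (ltn_predK b2) in Eb.
  by rewrite e; apply: E_mul => //; lia.
have [x76|x76] := ltnP x 76; last first.
  (* Then t = 6k + 1 is prime to 6 and 4t <= x < 4t + 24. *)
  pose k := (x - 4) %/ 24; have kx : 24 * k + 4 <= x < 24 * k + 28.
    by have := divn_eq (x - 4) 24; have := ltn_pmod (x - 4) (isT : 0 < 24); rewrite /k; lia.
  have k3 : 3 <= k by lia.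
  (* Here a single point would remain after four groups of 6k + 1, which [ok] forbids; with t = 6k -
     1 there remain 9. *)
  have [e|ne] := eqVneq x (4 * (6 * k).+1 + 1).
    have [a [b [at_ bt s oa ob]]] : exists a b, [/\ a <= (6 * k).-1, b <= (6 * k).-1, a + b = 9, ok a & ok b].
      by exists 9, 0; split=> //; lia.
    apply: (td (6 * k).-1 a b) => //; try lia.
    - by rewrite coprimen2; lia.
    - by rewrite -[6 * k]/((2 * 3) * k) coprime_sym prime_coprime //; lia.
  have [a [b [at_ bt s oa ob]]] := @split_two (6 * k).+1 (x - 4 * (6 * k).+1) ltac:(lia) ltac:(lia) ltac:(lia).
  apply: (td (6 * k).+1 a b) => //; try lia.
  - by rewrite coprimen2; lia.
  - by rewrite coprime_sym prime_coprime //; lia.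
have : x \in iota 0 76 by rewrite mem_iota.
have sm n : n \in [:: 3; 4; 5; 6; 7; 8; 10; 11] -> x.+1 = n -> E m x.+1.
  by move=> nS ->; apply: small.
rewrite /= !inE.
(* Below 76 each x takes the first construction in the list whose side conditions hold. *)
case: (ltnP x 44) => [x44|x44].
  move=> _; have : x \in iota 0 44 by rewrite mem_iota.
  rewrite !inE; do ![case/orP]; move/eqP => e; try (by rewrite e in x1 x13);
  first [by apply: (sm x.+1); rewrite // e
  | by apply: (td 5 4 0); rewrite // e | by apply: (td 5 5 0); rewrite // e | by apply: (td 5 2 0); rewrite // e
  | by apply: (td 5 0 0); rewrite // e | by apply: (td 5 3 0); rewrite // e | by apply: (td 5 4 2); rewrite // e
  | by apply: (td 5 5 2); rewrite // e | by apply: (td 5 5 3); rewrite // e | by apply: (td 5 5 4); rewrite // e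
  | by apply: (td 5 5 5); rewrite // e
  | by apply: (fr 4 3); rewrite // e | by apply: (fr 5 3); rewrite // e | by apply: (fr 6 3); rewrite // e
  | by apply: (fr 7 3); rewrite // e | by apply: (fr 4 4); rewrite // e
  | by apply: (ml 3 3); rewrite // e | by apply: (ml 3 4); rewrite // e | by apply: (ml 5 3); rewrite // e
  | by apply: (ml 6 3); rewrite // e | by apply: (ml 5 4); rewrite // e | by apply: (ml 11 4); rewrite // e
  | by apply: (td 7 (x - 28) 0); rewrite // e | by apply: (td 7 7 (x - 35)); rewrite // e
  | by apply: (td 7 5 3); rewrite // e | by apply: (td 7 6 2); rewrite // e
  | by apply: (td 5 6 (x - 26)); rewrite // e].
move=> _; have : x \in iota 44 32 by rewrite mem_iota; lia.
rewrite !inE; do ![case/orP]; move/eqP => e;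
first [by apply: (fr 5 9); rewrite // e
| by apply: (td 11 (x - 44) 0); rewrite // e | by apply: (td 11 11 (x - 55)); rewrite // e
| by apply: (td 11 10 2); rewrite // e
| by apply: (ml 17 4); rewrite // e | by apply: (ml 10 7); rewrite // e
| by apply: (td 17 (x - 68) 0); rewrite // e].
Qed.
End Closure.

(** * Eleven labels, as five pairs and one more *)

Definition avoids_pair (F : seq (seq pt)) z := ~~ has (fun p => p.1./2 == z) (flatten F).

Definition Kpair (u x y : nat) := [&& x < u.*2, y < u.*2 & x./2 != y./2].

(** Since 10 = 5 * 2 has an even second factor, lifting a frame does not give groups of size 2; this
    frame is built directly. A group of order 20 preserving the pairs develops one factor, and ten
    of its maps develop another: six factors for each of the five holes. *)
Definition strip_pairs5 : seq (seq (seq pt)) :=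
  [seq relabel g [:: [:: (4, 0); (8, 2); (4, 2); (2, 3); (8, 3)]; [:: (5, 0); (8, 0); (7, 2); (5, 2); (8, 4)]; [:: (7, 0); (8, 1); (3, 2); (7, 3); (3, 4)]; [:: (2, 0); (6, 1); (4, 1); (2, 2); (4, 4)]; [:: (6, 0); (3, 1); (6, 3); (4, 3); (3, 3)]; [:: (9, 0); (3, 0); (6, 2); (9, 2); (6, 4)]; [:: (5, 1); (2, 1); (9, 1); (5, 3); (2, 4)]; [:: (7, 1); (9, 3); (7, 4); (5, 4); (9, 4)]]
    | g <- [:: [:: 0; 1; 2; 3; 4; 5; 6; 7; 8; 9]; [:: 0; 1; 8; 9; 6; 7; 4; 5; 2; 3]; [:: 1; 0; 3; 2; 5; 4; 7; 6; 9; 8]; [:: 1; 0; 9; 8; 7; 6; 5; 4; 3; 2]; [:: 2; 3; 0; 1; 8; 9; 6; 7; 4; 5]; [:: 2; 3; 4; 5; 6; 7; 8; 9; 0; 1]; [:: 3; 2; 1; 0; 9; 8; 7; 6; 5; 4]; [:: 3; 2; 5; 4; 7; 6; 9; 8; 1; 0]; [:: 4; 5; 2; 3; 0; 1; 8; 9; 6; 7]; [:: 4; 5; 6; 7; 8; 9; 0; 1; 2; 3]; [:: 5; 4; 3; 2; 1; 0; 9; 8; 7; 6]; [:: 5; 4; 7; 6; 9; 8; 1; 0; 3; 2]; [:: 6; 7; 4; 5; 2; 3; 0; 1; 8; 9]; [:: 6; 7; 8; 9; 0; 1; 2; 3; 4; 5]; [:: 7; 6; 5; 4; 3; 2; 1;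 0; 9; 8]; [:: 7; 6; 9; 8; 1; 0; 3; 2; 5; 4]; [:: 8; 9; 0; 1; 2; 3; 4; 5; 6; 7]; [:: 8; 9; 6; 7; 4; 5; 2; 3; 0; 1]; [:: 9; 8; 1; 0; 3; 2; 5; 4; 7; 6]; [:: 9; 8; 7; 6; 5; 4; 3; 2; 1; 0]]] ++
  [seq relabel g [:: [:: (8, 0); (7, 0); (5, 2); (8, 2); (7, 3)]; [:: (4, 0); (2, 0); (4, 1); (7, 2); (2, 3)]; [:: (8, 1); (2, 1); (5, 3); (8, 3); (5, 4)]; [:: (6, 1); (2, 2); (6, 4); (9, 4); (2, 4)]; [:: (9, 0); (6, 0); (4, 2); (9, 2); (6, 3)]; [:: (5, 0); (3, 0); (5, 1); (6, 2); (3, 3)]; [:: (9, 1); (3, 1); (4, 3); (9, 3); (4, 4)]; [:: (7, 1); (3, 2); (7, 4); (8, 4); (3, 4)]]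
    | g <- [:: [:: 0; 1; 2; 3; 4; 5; 6; 7; 8; 9]; [:: 0; 1; 8; 9; 6; 7; 4; 5; 2; 3]; [:: 2; 3; 0; 1; 8; 9; 6; 7; 4; 5]; [:: 2; 3; 4; 5; 6; 7; 8; 9; 0; 1]; [:: 4; 5; 2; 3; 0; 1; 8; 9; 6; 7]; [:: 4; 5; 6; 7; 8; 9; 0; 1; 2; 3]; [:: 6; 7; 4; 5; 2; 3; 0; 1; 8; 9]; [:: 6; 7; 8; 9; 0; 1; 2; 3; 4; 5]; [:: 8; 9; 0; 1; 2; 3; 4; 5; 6; 7]; [:: 8; 9; 6; 7; 4; 5; 2; 3; 0; 1]]].

Definition rows_pairs5 : seq (seq (seq pt)) :=
  [seq relabel g (map (zip^~ (iota 0 5)) [:: [:: 7; 8; 7; 5; 2]; [:: 5; 2; 4; 7; 8]; [:: 3; 7; 5; 2; 7]; [:: 4; 6; 2; 9; 3]; [:: 2; 9; 3; 6; 4]; [:: 6; 4; 9; 3; 9]; [:: 9; 5; 6; 8; 5]; [:: 8; 3; 8; 4; 6]])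
    | g <- [:: [:: 0; 1; 2; 3; 4; 5; 6; 7; 8; 9]; [:: 1; 0; 3; 2; 5; 4; 7; 6; 9; 8]; [:: 2; 3; 4; 5; 6; 7; 8; 9; 0; 1]; [:: 3; 2; 5; 4; 7; 6; 9; 8; 1; 0]; [:: 4; 5; 6; 7; 8; 9; 0; 1; 2; 3]; [:: 5; 4; 7; 6; 9; 8; 1; 0; 3; 2]; [:: 6; 7; 8; 9; 0; 1; 2; 3; 4; 5]; [:: 7; 6; 9; 8; 1; 0; 3; 2; 5; 4]; [:: 8; 9; 0; 1; 2; 3; 4; 5; 6; 7]; [:: 9; 8; 1; 0; 3; 2; 5; 4; 7; 6]]].

Lemma pairs5_prime p : prime p -> 4 < p ->
  step_sys p (2 * p) (iota 0 5) (fun z x => (x < 10) && (x./2 != z)) (fun x y => Kpair 5 x y) all_steps.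
Proof.
move=> pp p4; apply: strip_prime => //; first by move=> x y; rewrite /Kpair eq_sym andbCA.
- have H : strip_ok true 10 6 (iota 0 5) (fun z x => (x < 10) && (x./2 != z)) (Kpair 5)
      (fun z => [seq F <- strip_pairs5 | avoids_pair F z]) by vm_compute.
  by apply: (strip_table H) => [z x /andP[]|x y /and3P[-> ->]].
have H : strip_ok false 10 2 (iota 0 5) (fun z x => (x < 10) && (x./2 != z)) (Kpair 5)
    (fun z => [seq F <- rows_pairs5 | avoids_pair F z]) by vm_compute.
by apply: (strip_table H) => [z x /andP[]|x y /and3P[-> ->]].
Qed.

Lemma E11_of_pairs m :
  step_sys m (2 * m) (iota 0 5) (fun z x => (x < 10) && (x./2 != z)) (fun x y => Kpair 5 x y) all_steps ->
  E m 3 -> E m 11.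
Proof.
move=> [B [BD BE]] E3; apply: (frame_fill (I := iota 0 5) (grp := half) (s := fun=> 2) (B := B)) => //.
- by move=> x; do 10?[case: x => [|x] //].
- by move=> i; rewrite mem_iota => /andP[_]; do 5?[case: i => [|i] //].
move=> p q; rewrite BE /Kpair /all_steps andbT mulnb /=; congr nat_of_bool; by rewrite -!andbA.
Qed.

(** * Direct tables for the prime 3 *)

(** Three columns are too few for a strip, so these tables give all column steps at once. *)
Definition sys_ok m n k I (V : nat -> pred nat) (A : rel nat) (L : nat -> seq (seq (seq pt))) : bool :=
  let D z := [seq x <- iota 0 n | V z x] in
  let grid := [seq (x, l) | x <- iota 0 n, l <- iota 0 m] in
  all (fun z => (size (L z) == k) && all (fun F => all (fun c => size c == m) F &&
     perm_eq (flatten F) [seq (x, l) | x <- D z, l <- iota 0 m]) (L z)) I &&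
  perm_by grid (larcs (flatten [seq L z | z <- I])) [seq a <- [seq (p, q) | p <- grid, q <- grid] | A a.1.1 a.2.1].

Lemma sys_table m n k I V A L : sys_ok m n k I V A L ->
  (forall z x, V z x -> x < n) -> (forall x y, A x y -> (x < n) && (y < n)) ->
  step_sys m k I V (fun x y => A x y) all_steps.
Proof.
move=> /andP[/allP H /perm_byP arc] Vn An.
exists (fun z p q => count_mem (p, q) (larcs (L z))); split.
  move=> z /H /andP[/eqP sL /allP K]; exists (L z); split=> // F /K /andP[sF /permP cF]; split=> // -[v l].
  rewrite cF count_uniq_mem; last first.
    by apply: allpairs_uniq; rewrite ?filter_uniq ?iota_uniq // => -[? ?] [? ?] _ _ [-> ->].
  rewrite /bl; congr nat_of_bool; apply/allpairsP/andP => [[[x i] /=]|[Vv lm]].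
    by rewrite mem_filter mem_iota => -[/andP[Vx _] im [-> ->]]; rewrite Vx; split=> //; move: im; rewrite mem_iota.
  by exists (v, l); rewrite mem_filter [V z _]Vv !mem_iota; split=> //; apply: Vn Vv.
move=> p q; transitivity (count_mem (p, q) (larcs (flatten [seq L z | z <- I]))).
  elim: (I) => [|z r IH]; first by rewrite big_nil.
  by rewrite big_cons IH /= larcs_cat count_cat.
have ug : uniq [seq (x, l) | x <- iota 0 n, l <- iota 0 m].
  by apply: allpairs_uniq; rewrite ?iota_uniq // => -[? ?] [? ?] _ _ [-> ->].
rewrite (permP arc) count_uniq_mem; last first.
  by apply: filter_uniq; apply: allpairs_uniq => // -[? ?] [? ?] _ _ [-> ->].
rewrite mem_filter /= andbT mulnb; congr nat_of_bool; case Aa: (A _ _) => //=.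
have /andP[pn qn] := An _ _ Aa; apply/allpairsP/andP => [[[[x i] [y j]] /= [+ + [-> ->]]]|[pm qm]].
  by move=> /allpairsP[[? ?] /= [_ + [_ ->]]] /allpairsP[[? ?] /= [_ + [_ ->]]]; rewrite !mem_iota.
exists (p, q); split=> //; apply/allpairsP; first by exists p; rewrite !mem_iota; case: (p) pn pm.
by exists q; rewrite !mem_iota; case: (q) qn qm.
Qed.

Lemma E_sys_table m n L :
  sys_ok m n (n.-1 * m) [:: 0] (fun _ x => x < n) (Krel n) (fun=> L) -> msys_E m n.
Proof. by move=> H; apply: (sys_table H) => // x y /and3P[-> ->]. Qed.

Lemma F_sys_table m n L :
  sys_ok m n m (iota 0 n) (fun z x => (x < n) && (x != z)) (Krel n) (fun z => [seq F <- L | avoids F z]) ->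
  msys_F m n.
Proof. by move=> H; apply: (sys_table H) => [z x /andP[]|x y /and3P[-> ->]]. Qed.

Definition turns (G : seq (seq nat)) (S : seq nat) (B : seq (seq (seq pt))) : seq (seq (seq pt)) :=
  flatten [seq [seq map (map (fun q => (nth 0 g q.1, (q.2 + s) %% 3))) F | g <- G, s <- S] | F <- B].

Definition cyc_shifts u n : seq (seq nat) := [seq rot i (iota 0 u) ++ iota u (n - u) | i <- iota 0 u].

Lemma E3_3 : msys_E 3 3.
Proof.
by apply: (E_sys_table (L := turns [:: iota 0 3] [:: 0]
  [:: [:: [:: (0, 0); (1, 0); (2, 0)]; [:: (0, 1); (1, 1); (2, 1)]; [:: (0, 2); (1, 2); (2, 2)]];
      [:: [:: (0, 0); (1, 1); (2, 2)]; [:: (0, 1); (1, 2); (2, 0)]; [:: (0, 2); (1, 0); (2, 1)]];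
      [:: [:: (0, 0); (1, 2); (2, 1)]; [:: (0, 1); (1, 0); (2, 2)]; [:: (0, 2); (1, 1); (2, 0)]];
      [:: [:: (2, 0); (1, 0); (0, 0)]; [:: (2, 1); (1, 1); (0, 1)]; [:: (2, 2); (1, 2); (0, 2)]];
      [:: [:: (2, 2); (1, 1); (0, 0)]; [:: (2, 0); (1, 2); (0, 1)]; [:: (2, 1); (1, 0); (0, 2)]];
      [:: [:: (2, 1); (1, 2); (0, 0)]; [:: (2, 2); (1, 0); (0, 1)]; [:: (2, 0); (1, 1); (0, 2)]]])); vm_compute.
Qed.

Lemma E4_3 : msys_E 3 4.
Proof.
by apply: (E_sys_table (L := turns (cyc_shifts 3 4) [:: 0]
  [:: [:: [:: (0, 1); (1, 0); (3, 2)]; [:: (1, 1); (3, 0); (2, 1)]; [:: (0, 2); (2, 0); (1, 2)]; [:: (0, 0); (3, 1); (2, 2)]];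
      [:: [:: (0, 2); (1, 1); (2, 1)]; [:: (1, 0); (2, 0); (3, 0)]; [:: (0, 1); (2, 2); (3, 1)]; [:: (0, 0); (1, 2); (3, 2)]];
      [:: [:: (0, 2); (2, 1); (3, 2)]; [:: (1, 2); (2, 2); (3, 0)]; [:: (0, 0); (1, 1); (3, 1)]; [:: (0, 1); (2, 0); (1, 0)]]])); vm_compute.
Qed.

Lemma E5_3 : msys_E 3 5.
Proof.
by apply: (E_sys_table (L := turns (cyc_shifts 4 5) [:: 0]
  [:: [:: [:: (0, 2); (4, 2); (2, 2)]; [:: (0, 0); (1, 2); (3, 1)]; [:: (0, 1); (1, 1); (3, 2)]; [:: (2, 1); (4, 0); (3, 0)]; [:: (1, 0); (4, 1); (2, 0)]];
      [:: [:: (2, 2); (3, 2); (4, 0)]; [:: (0, 2); (2, 0); (3, 1)]; [:: (0, 0); (2, 1); (1, 2)]; [:: (0, 1); (4, 1); (1, 1)]; [:: (1, 0); (3, 0); (4, 2)]];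
      [:: [:: (0, 2); (4, 1); (1, 2)]; [:: (0, 0); (1, 0); (3, 2)]; [:: (1, 1); (3, 0); (2, 2)]; [:: (2, 0); (4, 0); (3, 1)]; [:: (0, 1); (2, 1); (4, 2)]]])); vm_compute.
Qed.

Lemma E6_3 : msys_E 3 6.
Proof.
by apply: (E_sys_table (L := turns (cyc_shifts 5 6) (iota 0 3)
  [:: [:: [:: (2, 0); (5, 2); (4, 1)]; [:: (0, 0); (3, 0); (4, 2)]; [:: (1, 2); (5, 0); (3, 1)]; [:: (1, 1); (5, 1); (2, 1)]; [:: (0, 1); (2, 2); (3, 2)]; [:: (0, 2); (4, 0); (1, 0)]]])); vm_compute.
Qed.

Lemma E7_3 : msys_E 3 7.
Proof.
by apply: (E_sys_table (L := turns (cyc_shifts 6 7) (iota 0 3)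
  [:: [:: [:: (2, 0); (5, 1); (4, 1)]; [:: (4, 2); (6, 0); (5, 0)]; [:: (0, 0); (4, 0); (3, 1)]; [:: (0, 1); (2, 2); (6, 2)]; [:: (1, 1); (2, 1); (3, 0)]; [:: (0, 2); (1, 0); (3, 2)]; [:: (1, 2); (6, 1); (5, 2)]]])); vm_compute.
Qed.

Lemma E8_3 : msys_E 3 8.
Proof.
by apply: (E_sys_table (L := turns (cyc_shifts 7 8) (iota 0 3)
  [:: [:: [:: (0, 1); (6, 2); (1, 2)]; [:: (3, 0); (6, 1); (7, 2)]; [:: (1, 0); (4, 2); (7, 1)]; [:: (4, 0); (5, 0); (7, 0)]; [:: (0, 0); (5, 2); (2, 2)]; [:: (0, 2); (2, 0); (3, 1)]; [:: (1, 1); (4, 1); (2, 1)]; [:: (3, 2); (5, 1); (6, 0)]]])); vm_compute.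
Qed.

Lemma E10_3 : msys_E 3 10.
Proof.
by apply: (E_sys_table (L := turns (cyc_shifts 9 10) (iota 0 3)
  [:: [:: [:: (2, 1); (7, 2); (8, 1)]; [:: (0, 0); (1, 0); (7, 1)]; [:: (0, 1); (4, 0); (5, 1)]; [:: (2, 0); (8, 2); (4, 2)]; [:: (1, 2); (3, 2); (5, 0)]; [:: (6, 0); (9, 0); (7, 0)]; [:: (0, 2); (3, 1); (2, 2)]; [:: (3, 0); (6, 1); (9, 2)]; [:: (1, 1); (5, 2); (4, 1)]; [:: (6, 2); (9, 1); (8, 0)]]])); vm_compute.
Qed.

Lemma E11_3 : msys_E 3 11.
Proof.
by apply: (E_sys_table (L := turns (cyc_shifts 10 11) (iota 0 3)
  [:: [:: [:: (0, 1); (7, 2); (2, 0)]; [:: (1, 0); (5, 2); (9, 2)]; [:: (0, 0); (10, 0); (3, 0)]; [:: (2, 1); (9, 0); (3, 1)]; [:: (1, 1); (4, 2); (6, 1)]; [:: (3, 2); (8, 1); (7, 0)]; [:: (7, 1); (9, 1); (10, 2)]; [:: (4, 0); (5, 1); (6, 0)]; [:: (5, 0); (8, 0); (6, 2)]; [:: (2, 2); (8, 2); (10, 1)]; [:: (0, 2); (1, 2); (4, 1)]]])); vm_compute.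
Qed.

(** For m = 3 the passage through pairs of labels would meet the exception (2, 3), hence a direct
    table for 14 labels. *)
Lemma E14_3 : msys_E 3 14.
Proof.
by apply: (E_sys_table (L := turns (cyc_shifts 13 14) (iota 0 3)
  [:: [:: [:: (4, 0); (12, 2); (9, 0)]; [:: (0, 2); (1, 2); (2, 1)]; [:: (1, 1); (3, 2); (10, 0)]; [:: (0, 0); (7, 0); (13, 2)]; [:: (2, 2); (4, 1); (11, 0)]; [:: (0, 1); (9, 2); (12, 0)]; [:: (2, 0); (5, 2); (3, 1)]; [:: (5, 0); (11, 2); (10, 2)]; [:: (4, 2); (13, 0); (7, 2)]; [:: (1, 0); (6, 2); (8, 2)]; [:: (3, 0); (8, 0); (7, 1)]; [:: (6, 0); (11, 1); (9, 1)]; [:: (6, 1); (13, 1); (10, 1)]; [:: (5, 1); (8, 1); (12, 1)]]])); vm_compute.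
Qed.

Lemma frame4_3 : msys_F 3 4.
Proof.
by apply: (F_sys_table (L := turns [:: [:: 0; 1; 2; 3]; [:: 1; 0; 3; 2]; [:: 2; 3; 0; 1]; [:: 3; 2; 1; 0]] [:: 0]
  [:: [:: [:: (1, 0); (2, 0); (3, 0)]; [:: (1, 2); (2, 1); (3, 1)]; [:: (1, 1); (2, 2); (3, 2)]];
      [:: [:: (1, 1); (3, 0); (2, 1)]; [:: (1, 0); (3, 1); (2, 2)]; [:: (1, 2); (3, 2); (2, 0)]];
      [:: [:: (1, 2); (3, 0); (2, 2)]; [:: (1, 1); (3, 1); (2, 0)]; [:: (1, 0); (3, 2); (2, 1)]]])); vm_compute.
Qed.

Lemma frame5_3 : msys_F 3 5.
Proof.
by apply: (F_sys_table (L := turns (cyc_shifts 5 5) (iota 0 3)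
  [:: [:: [:: (1, 0); (3, 0); (4, 1)]; [:: (1, 1); (4, 0); (2, 0)]; [:: (1, 2); (2, 2); (3, 1)]; [:: (2, 1); (4, 2); (3, 2)]]])); vm_compute.
Qed.

Lemma frame7_3 : msys_F 3 7.
Proof.
by apply: (F_sys_table (L := turns (cyc_shifts 7 7) (iota 0 3)
  [:: [:: [:: (2, 2); (5, 1); (6, 1)]; [:: (1, 1); (6, 0); (3, 1)]; [:: (1, 2); (4, 2); (2, 0)]; [:: (3, 2); (5, 0); (6, 2)]; [:: (3, 0); (5, 2); (4, 0)]; [:: (1, 0); (2, 1); (4, 1)]]])); vm_compute.
Qed.

Lemma frame6_3 : msys_F 3 6.
Proof.
by apply: (F_sys_table (L := turns [:: rot 0 (iota 0 6); rot 2 (iota 0 6); rot 4 (iota 0 6)] (iota 0 3)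
  [:: [:: [:: (3, 2); (4, 0); (5, 1)]; [:: (1, 1); (2, 1); (5, 0)]; [:: (1, 2); (5, 2); (4, 1)]; [:: (2, 2); (4, 2); (3, 1)]; [:: (1, 0); (3, 0); (2, 0)]];
      [:: [:: (0, 1); (5, 2); (3, 1)]; [:: (2, 0); (3, 2); (5, 1)]; [:: (0, 0); (3, 0); (4, 2)]; [:: (0, 2); (4, 1); (2, 2)]; [:: (2, 1); (4, 0); (5, 0)]]])); vm_compute.
Qed.

(** * Assembling the case of odd m, and fourteen labels *)

Lemma E_cols m n g : odd m -> 1 < m -> odd g -> msys_E m n -> E (m * g) n.
Proof.
move=> mo m1 go /(step_sys_cols mo m1 go) H; apply: E_of_sys.
by apply: step_sys_ext H => //; rewrite mulnA.
Qed.

Lemma prime_part m : odd m -> 2 < m -> exists p g, [/\ m = p * g, prime p, odd p, 2 < p & odd g].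
Proof.
move=> mo m2; have pp : prime (pdiv m) by apply: pdiv_prime; lia.
have e : m = pdiv m * (m %/ pdiv m) by rewrite mulnC divnK ?pdiv_dvd.
exists (pdiv m), (m %/ pdiv m); move: mo; rewrite {1}e oddM => /andP[po go].
by split=> //; rewrite odd_prime_gt2.
Qed.

Lemma frames_odd m u : odd m -> 2 < m -> 4 <= u <= 7 -> msys_F m u.
Proof.
move=> mo /(prime_part mo) [p [g [-> pp po p2 go]]] u47; have p1 : 1 < p by lia.
rewrite /msys_F; apply: (step_sys_cols po p1 go).
have : u \in [:: 4; 5; 6; 7] by rewrite !inE; lia.
have [->|p3] := eqVneq p 3.
  by rewrite !inE => /or4P[]/eqP->; [exact: frame4_3|exact: frame5_3|exact: frame6_3|exact: frame7_3].
have p4 : 4 < p by case: (p) po p2 p3 => [|[|[|[|[|]]]]].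
by rewrite !inE => /or4P[]/eqP->; [exact: frame4_prime|exact: frame5_prime|exact: frame6_prime|exact: frame7_prime].
Qed.

Lemma small_odd m n : odd m -> 2 < m -> n \in [:: 3; 4; 5; 6; 7; 8; 10; 11] -> E m n.
Proof.
move=> mo /(prime_part mo) [p [g [-> pp po p2 go]]]; have p1 : 1 < p by lia.
have C n' := @E_cols p n' g po p1 go.
have [->|p3] := eqVneq p 3.
  rewrite !inE; do 7?[case/orP]; move/eqP=> ->; apply: E_cols => //;
  [exact: E3_3|exact: E4_3|exact: E5_3|exact: E6_3|exact: E7_3|exact: E8_3|exact: E10_3|exact: E11_3].
have p4 : 4 < p by case: (p) po p2 p3 => [|[|[|[|[|]]]]].
rewrite !inE; do 7?[case/orP]; move/eqP=> ->;
  try by [apply/C/E3_prime|apply/C/E4_prime|apply/C/E5_prime|apply/C/E6_prime|apply/C/E7_prime|apply/C/E8_prime|apply/C/E10_prime].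
apply: E11_of_pairs; last by apply/C/E3_prime.
by have := step_sys_cols po p1 go (pairs5_prime pp p4); rewrite mulnA.
Qed.

(** Base cycles are first completed to a factor by the maps [s], and this factor is then developed
    by the maps [g]: 21 + 6 + 6 + 3 = 36 = 3 * 12 factors. *)
Definition strip_pairs7 : seq (seq (seq pt)) :=
  flatten [::
    [seq relabel g (flatten [seq relabel s [:: [:: (0, 1); (4, 3); (13, 4); (0, 4); (4, 4)]; [:: (2, 1); (4, 1); (9, 1); (2, 3); (9, 4)]; [:: (3, 1); (5, 1); (10, 2); (3, 4); (5, 4)]; [:: (6, 0); (10, 0); (8, 1); (6, 3); (10, 3)]; [:: (4, 0); (0, 2); (4, 2); (9, 2); (0, 3)]; [:: (2, 0); (8, 0); (1, 0); (2, 2); (8, 4)]; [:: (3, 0); (12, 2); (8, 2); (12, 3); (8, 3)]] | s <- [:: [:: 0; 1; 2; 3; 4; 5; 6; 7; 8; 9; 10; 11; 12; 13]; [:: 1; 0; 13; 12; 11; 10; 9; 8; 7; 6; 5; 4; 3; 2]]])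
      | g <- [:: [:: 0; 1; 2; 3; 4; 5; 6; 7; 8; 9; 10; 11; 12; 13]; [:: 0; 1; 4; 5; 8; 9; 12; 13; 2; 3; 6; 7; 10; 11]; [:: 0; 1; 8; 9; 2; 3; 10; 11; 4; 5; 12; 13; 6; 7]; [:: 2; 3; 4; 5; 6; 7; 8; 9; 10; 11; 12; 13; 0; 1]; [:: 2; 3; 6; 7; 10; 11; 0; 1; 4; 5; 8; 9; 12; 13]; [:: 2; 3; 10; 11; 4; 5; 12; 13; 6; 7; 0; 1; 8; 9]; [:: 4; 5; 6; 7; 8; 9; 10; 11; 12; 13; 0; 1; 2; 3]; [:: 4; 5; 8; 9; 12; 13; 2; 3; 6; 7; 10; 11; 0; 1]; [:: 4; 5; 12; 13; 6; 7; 0; 1; 8; 9; 2; 3; 10; 11]; [:: 6; 7; 0; 1; 8; 9; 2; 3; 10; 11; 4; 5; 12; 13]; [:: 6; 7; 8; 9; 10; 11; 12; 13; 0; 1; 2; 3; 4; 5]; [:: 6; 7; 10; 11; 0; 1; 4; 5; 8; 9; 12; 13; 2; 3]; [:: 8; 9; 2; 3; 10; 11; 4; 5; 12; 13; 6; 7; 0; 1]; [:: 8; 9; 10; 11; 12; 13; 0; 1; 2; 3; 4; 5; 6; 7]; [:: 8; 9; 12; 13; 2; 3; 6; 7; 10; 11; 0; 1; 4; 5]; [:: 10; 11; 0; 1; 4; 5; 8; 9; 12; 13; 2; 3; 6; 7]; [:: 10; 11; 4; 5; 12; 13; 6; 7; 0; 1; 8; 9; 2; 3]; [:: 10; 11;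 12; 13; 0; 1; 2; 3; 4; 5; 6; 7; 8; 9]; [:: 12; 13; 0; 1; 2; 3; 4; 5; 6; 7; 8; 9; 10; 11]; [:: 12; 13; 2; 3; 6; 7; 10; 11; 0; 1; 4; 5; 8; 9]; [:: 12; 13; 6; 7; 0; 1; 8; 9; 2; 3; 10; 11; 4; 5]]];
    [seq relabel g (flatten [seq relabel s [:: [:: (0, 0); (3, 0); (13, 2); (0, 3); (13, 3)]; [:: (1, 1); (2, 1); (12, 2); (1, 4); (12, 4)]] | s <- [:: [:: 0; 1; 2; 3; 4; 5; 6; 7; 8; 9; 10; 11; 12; 13]; [:: 2; 3; 4; 5; 6; 7; 8; 9; 10; 11; 12; 13; 0; 1]; [:: 4; 5; 6; 7; 8; 9; 10; 11; 12; 13; 0; 1; 2; 3]; [:: 6; 7; 8; 9; 10; 11; 12; 13; 0; 1; 2; 3; 4; 5]; [:: 8; 9; 10; 11; 12; 13; 0; 1; 2; 3; 4; 5; 6; 7]; [:: 10; 11; 12; 13; 0; 1; 2; 3; 4; 5; 6; 7; 8; 9]; [:: 12; 13; 0; 1; 2; 3; 4; 5; 6; 7; 8; 9; 10; 11]]])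
      | g <- [:: [:: 0; 1; 2; 3; 4; 5; 6; 7; 8; 9; 10; 11; 12; 13]; [:: 0; 1; 4; 5; 8; 9; 12; 13; 2; 3; 6; 7; 10; 11]; [:: 0; 1; 8; 9; 2; 3; 10; 11; 4; 5; 12; 13; 6; 7]; [:: 1; 0; 7; 6; 13; 12; 5; 4; 11; 10; 3; 2; 9; 8]; [:: 1; 0; 11; 10; 7; 6; 3; 2; 13; 12; 9; 8; 5; 4]; [:: 1; 0; 13; 12; 11; 10; 9; 8; 7; 6; 5; 4; 3; 2]]];
    [seq relabel g (flatten [seq relabel s [:: [:: (1, 0); (6, 1); (1, 3); (6, 3); (2, 4)]; [:: (0, 0); (7, 1); (0, 2); (7, 2); (3, 4)]] | s <- [:: [:: 0; 1; 2; 3; 4; 5; 6; 7; 8; 9; 10; 11; 12; 13]; [:: 2; 3; 4; 5; 6; 7; 8; 9; 10; 11; 12; 13; 0; 1]; [:: 4; 5; 6; 7; 8; 9; 10; 11; 12; 13; 0; 1; 2; 3]; [:: 6; 7; 8; 9; 10; 11; 12; 13; 0; 1; 2; 3; 4; 5]; [:: 8; 9; 10; 11; 12; 13; 0; 1; 2; 3; 4; 5; 6; 7]; [:: 10; 11; 12; 13; 0; 1; 2; 3; 4; 5; 6; 7; 8; 9]; [:: 12; 13; 0; 1; 2; 3; 4; 5; 6; 7; 8; 9; 10; 11]]])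
      | g <- [:: [:: 0; 1; 2; 3; 4; 5; 6; 7; 8; 9; 10; 11; 12; 13]; [:: 0; 1; 4; 5; 8; 9; 12; 13; 2; 3; 6; 7; 10; 11]; [:: 0; 1; 8; 9; 2; 3; 10; 11; 4; 5; 12; 13; 6; 7]; [:: 1; 0; 7; 6; 13; 12; 5; 4; 11; 10; 3; 2; 9; 8]; [:: 1; 0; 11; 10; 7; 6; 3; 2; 13; 12; 9; 8; 5; 4]; [:: 1; 0; 13; 12; 11; 10; 9; 8; 7; 6; 5; 4; 3; 2]]];
    [seq relabel g (flatten [seq relabel s [:: [:: (0, 0); (2, 1); (4, 2); (0, 3); (2, 4)]] | s <- [:: [:: 0; 1; 2; 3; 4; 5; 6; 7; 8; 9; 10; 11; 12; 13]; [:: 1; 0; 13; 12; 11; 10; 9; 8; 7; 6; 5; 4; 3; 2]; [:: 2; 3; 4; 5; 6; 7; 8; 9; 10; 11; 12; 13; 0; 1]; [:: 3; 2; 1; 0; 13; 12; 11; 10; 9; 8; 7; 6; 5; 4]; [:: 4; 5; 6; 7; 8; 9; 10; 11; 12; 13; 0; 1; 2; 3]; [:: 5; 4; 3; 2; 1; 0; 13; 12; 11; 10; 9; 8; 7; 6]; [:: 6; 7; 8; 9; 10; 11; 12; 13; 0; 1; 2; 3; 4; 5]; [:: 7; 6; 5; 4; 3; 2; 1; 0; 13; 12; 11; 10; 9; 8]; [:: 8; 9; 10; 11; 12; 13; 0; 1; 2; 3; 4; 5; 6; 7]; [:: 9; 8; 7; 6; 5; 4; 3; 2; 1; 0; 13;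 12; 11; 10]; [:: 10; 11; 12; 13; 0; 1; 2; 3; 4; 5; 6; 7; 8; 9]; [:: 11; 10; 9; 8; 7; 6; 5; 4; 3; 2; 1; 0; 13; 12]; [:: 12; 13; 0; 1; 2; 3; 4; 5; 6; 7; 8; 9; 10; 11]; [:: 13; 12; 11; 10; 9; 8; 7; 6; 5; 4; 3; 2; 1; 0]]])
      | g <- [:: [:: 0; 1; 2; 3; 4; 5; 6; 7; 8; 9; 10; 11; 12; 13]; [:: 0; 1; 4; 5; 8; 9; 12; 13; 2; 3; 6; 7; 10; 11]; [:: 0; 1; 8; 9; 2; 3; 10; 11; 4; 5; 12; 13; 6; 7]]]].

(** The labels are reordered as Z_14 so that the two members of a pair differ by 7; each base cycle
    is developed by all 14 translations. *)
Definition rows_pairs7 : seq (seq (seq pt)) :=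
  [seq [seq [seq (nth 0 [:: 0; 3; 4; 7; 8; 11; 12; 1; 2; 5; 6; 9; 10; 13] ((a.1 + x) %% 14), a.2) | a <- zip c (iota 0 5)] | x <- iota 0 14]
    | c <- [:: [:: 0; 1; 4; 6; 5]; [:: 0; 2; 1; 10; 12]; [:: 0; 3; 13; 9; 10]; [:: 0; 4; 9; 1; 11]; [:: 0; 5; 0; 12; 1]; [:: 0; 6; 0; 5; 2]; [:: 0; 8; 5; 8; 3]; [:: 0; 9; 11; 12; 4]; [:: 0; 10; 11; 5; 9]; [:: 0; 11; 3; 0; 8]; [:: 0; 12; 2; 1; 13]; [:: 0; 13; 11; 1; 6]]].

Lemma full_table p n k (K : rel nat) Lt Lf :
  strip_ok true n (3 * k) [:: 0] (fun _ x => x < n) K (fun=> Lt) ->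
  strip_ok false n k [:: 0] (fun _ x => x < n) K (fun=> Lf) ->
  (forall x y, K x y = K y x) -> (forall x y, K x y -> (x < n) && (y < n)) ->
  prime p -> 4 < p -> step_sys p (k * p) [:: 0] (fun _ x => x < n) (fun x y => K x y) all_steps.
Proof.
move=> Ht Hf KC Kn pp p4; apply: strip_prime => //; first by move=> x y; rewrite KC.
- exact: (strip_table Ht).
exact: (strip_table Hf).
Qed.

Lemma pairs7_prime p : prime p -> 4 < p ->
  step_sys p (12 * p) [:: 0] (fun _ x => x < 14) (fun x y => Kpair 7 x y) all_steps.
Proof.
apply: (full_table (Lt := strip_pairs7) (Lf := rows_pairs7)).
- by vm_compute.
- by vm_compute.
- by move=> x y; rewrite /Kpair eq_sym andbCA.
by move=> x y /and3P[-> ->].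
Qed.

(** In contrast to [frame_fill] no label is added, the factors between groups cover everything, and
    the groups receive all their arcs, including those inside a label. *)
Lemma fill_groups m K r n c s (grp : nat -> nat) A : 0 < m ->
  (forall x, x < n -> grp x < c) ->
  (forall i, i < c -> size [seq x <- iota 0 n | grp x == i] = s) ->
  dec m K (bl (fun x => x < n) m) A ->
  (forall p q, A p q = [&& p.1 < n, q.1 < n, grp p.1 != grp q.1, p.2 < m & q.2 < m]) ->
  dec m r (fun x => x < s * m) (Kstar (s * m)) ->
  dec m (K + r) (fun x => x < n * m) (Kstar (n * m)).
Proof.
move=> m0 gc sz DA AE Ds; apply: dec_flat => //.
pose blk i := [seq x <- iota 0 n | grp x == i].
have mblk i x : (x \in blk i) = (grp x == i) && (x < n) by rewrite mem_filter mem_iota.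
have D2 : dec m r (fun p => has (fun i => bl (mem (blk i)) m p) (iota 0 c))
    (fun p q => \sum_(i <- iota 0 c) Kbl (mem (blk i)) m p q).
  apply: dec_bigunion; first exact: iota_uniq.
    move=> i j [x l] _ _; rewrite /bl /= !mblk => /andP[/andP[/eqP <- _] _] /andP[/andP[/eqP <- _] _] //.
  move=> i; rewrite mem_iota => /andP[_ ic]; apply: dec_place => //; first by rewrite filter_uniq ?iota_uniq.
  by rewrite sz.
have D2' : dec m r (bl (fun x => x < n) m) (fun p q => \sum_(i <- iota 0 c) Kbl (mem (blk i)) m p q).
  apply: dec_ext D2 => // -[x l]; rewrite /bl /=; apply/hasP/andP => [[i]|[xn lm]].
    by rewrite mblk => _ /andP[/andP[_ ->] ->].
  by exists (grp x); rewrite ?mem_iota ?gc // mblk eqxx xn.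
apply: dec_ext (dec_add DA D2') => // -[x l] [y l']; rewrite AE /Kbl /bl /=.
have [xn|xn] := ltnP x n; last by rewrite big1 // => i _; rewrite !mblk ltnNge xn /= andbF.
rewrite (bigD1_seq (grp x)) ?mem_iota ?gc ?iota_uniq //= big1 => [|i]; last first.
  by rewrite eq_sym !mblk => /negPf ->.
rewrite addn0 !mblk eqxx xn /=; case: (l < m); last by rewrite !andbF.
case: (l' < m); last by rewrite !andbF.
rewrite !andbT /= [grp y == _]eq_sym; case: (y < n); last by rewrite /= !andbF.
rewrite /= andbT; case: eqP => //= ne; rewrite (_ : (x, l) != (y, l')) //.
by apply/eqP => -[e _]; rewrite e in ne.
Qed.

Lemma R_of_E m a : odd m -> 2 < m -> 0 < a -> E m a ->
  dec m (a * m).-1 (fun x => x < a * m) (Kstar (a * m)).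
Proof.
move=> mo m2 a0 Ea; have m0 : 0 < m by lia.
have -> : (a * m).-1 = a.-1 * m + m.-1 by nia.
apply: (@fill_groups m _ _ a a 1 id _ m0 _ _ Ea) => // [i ia|p q|].
- by rewrite size_filter -/(count_mem i _) count_uniq_mem ?iota_uniq // mem_iota ia.
- by rewrite /Karcs /Krel mulnb -!andbA.
rewrite mul1n; apply: ham => //; apply/eqP => e; by rewrite e in mo.
Qed.

Lemma R14 m : odd m -> 2 < m -> dec m (14 * m).-1 (fun x => x < 14 * m) (Kstar (14 * m)).
Proof.
move=> mo m2; have [p [g [em pp po p2 go]]] := prime_part mo m2; have p1 : 1 < p by lia.
have [p3|p3] := eqVneq p 3.
  by apply: R_of_E => //; rewrite em p3; apply: E_cols => //; exact: E14_3.
have p4 : 4 < p by case: (p) po p2 p3 => [|[|[|[|[|]]]]].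
have [B [BD BE]] := step_sys_cols po p1 go (pairs7_prime pp p4); rewrite -em in BD BE.
have m4 : 4 < m by rewrite em (leq_trans p4) // leq_pmulr //; case: (g) go.
(* 12m factors between the pairs of labels and 2m - 1 inside them, the latter from [two_groups]. *)
have -> : (14 * m).-1 = 12 * p * g + (2 * m).-1 by rewrite -mulnA -em; lia.
apply: (@fill_groups m _ _ 14 7 2 half (B 0)) => //; first lia.
- by do 14?[case=> [|] //].
- by do 7?[case=> [|] //].
- exact: BD (mem_head _ _).
- by move=> q r; have := BE q r; rewrite big_seq1 /Kpair /all_steps andbT mulnb => ->; rewrite -!andbA.
have e : m = (2 * m./2).+1 by have := odd_double_half m; rewrite mo; lia.
have h1 : 1 < m./2 by lia.
have e2 : (4 * m./2).+1 = (2 * m).-1 by lia.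
by have := two_groups h1; rewrite -e e2 (@prednK (2 * m)) //; lia.
Qed.

(** * The case m = 4 *)

Lemma cyc_off_close_id g i j : 0 < g ->
  \sum_(t <- iota 0 g) \sum_(r <- iota 0 g) ((cyc_off g 1 t r == i) && (r == j))
    = (i < g) && (j < g).
Proof.
move=> g0; apply: uniq_sum2 => [t r tg rg|]; first by rewrite /cyc_off /= ltn_pmod.
apply: uniq_pairs => t r t' r' tg rg tg' rg'; rewrite /cyc_off /= => e1 er; split=> //; subst r'.
by move/eqP: e1; rewrite eqn_modDl => /eqP; rewrite !modn_small.
Qed.

Lemma dec_edges_lift (T : eqType) (V : pred T) A k g : 0 < g -> dec 2 k V A ->
  dec 2 (k * g) (fun q : T * nat => V q.1 && (q.2 < g))
    (fun q q' => A q.1 q'.1 * ((q.2 < g) && (q'.2 < g))).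
Proof.
move=> g0; apply: (dec_parallel (f := cyc_off g) (cl := id)) => //.
- by move=> n t i; apply: cyc_off_sum.
- by move=> a b i j; apply: cyc_off_adj.
by move=> i j; apply: cyc_off_close_id.
Qed.

(** Each 2-cycle is first lifted to h parallel copies and only then wound twice, so that 2h points
    per vertex give cycles of length 4 and not 4h. *)
Lemma blow4 h k V A : 0 < h -> dec 2 k V A -> dec 4 (k * (2 * h)) (bl V (2 * h)) (blift A (2 * h)).
Proof.
move=> h0 D0; have /(dec_edges (isT : 0 < 2)) := dec_edges_lift h0 D0; rewrite -mulnA [h * 2]mulnC.
apply: (dec_map (f := fun q : nat * nat * nat => (q.1.1, q.1.2 * 2 + q.2))).
- move=> [[x l] r] [[y l'] r']; rewrite !unfold_in /= => /andP[_ rg] /andP[_ rg'] [-> e].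
  have := congr1 (divn^~ 2) e; rewrite !divnMDl // !divn_small // !addn0 => ->.
  by have := congr1 (modn^~ 2) e; rewrite !modnMDl !modn_small // => ->.
- by move=> [[x l] r]; rewrite /bl /= => /andP[/andP[-> lp] rg] /=; lia.
- move=> [x l]; rewrite /bl /= => /andP[Vx lp]; exists ((x, l %/ 2), l %% 2); last by rewrite /= -divn_eq.
  by rewrite /= ltn_pmod // Vx ltn_divLR // mulnC lp.
- move=> [[x l] r] [[y l'] r']; rewrite /blift /= => /andP[/andP[_ lh] rg] /andP[/andP[_ lh'] rg'].
  by rewrite rg rg' lh lh' !muln1 (_ : _ && _ = true) ?muln1 //; lia.
move=> [x l] [y l']; rewrite /blift /bl /= => nz.
have [AV /andP[-> ->]] : A x y != 0 /\ (l < 2 * h) && (l' < 2 * h).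
  by move: nz; case: (_ && _); rewrite ?muln0 // muln1.
rewrite !andbT; exact: dec_supp D0 AV.
Qed.

(* A frame of K*_v with groups of t consecutive points, in matchings. *)
Definition frame2 u t := exists B : nat -> nat -> nat -> nat,
  (forall z, z < u -> dec 2 t (fun x => (x < u * t) && (x %/ t != z)) (B z)) /\
  forall x y, \sum_(z <- iota 0 u) B z x y = [&& x < u * t, y < u * t & x %/ t != y %/ t].

Lemma frame2_odd u : odd u -> frame2 u 1.
Proof.
move=> ou; have u0 : 0 < u by case: u ou.
(* The colour in which z is joined to infinity; without infinity this matching misses z alone. *)
pose c z := if z.*2 < u then z.*2 else z.*2 - u.
have cu z : z < u -> c z < u by rewrite /c; case: ifP; lia.
have muz z : z < u -> mate u (c z) u = z by move=> zu; rewrite /mate eqxx /c; casesif; lia.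
have mz z : z < u -> mate u (c z) z = u.
  by move=> zu; have /and3P[_ _ /eqP] := mateP ou (cu z zu) (leqnn u); rewrite muz.
have near z x : z < u -> x < u -> x != z ->
    [&& mate u (c z) x < u, mate u (c z) x != z, mate u (c z) x != x & mate u (c z) (mate u (c z) x) == x].
  move=> zu xu xz; have /and3P[mN nm /eqP mm] := mateP ou (cu z zu) (ltnW xu).
  rewrite nm mm eqxx !andbT; apply/andP; split.
    by rewrite ltn_neqAle mN andbT; apply: contraNneq xz => e; rewrite -mm e muz.
  by apply/eqP => e; move: mm; rewrite e mz //; lia.
exists (fun z x y => ((x < u * 1) && (x %/ 1 != z)) && (y == mate u (c z) x)); split.
  move=> z zu; apply: (@dec_matching u) => x; rewrite muln1 divn1 => /andP[xu xz] //.
  by rewrite divn1; have /and4P[-> -> -> ->] := near z x zu xu xz.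
move=> x y; rewrite muln1 !divn1; have [xu|] := ltnP x u; last by rewrite big1.
rewrite (eq_big_seq (fun z => (y < u) * (y == mate u (c z) x))) => [|z]; last first.
  rewrite mem_iota => /andP[_ zu] /=; rewrite ?divn1 mulnb; have [->|xz] := eqVneq x z.
    by rewrite mz //; case: (y =P u) => [->|_]; rewrite ?ltnn ?andbF.
  have /and4P[mu _ _ _] := near z x zu xu xz.
  by rewrite /=; case: eqP => [->|_]; rewrite ?mu ?andbF.
rewrite -big_distrr /= -(big_map c xpredT (fun d => nat_of_bool (y == mate u d x))).
have ci : {in iota 0 u &, injective c}.
  by move=> a b; rewrite !mem_iota /c => /andP[_ au] /andP[_ bu]; casesif; lia.
have uc : uniq (map c (iota 0 u)) by rewrite map_inj_in_uniq ?iota_uniq.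
have sc : {subset map c (iota 0 u) <= iota 0 u} by move=> _ /mapP[z + ->]; rewrite !mem_iota; apply: cu.
have [|_ mc] := uniq_min_size uc sc; first by rewrite size_map.
rewrite (perm_big _ (uniq_perm uc (iota_uniq 0 u) mc)) mate_sum ?(ltnW xu) //.
by rewrite mulnb; case yu: (y < u) => //=; rewrite (ltnW yu).
Qed.

(** The rows z and z + 4 are involutions fixing just the two points of the pair z; they are the
    matchings for the hole z. *)
Definition pairs4 : seq (seq nat) :=
  [:: [:: 0; 1; 5; 7; 6; 2; 4; 3]; [:: 5; 6; 2; 3; 7; 0; 1; 4]; [:: 6; 3; 7; 1; 4; 5; 0; 2]; [:: 4; 2; 1; 5; 0; 3; 6; 7]; [:: 0; 1; 6; 4; 3; 7; 2; 5]; [:: 7; 4; 2; 3; 1; 6; 5; 0]; [:: 2; 7; 0; 6; 4; 5; 3; 1]; [:: 3; 5; 4; 0; 2; 1; 6; 7]].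

(** Four groups of size 1 would ask for matchings on three points; groups of size 2 avoid this. *)
Lemma frame2_4 : frame2 4 2.
Proof.
pose M t x := nth 0 (nth [::] pairs4 t) x.
exists (fun z x y => ((x < 8) && (x %/ 2 != z)) && (y == M z x) +
  (((x < 8) && (x %/ 2 != z)) && (y == M (z + 4) x))); split.
  move=> z z4; apply: (dec_add (k := 1)); apply: (@dec_matching 8) => x /andP[] //.
    by case: z z4 => [|[|[|[|]]]] // _; do 8?[case: x => [|x] //].
  by case: z z4 => [|[|[|[|]]]] // _; do 8?[case: x => [|x] //].
move=> x y; rewrite unlock /=.
by do 8?[case: x => [|x]; first by do 8?[case: y => [|y] //]].
Qed.

Definition frame4 u g := exists B : nat -> pt -> pt -> nat,
  (forall z, z < u -> dec 4 (4 * g) (bl (fun x => (x < u * g) && (x %/ g != z)) 4) (B z)) /\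
  forall p q, \sum_(z <- iota 0 u) B z p q =
    [&& p.1 < u * g, q.1 < u * g, p.1 %/ g != q.1 %/ g, p.2 < 4 & q.2 < 4].

(** The same points are cut into blocks of 2h for the matchings and into blocks of 4 for the labels;
    t * (2 * h) = 4 * g makes the groups of both readings agree. *)
Lemma frame4_of u t h g : 0 < t -> 0 < h -> t * (2 * h) = 4 * g -> frame2 u t -> frame4 u g.
Proof.
move=> t0 h0 e [B [BD BE]]; pose w := 2 * h; have w0 : 0 < w by rewrite muln_gt0.
pose d (p : pt) := p.1 * 4 + p.2.
have dq p q : p.2 < 4 -> q.2 < 4 -> d p = d q -> p = q.
  by case: p q => [a b] [a' b'] /= h1 h2; rewrite /d /= => E4; congr (_, _); lia.
have dw p : p.2 < 4 -> (d p %/ w < u * t) = (p.1 < u * g).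
  by move=> p4; rewrite ltn_divLR // -mulnA e mulnCA mulnC /d; lia.
have dg p : p.2 < 4 -> d p %/ w %/ t = p.1 %/ g.
  move=> p4; rewrite -divnMA [w * t]mulnC e /d divnMA.
  by rewrite divnMDl // (divn_small p4) addn0.
exists (fun z p q => B z (d p %/ w) (d q %/ w) * ((p.2 < 4) && (q.2 < 4))); split.
  move=> z zu; have := blow4 h0 (BD z zu); rewrite e.
  apply: (dec_map (f := fun q : nat * nat => ((q.1 * w + q.2) %/ 4, (q.1 * w + q.2) %% 4))).
  - move=> [x j] [y j']; rewrite !unfold_in /bl /= => /andP[_ jw] /andP[_ jw'] [e1 e2].
    have E4 : x * w + j = y * w + j' by rewrite (divn_eq (x * w + j) 4) (divn_eq (y * w + j') 4) e1 e2.
    have := congr1 (divn^~ w) E4; rewrite !divnMDl // !divn_small // !addn0 => ->.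
    by have := congr1 (modn^~ w) E4; rewrite !modnMDl !modn_small // => ->.
  - move=> [x j]; rewrite /bl /= => /andP[/andP[xu xz] jw].
    pose q : pt := ((x * w + j) %/ 4, (x * w + j) %% 4); have q4 : q.2 < 4 by rewrite ltn_pmod.
    have dqE : d q %/ w = x by rewrite /d /q /= -divn_eq divnMDl // divn_small // addn0.
    by have := dw q q4; have := dg q q4; rewrite dqE /q /= => <- <-; rewrite xu xz ltn_pmod.
  - move=> [y l]; rewrite /bl /= => /andP[/andP[yu yz] l4].
    exists (d (y, l) %/ w, d (y, l) %% w); last by rewrite /= -divn_eq /d /= divnMDl // modnMDl divn_small // modn_small // addn0.
    by rewrite /= ltn_pmod // andbT dw // dg // yu yz.
  - move=> [x j] [y j']; rewrite /bl /blift /= => /andP[_ jw] /andP[_ jw'].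
    by rewrite !ltn_pmod // muln1 /d /= -!divn_eq !divnMDl // !divn_small // !addn0 jw jw' muln1.
  move=> p q nz; have [nzB /andP[p4 q4]] : B z (d p %/ w) (d q %/ w) != 0 /\ (p.2 < 4) && (q.2 < 4).
    by move: nz; case: (_ && _); rewrite ?muln0 // muln1.
  have := dec_supp (BD z zu) nzB; rewrite /bl p4 q4 !andbT -!(dw _ p4) -!(dw _ q4) -!(dg _ p4) -!(dg _ q4).
  exact.
move=> p q; rewrite -big_distrl /= BE mulnb; congr nat_of_bool.
case p4: (p.2 < 4); last by rewrite !andbF.
by case q4: (q.2 < 4); rewrite ?andbF // !andbT !dw // !dg.
Qed.

(* The label n is the hole; it is filled when b holds. *)
Definition G b n := exists F H : pt -> pt -> nat,
  [/\ dec 4 (4 * n) (bl (fun x => x <= n) 4) F,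
      dec 4 3 (bl (fun x => (x <= n) && ((x != n) || b)) 4) H &
      forall p q, F p q + H p q =
        Kbl (fun x => x <= n) 4 p q * ~~ [&& p.1 == n, q.1 == n & ~~ b]].

Definition cols4 (L : seq (seq (seq nat))) : seq (seq (seq pt)) :=
  map (map (map (fun q => (q %/ 4, q %% 4)))) L.

Definition grid4 k : seq pt := [seq (x, l) | x <- iota 0 k, l <- iota 0 4].

Definition G_ok (b : bool) (n : nat) (L M : seq (seq (seq nat))) : bool :=
  [&& size L == 4 * n, size M == 3,
      all (fun F => all (fun c => size c == 4) F && perm_eq (flatten F) (grid4 n.+1)) (cols4 L),
      all (fun F => all (fun c => size c == 4) F && perm_eq (flatten F) (grid4 (n + b))) (cols4 M) &
      perm_by (grid4 n.+1) (larcs (cols4 L) ++ larcs (cols4 M)) [seq a <- [seq (p, q) | p <- grid4 n.+1, q <- grid4 n.+1]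
         | (a.1 != a.2) && ~~ [&& a.1.1 == n, a.2.1 == n & ~~ b]]].

Lemma G_table b n L M : G_ok b n L M -> G b n.
Proof.
have sL : size (cols4 L) = size L by rewrite size_map.
have sM : size (cols4 M) = size M by rewrite size_map.
rewrite /G_ok; move: (cols4 L) (cols4 M) sL sM => L' M' sL sM.
move=> /and5P[/eqP eL /eqP eM /allP FL /allP FM /perm_byP arc].
have ug k : uniq (grid4 k).
  by apply: allpairs_uniq; rewrite ?iota_uniq // => -[? ?] [? ?] _ _ [-> ->].
have gr k (q : pt) : (q \in grid4 k) = (q.1 < k) && (q.2 < 4).
  case: q => x l; apply/allpairsP/andP => [[[? ?] /= []]|[xk l4]]; last by exists (x, l); rewrite !mem_iota.
  by rewrite mem_iota => ? l4 [-> ->]; split=> //; move: l4; rewrite !inE; lia.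
exists (fun p q => count_mem (p, q) (larcs L')), (fun p q => count_mem (p, q) (larcs M')); split.
- exists L'; split=> [|F /FL /andP[sF /permP cF]|//]; first by rewrite sL eL.
  by split=> // -[x l]; rewrite cF count_uniq_mem // gr.
- exists M'; split=> [|F /FM /andP[sF /permP cF]|//]; first by rewrite sM eM.
  split=> // -[x l]; rewrite cF count_uniq_mem // gr /bl /=; congr nat_of_bool; congr (_ && _).
  by case: b {arc cF FM FL}; rewrite /= ?addn1 ?addn0 ?orbT ?andbT // orbF ltn_neqAle andbC.
move=> p q; have := permP arc (pred1 (p, q)); rewrite count_cat => ->.
rewrite count_uniq_mem; last first.
  by apply: filter_uniq; apply: allpairs_uniq => // -[? ?] [? ?] _ _ [-> ->].
rewrite mem_filter mulnb; congr nat_of_bool; rewrite [RHS]andbC /Kbl /=.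
have -> : ((p, q) \in [seq (p0, q0) | p0 <- grid4 n.+1,
    q0 <- grid4 n.+1]) = bl (fun x => x <= n) 4 p && bl (fun x => x <= n) 4 q.
  apply/allpairsP/andP => [[[? ?] /= [+ + [-> ->]]]|[bp bq]]; first by rewrite !gr.
  by exists (p, q); rewrite !gr.
by case: (bl _ _ p); case: (bl _ _ q); rewrite /= ?andbF ?andbT // andbC.
Qed.

Definition pl (s : seq nat) (A : pt -> pt -> nat) (p q : pt) : nat :=
  ((p.1 \in s) && (q.1 \in s)) * A (index p.1 s, p.2) (index q.1 s, q.2).

(** Each group, together with the common hole, carries an ingredient. Its factors of the first kind
    complete the frame factors that miss the group; those of the second kind are united over all
    groups. Only the group 0 takes [G b], so the hole is filled at most once. *)
Lemma G_fill b u g : 0 < u -> 0 < g -> frame4 u g -> G false g -> G b g -> G b (u * g).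
Proof.
move=> u0 g0 [B [BD BE]] [F0 [H0 [F0D H0D FH0]]] [F1 [H1 [F1D H1D FH1]]].
pose n := u * g; pose s z := rcons (iota (z * g) g) n; pose bz z := b && (z == 0).
have us z : z < u -> uniq (s z).
  by move=> zu; rewrite rcons_uniq iota_uniq mem_iota -mulSnr andbT /n; nia.
have ms z x : (x \in s z) = (x == n) || (x %/ g == z).
  rewrite mem_rcons inE mem_iota -mulSnr -ltn_divLR // -leq_divRL //; congr (_ || _); lia.
have ss z : size (s z) = g.+1 by rewrite size_rcons size_iota.
have ix z x : x \in s z -> index x (s z) <= g by rewrite -ltnS -(ss z) index_mem.
have idn z x : z < u -> x \in s z -> (index x (s z) == g) = (x == n).
  move=> zu xs; have -> : g = index n (s z).
    by rewrite /s -cats1 index_cat mem_iota -mulSnr (_ : _ && _ = false) ?size_iota /= ?eqxx ?addn0 // /n; nia.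
  by apply/eqP/eqP => [e|-> //]; rewrite -(nth_index 0 xs) e nth_index // ms eqxx.
pose FF z := pl (s z) (if z == 0 then F1 else F0); pose HH z := pl (s z) (if z == 0 then H1 else H0).
have FD z : z < u -> dec 4 (4 * g) (bl (fun x => x \in s z) 4) (FF z).
  move=> zu; have D : dec 4 (4 * g) (bl (fun x => x <= g) 4) (if z == 0 then F1 else F0) by case: ifP.
  apply: dec_ext (place (us z zu) _ D) => // [[x l]|x]; last by rewrite ss.
  by rewrite /bl /=; case xs: (x \in s z) => //=; rewrite -ltnS -(ss z) index_mem xs.
have HD z : z < u -> dec 4 3 (bl (fun x => (x \in s z) && ((x != n) || bz z)) 4) (HH z).
  move=> zu; have D : dec 4 3 (bl (fun x => (x <= g) && ((x != g) || bz z)) 4) (if z == 0 then H1 else H0).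
    by rewrite /bz; case: ifP => _; rewrite ?andbT ?andbF.
  apply: dec_ext (place (us z zu) _ D) => // [[x l]|x /andP[]]; last by rewrite ss.
  by rewrite /bl /=; case xs: (x \in s z) => //=; rewrite -ltnS -(ss z) index_mem xs idn.
have SE z p q : z < u -> FF z p q + HH z p q =
    Kbl (mem (s z)) 4 p q * ~~ [&& p.1 == n, q.1 == n & ~~ bz z].
  move=> zu; rewrite /FF /HH /pl -mulnDr.
  have -> : (if z == 0 then F1 else F0) (index p.1 (s z), p.2) (index q.1 (s z), q.2) +
      (if z == 0 then H1 else H0) (index p.1 (s z), p.2) (index q.1 (s z), q.2) =
      Kbl (fun x => x <= g) 4 (index p.1 (s z), p.2) (index q.1 (s z), q.2) *
      ~~ [&& index p.1 (s z) == g, index q.1 (s z) == g & ~~ bz z].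
    by rewrite /bz; case: (z == 0); [rewrite FH1 andbT|rewrite FH0 andbF].
  case: p q => [x l] [y l'] /=; rewrite /Kbl /bl /=.
  case xs: (x \in s z) => //=; case ys: (y \in s z); rewrite ?andbF //= mul1n !idn // !ix //=.
  congr (nat_of_bool _ * _); congr [&& _, _ & _]; rewrite !xpair_eqE; congr (~~ (_ && _)).
  by apply/eqP/eqP => [e|-> //]; rewrite -(nth_index 0 xs) e nth_index.
have lt_div x : (x %/ g < u) = (x < n) by rewrite ltn_divLR.
exists (fun p q => \sum_(z <- iota 0 u) (B z p q + FF z p q)), (fun p q => \sum_(z <- iota 0 u) HH z p q); split.
- have -> : 4 * (u * g) = \sum_(z <- iota 0 u) 4 * g.
    by rewrite big_const_seq count_predT size_iota iter_addn_0 mulnAC mulnA.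
  apply: dec_sum => z; rewrite mem_iota => /andP[_ zu].
  apply: dec_ext (dec_union _ (BD z zu) (FD z zu)) => // [[x l]|[x l]]; rewrite /bl /= ms.
    rewrite -/n -andb_orl; congr (_ && _).
    case: (x %/ g =P z) => [e|_]; last by rewrite andbT orbF; lia.
    by have xn : x < n by [rewrite -lt_div e]; rewrite !orbT; lia.
  move=> /andP[/andP[xn xz] _]; rewrite (negPf xz) orbF negb_and; apply/orP; left; move: xn; rewrite -/n; lia.
- have HU : dec 4 3 (fun p => has (fun z => bl (fun x => (x \in s z) && ((x != n) || bz z)) 4 p) (iota 0 u))
      (fun p q => \sum_(z <- iota 0 u) HH z p q).
    apply: dec_bigunion; first exact: iota_uniq.
      move=> i j [x l] _ _; rewrite /bl /= !ms /bz => /andP[/andP[h1 h2] _] /andP[/andP[h3 h4] _].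
      move: h1 h2 h3 h4; case: (x =P n) => /= [_ _ /andP[_ /eqP ->] _ /andP[_ /eqP ->] //|_ /eqP <- _ /eqP <- //].
    by move=> z; rewrite mem_iota => /andP[_ zu]; apply: HD.
  apply: dec_ext HU => // -[x l]; rewrite /bl /= -/n; apply/hasP/andP => [[z]|[/andP[xn xb] l4]].
    rewrite mem_iota /bz => /andP[_ zu] /= /andP[/andP[]]; rewrite ms.
    case: (x =P n) => [->|_] /= xz; first by move=> /andP[-> _] ->; rewrite leqnn.
    by move=> _ ->; have xn : x < n by [rewrite -lt_div (eqP xz)]; rewrite (ltnW xn).
  move: xb xn; rewrite /bz; have [->|ne] /= := eqVneq x n.
    by move=> hb _; exists 0; rewrite ?mem_iota //= ms eqxx hb l4.
  by move=> _ xn; exists (x %/ g); rewrite ?mem_iota ?ms ?eqxx ?orbT ?l4 //= ?(negPf ne) // add0n lt_div ltn_neqAle ne.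
move=> p q; rewrite big_split /= BE -addnA -big_split /=.
rewrite (eq_big_seq (fun z => Kbl (mem (s z)) 4 p q * ~~ [&& p.1 == n, q.1 == n & ~~ bz z])); last first.
  by move=> z; rewrite mem_iota => /andP[_ zu]; apply: SE.
case: p q => [x l] [y l']; rewrite /Kbl /bl /= -/n.
case: (l < 4); last by rewrite !andbF big1 // => z _; rewrite andbF.
case: (l' < 4); last by rewrite !andbF big1 // => z _; rewrite /= !andbF.
rewrite !andbT /=; under eq_bigr => z _ do rewrite !ms !andbT.
have cI c : c < u -> \sum_(z <- iota 0 u) (c == z) = 1.
  move=> cu; rewrite -(count_big (fun z => c == z)) (eq_count (a2 := pred1 c)).
    by rewrite count_uniq_mem ?iota_uniq // mem_iota cu.
  by move=> z; rewrite /= eq_sym.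
have c0 : \sum_(z <- iota 0 u) (bz z : nat) = b.
  rewrite /bz; case: b {bz HD SE HH FH1 H1D}; last by rewrite big1.
  by under eq_bigr => z _ do rewrite /= eq_sym; apply: cI.
have out z : n < z -> forall i, i \in iota 0 u -> (z %/ g == i) = false.
  move=> zn i; rewrite mem_iota => /andP[_ iu]; apply/eqP => e; move: (lt_div z); rewrite e; lia.
have [xn|xn|xn] := ltngtP x n; have [yn|yn|yn] := ltngtP y n; rewrite /= ?andbF ?andbT.
- under eq_bigr => z _ do rewrite muln1.
  case: (x %/ g =P y %/ g) => [e|ne] /=.
    rewrite add0n muln1 -e (eq_bigr (fun z => (x %/ g == z) * ((x, l) != (y, l')))) => [|z _].
      by rewrite -big_distrl /= cI ?mul1n // lt_div.
    by rewrite mulnb; case: (x %/ g == z).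
  rewrite big1 => [|z _]; last by case: eqP => // e; case: eqP => // e'; case: ne; rewrite e e'.
  rewrite addn0 muln1 (_ : (x, l) != (y, l')) //; by apply/eqP => -[e _]; rewrite e in ne.
- rewrite big1_seq // => z /andP[_ zi]; by rewrite (out _ yn) ?andbF.
- rewrite -yn in xn *; rewrite (_ : (x, l) != (y, l')) ?muln1; last by apply/eqP => -[e _]; rewrite e ltnn in xn.
  under eq_bigr => z _ do rewrite muln1 andbT; by rewrite cI // lt_div -yn.
- rewrite big1_seq // => z /andP[_ zi]; by rewrite (out _ xn).
- rewrite big1_seq // => z /andP[_ zi]; by rewrite (out _ xn).
- rewrite big1_seq // => z /andP[_ zi]; by rewrite (out _ xn).
- rewrite -xn in yn *; rewrite (_ : (x, l) != (y, l')) ?muln1; last by apply/eqP => -[e _]; rewrite e ltnn in yn.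
  under eq_bigr => z _ do rewrite muln1 andbT; by rewrite cI // lt_div -xn.
- rewrite big1_seq // => z /andP[_ zi]; by rewrite (out _ yn) ?andbF.
rewrite add0n (eq_bigr (fun z => ((x, l) != (y, l')) * bz z)) => [|z _]; last by rewrite negbK.
by rewrite -big_distrr /= c0 negbK.
Qed.

Lemma G_2 b : G b 2.
Proof.
case: b.
  by apply: (@G_table true 2
     [:: [:: [:: 0; 10; 3; 8]; [:: 1; 11; 4; 6]; [:: 2; 9; 5; 7]];
      [:: [:: 0; 5; 6; 9]; [:: 1; 3; 7; 10]; [:: 2; 4; 8; 11]];
      [:: [:: 1; 10; 9; 3]; [:: 2; 5; 11; 6]; [:: 0; 7; 8; 4]];
      [:: [:: 2; 11; 10; 4]; [:: 0; 3; 9; 7]; [:: 1; 8; 6; 5]];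
      [:: [:: 0; 9; 11; 5]; [:: 1; 4; 10; 8]; [:: 2; 6; 7; 3]];
      [:: [:: 0; 4; 7; 6]; [:: 1; 9; 10; 2]; [:: 3; 11; 8; 5]];
      [:: [:: 1; 5; 8; 7]; [:: 2; 10; 11; 0]; [:: 4; 9; 6; 3]];
      [:: [:: 2; 3; 6; 8]; [:: 0; 11; 9; 1]; [:: 5; 10; 7; 4]]]
     [:: [:: [:: 0; 6; 4; 3]; [:: 1; 2; 7; 11]; [:: 5; 9; 8; 10]];
      [:: [:: 1; 7; 5; 4]; [:: 2; 0; 8; 9]; [:: 3; 10; 6; 11]];
      [:: [:: 2; 8; 3; 5]; [:: 0; 1; 6; 10]; [:: 4; 11; 7; 9]]]); vm_compute.
by apply: (@G_table false 2
     [:: [:: [:: 3; 7; 8; 5]; [:: 1; 4; 6; 10]; [:: 0; 9; 2; 11]];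
      [:: [:: 0; 4; 8; 6]; [:: 2; 5; 7; 10]; [:: 1; 9; 3; 11]];
      [:: [:: 1; 5; 8; 7]; [:: 3; 6; 4; 10]; [:: 2; 9; 0; 11]];
      [:: [:: 2; 6; 8; 4]; [:: 0; 7; 5; 10]; [:: 3; 9; 1; 11]];
      [:: [:: 7; 3; 8; 1]; [:: 5; 0; 2; 10]; [:: 4; 9; 6; 11]];
      [:: [:: 4; 0; 8; 2]; [:: 6; 1; 3; 10]; [:: 5; 9; 7; 11]];
      [:: [:: 5; 1; 8; 3]; [:: 7; 2; 0; 10]; [:: 6; 9; 4; 11]];
      [:: [:: 6; 2; 8; 0]; [:: 4; 3; 1; 10]; [:: 7; 9; 5; 11]]]
     [:: [:: [:: 0; 1; 2; 3]; [:: 4; 5; 6; 7]];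
      [:: [:: 0; 3; 2; 1]; [:: 4; 7; 6; 5]];
      [:: [:: 0; 5; 2; 7]; [:: 1; 6; 3; 4]]]); vm_compute.
Qed.

Lemma G_4 b : G b 4.
Proof.
case: b.
  by apply: (@G_table true 4
     [:: [:: [:: 0; 11; 18; 8]; [:: 1; 12; 19; 9]; [:: 2; 13; 15; 5]; [:: 3; 14; 16; 6]; [:: 4; 10; 17; 7]];
      [:: [:: 0; 10; 6; 19]; [:: 1; 11; 7; 15]; [:: 2; 12; 8; 16]; [:: 3; 13; 9; 17]; [:: 4; 14; 5; 18]];
      [:: [:: 0; 12; 18; 5]; [:: 1; 13; 19; 6]; [:: 2; 14; 15; 7]; [:: 3; 10; 16; 8]; [:: 4; 11; 17; 9]];
      [:: [:: 0; 17; 14; 9]; [:: 1; 18; 10; 5]; [:: 2; 19; 11; 6]; [:: 3; 15; 12; 7]; [:: 4; 16; 13; 8]];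
      [:: [:: 2; 16; 17; 12]; [:: 6; 15; 9; 7]; [:: 0; 13; 14; 18]; [:: 3; 8; 5; 11]; [:: 1; 19; 10; 4]];
      [:: [:: 3; 17; 18; 13]; [:: 7; 16; 5; 8]; [:: 1; 14; 10; 19]; [:: 4; 9; 6; 12]; [:: 2; 15; 11; 0]];
      [:: [:: 4; 18; 19; 14]; [:: 8; 17; 6; 9]; [:: 2; 10; 11; 15]; [:: 0; 5; 7; 13]; [:: 3; 16; 12; 1]];
      [:: [:: 0; 19; 15; 10]; [:: 9; 18; 7; 5]; [:: 3; 11; 12; 16]; [:: 1; 6; 8; 14]; [:: 4; 17; 13; 2]];
      [:: [:: 1; 15; 16; 11]; [:: 5; 19; 8; 6]; [:: 4; 12; 13; 17]; [:: 2; 7; 9; 10]; [:: 0; 18; 14; 3]];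
      [:: [:: 2; 3; 9; 19]; [:: 0; 16; 7; 1]; [:: 4; 8; 13; 6]; [:: 10; 15; 18; 11]; [:: 5; 12; 14; 17]];
      [:: [:: 3; 4; 5; 15]; [:: 1; 17; 8; 2]; [:: 0; 9; 14; 7]; [:: 11; 16; 19; 12]; [:: 6; 13; 10; 18]];
      [:: [:: 4; 0; 6; 16]; [:: 2; 18; 9; 3]; [:: 1; 5; 10; 8]; [:: 12; 17; 15; 13]; [:: 7; 14; 11; 19]];
      [:: [:: 0; 1; 7; 17]; [:: 3; 19; 5; 4]; [:: 2; 6; 11; 9]; [:: 13; 18; 16; 14]; [:: 8; 10; 12; 15]];
      [:: [:: 1; 2; 8; 18]; [:: 4; 15; 6; 0]; [:: 3; 7; 12; 5]; [:: 14; 19; 17; 10]; [:: 9; 11; 13; 16]];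
      [:: [:: 2; 17; 19; 18]; [:: 0; 14; 8; 15]; [:: 4; 6; 7; 11]; [:: 5; 16; 10; 13]; [:: 1; 9; 12; 3]];
      [:: [:: 3; 18; 15; 19]; [:: 1; 10; 9; 16]; [:: 0; 7; 8; 12]; [:: 6; 17; 11; 14]; [:: 2; 5; 13; 4]]]
     [:: [:: [:: 4; 19; 16; 15]; [:: 2; 11; 5; 17]; [:: 1; 8; 9; 13]; [:: 7; 18; 12; 10]; [:: 3; 6; 14; 0]];
      [:: [:: 0; 15; 17; 16]; [:: 3; 12; 6; 18]; [:: 2; 9; 5; 14]; [:: 8; 19; 13; 11]; [:: 4; 7; 10; 1]];
      [:: [:: 1; 16; 18; 17]; [:: 4; 13; 7; 19]; [:: 3; 5; 6; 10]; [:: 9; 15; 14; 12]; [:: 0; 8; 11; 2]]]); vm_compute.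
by apply: (@G_table false 4
     [:: [:: [:: 0; 10; 5; 17]; [:: 4; 15; 9; 12]; [:: 1; 3; 8; 16]; [:: 11; 13; 19; 14]; [:: 2; 7; 18; 6]];
      [:: [:: 1; 11; 6; 17]; [:: 5; 12; 10; 13]; [:: 2; 0; 9; 16]; [:: 8; 14; 19; 15]; [:: 3; 4; 18; 7]];
      [:: [:: 2; 8; 7; 17]; [:: 6; 13; 11; 14]; [:: 3; 1; 10; 16]; [:: 9; 15; 19; 12]; [:: 0; 5; 18; 4]];
      [:: [:: 3; 9; 4; 17]; [:: 7; 14; 8; 15]; [:: 0; 2; 11; 16]; [:: 10; 12; 19; 13]; [:: 1; 6; 18; 5]];
      [:: [:: 4; 14; 9; 17]; [:: 8; 3; 13; 0]; [:: 5; 7; 12; 16]; [:: 15; 1; 19; 2]; [:: 6; 11; 18; 10]];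
      [:: [:: 5; 15; 10; 17]; [:: 9; 0; 14; 1]; [:: 6; 4; 13; 16]; [:: 12; 2; 19; 3]; [:: 7; 8; 18; 11]];
      [:: [:: 6; 12; 11; 17]; [:: 10; 1; 15; 2]; [:: 7; 5; 14; 16]; [:: 13; 3; 19; 0]; [:: 4; 9; 18; 8]];
      [:: [:: 7; 13; 8; 17]; [:: 11; 2; 12; 3]; [:: 4; 6; 15; 16]; [:: 14; 0; 19; 1]; [:: 5; 10; 18; 9]];
      [:: [:: 8; 2; 13; 17]; [:: 12; 7; 1; 4]; [:: 9; 11; 0; 16]; [:: 3; 5; 19; 6]; [:: 10; 15; 18; 14]];
      [:: [:: 9; 3; 14; 17]; [:: 13; 4; 2; 5]; [:: 10; 8; 1; 16]; [:: 0; 6; 19; 7]; [:: 11; 12; 18; 15]];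
      [:: [:: 10; 0; 15; 17]; [:: 14; 5; 3; 6]; [:: 11; 9; 2; 16]; [:: 1; 7; 19; 4]; [:: 8; 13; 18; 12]];
      [:: [:: 11; 1; 12; 17]; [:: 15; 6; 0; 7]; [:: 8; 10; 3; 16]; [:: 2; 4; 19; 5]; [:: 9; 14; 18; 13]];
      [:: [:: 12; 6; 1; 17]; [:: 0; 11; 5; 8]; [:: 13; 15; 4; 16]; [:: 7; 9; 19; 10]; [:: 14; 3; 18; 2]];
      [:: [:: 13; 7; 2; 17]; [:: 1; 8; 6; 9]; [:: 14; 12; 5; 16]; [:: 4; 10; 19; 11]; [:: 15; 0; 18; 3]];
      [:: [:: 14; 4; 3; 17]; [:: 2; 9; 7; 10]; [:: 15; 13; 6; 16]; [:: 5; 11; 19; 8]; [:: 12; 1; 18; 0]];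
      [:: [:: 15; 5; 0; 17]; [:: 3; 10; 4; 11]; [:: 12; 14; 7; 16]; [:: 6; 8; 19; 9]; [:: 13; 2; 18; 1]]]
     [:: [:: [:: 0; 1; 2; 3]; [:: 4; 5; 6; 7]; [:: 8; 9; 10; 11]; [:: 12; 13; 14; 15]];
      [:: [:: 0; 3; 2; 1]; [:: 4; 7; 6; 5]; [:: 8; 11; 10; 9]; [:: 12; 15; 14; 13]];
      [:: [:: 0; 4; 8; 12]; [:: 1; 5; 9; 13]; [:: 2; 6; 10; 14]; [:: 3; 7; 11; 15]]]); vm_compute.
Qed.

(** If n is 2 or 4 times an odd number, frames with that odd number of groups apply; otherwise 8
    divides n, and four groups of n / 4 labels lead back to a smaller even number. *)
Lemma G_even b n : 0 < n -> ~~ odd n -> G b n.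
Proof.
elim/ltn_ind: n b => n IH b n0 en.
have [h hE] : exists h, n = h.*2 by exists n./2; have := odd_double_half n; rewrite (negPf en); lia.
have [oh|eh] := boolP (odd h).
  have [h1|h3] := eqVneq h 1; first by rewrite hE h1; apply: G_2.
  rewrite hE -muln2; apply: G_fill => //; [by case: (h) oh| |exact: G_2|exact: G_2].
  by apply: (@frame4_of h 1 4 2) => //; apply: frame2_odd.
have [k kE] : exists k, h = k.*2 by exists h./2; have := odd_double_half h; rewrite (negPf eh); lia.
have [ok|ek] := boolP (odd k).
  have [k1|k3] := eqVneq k 1; first by rewrite hE kE k1; apply: G_4.
  have -> : n = k * 4 by lia.
  apply: G_fill => //; [by case: (k) ok| |exact: G_4|exact: G_4].
  by apply: (@frame4_of k 1 8 4) => //; apply: frame2_odd.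
have -> : n = 4 * k by lia.
have k0 : 0 < k by lia.
apply: G_fill => //; try (by apply: IH => //; lia).
by apply: (@frame4_of 4 2 k k) => //; [lia|apply: frame2_4].
Qed.

(** Replaces K*_4 as the ingredient of [dec_pairs], with whole labels of 4 points in place of
    halves. *)
Lemma four_8 : dec 4 7 (fun x => x < 8) (Kstar 8).
Proof.
exact: (@dec_table 4 8
  [:: [:: [:: 2; 5; 6; 3]; [:: 0; 7; 1; 4]];
      [:: [:: 3; 4; 7; 5]; [:: 0; 2; 1; 6]];
      [:: [:: 2; 6; 7; 4]; [:: 0; 1; 3; 5]];
      [:: [:: 1; 5; 4; 6]; [:: 0; 3; 7; 2]];
      [:: [:: 1; 7; 6; 4]; [:: 0; 5; 2; 3]];
      [:: [:: 2; 7; 3; 6]; [:: 0; 4; 5; 1]];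
      [:: [:: 0; 6; 5; 7]; [:: 1; 2; 4; 3]]]).
Qed.

Theorem m4_all a : 1 < a -> dec 4 (a * 4).-1 (fun x => x < a * 4) (Kstar (a * 4)).
Proof.
move=> a1; have [oa|ea] := boolP (odd a).
  (* The hole is one of the a labels, so the even number a - 1 enters. *)
  have [F [H [FD HD FH]]] := @G_even true a.-1 ltac:(lia) ltac:(lia).
  have -> : (a * 4).-1 = 4 * a.-1 + 3 by lia.
  apply: dec_flat => //; apply: dec_ext (dec_add FD (dec_ext _ (fun _ _ => erefl) HD)) => //.
  - by move=> [x l]; rewrite /bl /=; congr (_ && _); lia.
  - move=> p q; rewrite FH /= !andbF muln1 /Kbl /bl; congr nat_of_bool; congr [&& _ && _, _ && _ & _]; lia.
  by move=> [x l]; rewrite /bl /= orbT andbT.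
have -> : a = a.-1.+1 by lia.
apply: dec_pairs => //; first by lia.
- by move=> k V A; apply: (@blow4 2).
exact: four_8.
Qed.

(** * Collecting the cases *)

Lemma dec_odd m a : odd m -> 2 < m -> 2 < a -> dec m (a * m).-1 (fun x => x < a * m) (Kstar (a * m)).
Proof.
move=> mo m2 a2; have [->|a14] := eqVneq a 14; first exact: R14.
apply: R_of_E => //; first by lia.
have -> : a = a.-1.+1 by lia.
apply: E_all => //; try lia; first by move=> u; apply: frames_odd.
by move=> n; apply: small_odd.
Qed.

Lemma dec_even m a : ~~ odd m -> 2 < m -> 1 < a -> dec m (a * m).-1 (fun x => x < a * m) (Kstar (a * m)).
Proof.
move=> me m2 a1; have [->|m4] := eqVneq m 4; first exact: m4_all.
have [->|m6] := eqVneq m 6; first by have := even6 a1; rewrite (_ : a.*2 * 3 = a * 6) //; lia.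
have [h hE] : exists h, m = 2 * h by exists m./2; have := odd_double_half m; rewrite (negPf me); lia.
(* Twice as many half-labels of m / 2 points: their number is even, as the one-factorization
   requires. *)
have -> : a * m = (a.*2.-1).+1 * h by rewrite hE; nia.
apply: dec_pairs; [by lia|by lia| |].
  by move=> k V A; rewrite hE; apply: dec_edges; lia.
by rewrite -hE; apply: ham => //; lia.
Qed.

Lemma dec_two m : odd m -> 3 < m -> dec m (2 * m).-1 (fun x => x < 2 * m) (Kstar (2 * m)).
Proof.
move=> mo m3; have e : m = (2 * m./2).+1 by have := odd_double_half m; rewrite mo; lia.
have h1 : 1 < m./2 by lia.
have e2 : (4 * m./2).+1 = (2 * m).-1 by lia.
by have := two_groups h1; rewrite -e e2 (@prednK (2 * m)) //; lia.
Qed.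

Theorem theorem4 (alpha m : nat) (halpha : 1 <= alpha) (hm : 3 <= m) :
  (exists L : seq (seq (seq 'I_(alpha * m))), @Cm_factorization (alpha * m) m L)
  <-> ~ ((alpha, m) \in [:: (1, 6); (1, 4); (2, 3)]).
Proof.
split=> [H|H].
  rewrite !inE !xpair_eqE => /or3P[] /andP[/eqP ea /eqP em]; subst alpha m.
  - exact: no_1_6.
  - exact: no_1_4.
  exact: no_2_3.
apply: (@dec_factorization _ _ (alpha * m).-1).
have {H} : ~~ ((alpha, m) \in [:: (1, 6); (1, 4); (2, 3)]) by apply/negP.
rewrite !inE !xpair_eqE; have [a1|a1] := eqVneq alpha 1.
  by rewrite a1 mul1n => H; apply: ham; lia.
have [om|em] := boolP (odd m); last by move=> _; apply: dec_even => //; lia.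
have [a2|a2] := eqVneq alpha 2; last by move=> _; apply: dec_odd => //; lia.
by rewrite a2 => H; apply: dec_two => //; lia.
Qed.
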